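(* Consider a state space $(\Sigma,\mathcal{B},\mu)$ with a cemetery state $\Delta$ and a Markov chain $(Z_k)_{k\ge1}$ on $\Sigma$ with transition densities $g(\cdot,\cdot)$ with respect to $\mu$ and $Z_1$ distributed as $g(Z_0,z)\mu(dz)$. Let $G_n$ be the associated soft local time under $\mathbb{Q}$. Then $z\mapsto E^{\mathbb{Q}}[G_{T_\Delta}(z)]$ is the expected local time density of $(Z_k)_{k\le T_\Delta}$ with respect to $\mu$, i.e. $$E^{\mathcal{P}}\Big(\sum_{k\le T_\Delta}f(Z_k)\Big)=\int_\Sigma f(z)\,E^{\mathbb{Q}}[G_{T_\Delta}(z)]\,\mu(dz)$$ for every non-negative measurable $f$ on $\Sigma$ with $f(\Delta)=0$. The result is also true when $T_\Delta$ is replaced by a deterministic time.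
   Context: $\Sigma$ is a locally compact Polish metric space with Borel $\sigma$-algebra $\mathcal{B}$, $\mu$ a Radon measure. The Markov chain (law $\mathcal{P}$) satisfies $\mathcal{P}[Z_{k+1}\in dz\mid Z_k]=g(Z_k,z)\mu(dz)$, $k\ge1$, with $g:\Sigma\times\Sigma\to\mathbb{R}_+$ measurable in each coordinate and of $\mu$-integral one in the second coordinate; $Z_0$ is only a notation for the initial density $g(Z_0,\cdot)$ of $Z_1$. A cemetery is an element $\Delta\in\Sigma$ with $\mu(\{\Delta\})=1$ and $g(\Delta,\cdot)=1_{\{\Delta\}}(\cdot)$; $T_\Delta$ is the hitting time of $\Delta$ (by $(Z_k)_{k\ge1}$ under $\mathcal{P}$, and by the chain $(z_k)_{k\ge1}$ below under $\mathbb{Q}$). Test functions $f$ are assumed to vanish at $\Delta$. Soft local time: under $\mathbb{Q}$, $\eta=\sum_{\lambda\in\Lambda}\delta_{(z_\lambda,v_\lambda)}$ is a Poisson point process on $\Sigma\times\mathbb{R}_+$ with intensity $\mu\otimes dv$. With $G_0\equiv0$, $z_0=Z_0$, define iteratively for $n\ge1$ (almost surely): $\xi_n=\inf\{t\ge0:\exists(z_\lambda,v_\lambda)\notin\{(z_k,v_k)\}_{k=1}^{n-1}\text{ with }G_{n-1}(z_\lambda)+t\,g(z_{n-1},z_\lambda)\ge v_\lambda\}$; $G_n(z)=G_{n-1}(z)+\xi_n g(z_{n-1},z)$; $(z_n,v_n)$ is the unique pair $(z_\lambda,v_\lambda)\notin\{(z_k,v_k)\}_{k=1}^{n-1}$ with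 $G_n(z_\lambda)=v_\lambda$. The sequence $(z_n)$ has the law of $(Z_n)$. $G_n$ is the soft local time up to time $n$.
   Formalization: The transition density g is assumed jointly measurable on Σ×Σ rather than measurable in each coordinate; with coordinatewise measurability alone the identity can fail (under the continuum hypothesis). *)

(* Defs.v *)
From HB Require Import structures.
From mathcomp Require Import all_boot all_order all_algebra.
From mathcomp Require Import all_classical all_reals all_analysis.
From mathcomp Require Import measurable_realfun.

Set Implicit Arguments.
Unset Strict Implicit.
Unset Printing Implicit Defensive.

Import Order.TTheory GRing.Theory Num.Theory.
Import numFieldNormedType.Exports.

Local Open Scope classical_set_scope.
Local Open Scope ring_scope.
Local Open Scope ereal_scope.

#[short(type="completeMetricType")]
HB.structure Definition CompleteMetric (K : numDomainType) :=
  {M of Metric K M & Complete M}.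

Notation borel S := (g_sigma_algebraType (@open S)).

Definition separable (S : topologicalType) : Prop :=
  exists2 A : set S, countable A & dense A.

Definition radon_measure (R : realType) (S : completeMetricType R)
    (mu : {measure set (borel S) -> \bar R}) : Prop :=
  (forall K : set S, compact K -> mu K < +oo) /\
  (forall A : set S, measurable (A : set (borel S)) ->
     mu A = ereal_sup [set mu K | K in [set K : set S | compact K /\ K `<=` A]]).

Definition mutually_independent d (Om : measurableType d) (R : realType)
    (Q : probability Om R) (n : nat) (X : 'I_n -> Om -> \bar R) : Prop :=
  forall B : 'I_n -> set (\bar R), (forall i, measurable (B i)) ->
  fine (Q (\bigcap_i (X i @^-1` B i))) =
  (\prod_(i < n) fine (Q (X i @^-1` B i)))%R.

(* The random measure $\eta=\sum_{\lambda\in\Lambda}\delta_{pt_\lambda}$; the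
   random index set Lam is countable, hence without loss of generality made of
   integers. No measurability of Lam or pt is assumed separately. *)
Definition point_measure (R : realType) (Om : Type) dE (E : measurableType dE)
    (Lam : Om -> set nat) (pt : nat -> Om -> E) (w : Om) (A : set E) : \bar R :=
  \esum_(i in Lam w) \d_(pt i w) A.
Arguments point_measure R {Om dE E}.

Definition point_set (Om E : Type)
    (Lam : Om -> set nat) (pt : nat -> Om -> E) (w : Om) : set E :=
  [set pt i w | i in Lam w].

(* The second argument of poisson_prob is a dummy. *)
Record poisson_point_process d (Om : measurableType d) (R : realType)
    (Q : probability Om R) dE (E : measurableType dE) (m : set E -> \bar R)
    (Lam : Om -> set nat) (pt : nat -> Om -> E) : Prop := {
  ppp_measurable : forall A, measurable A ->
    measurable_fun setT (fun w => point_measure R Lam pt w A) ;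
  ppp_law : forall A, measurable A -> m A < +oo -> forall k : nat,
    Q [set w | point_measure R Lam pt w A = k%:R%:E] =
    poisson_prob (fine (m A)) 0%N [set k] ;
  ppp_law_infty : forall A, measurable A -> m A = +oo ->
    Q [set w | point_measure R Lam pt w A = +oo] = 1 ;
  ppp_independent : forall (n : nat) (A : 'I_n -> set E),
    (forall i, measurable (A i)) -> trivIset setT A ->
    mutually_independent Q (fun i w => point_measure R Lam pt w (A i)) }.

(* The measure $\mu\otimes dv$ of $\Sigma\times\mathbb{R}_+$, as a measure on
   $\Sigma\times\mathbb{R}$. *)
Definition slt_intensity d (T : measurableType d) (R : realType)
    (mu : set T -> \bar R) (A : set (T * R)) : \bar R :=
  (mu \x (@lebesgue_measure R)) (A `&` [set p | 0 <= p.2]%R).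

Definition probability_density d (T : measurableType d) (R : realType)
    (mu : set T -> \bar R) (h : T -> R) : Prop :=
  [/\ measurable_fun setT h, (forall z, 0 <= h z)%R &
      \int[mu]_z (h z)%:E = 1].

(* Joint measurability: coordinatewise measurability alone would not make
   $x\mapsto\int_A g(x,z)\mu(dz)$ or the soft local times measurable. *)
Record transition_density d (T : measurableType d) (R : realType)
    (mu : set T -> \bar R) (g : T -> T -> R) : Prop := {
  td_measurable : measurable_fun setT (fun p : T * T => g p.1 p.2) ;
  td_density : forall x, probability_density mu (g x) }.

Definition cemetery d (T : measurableType d) (R : realType)
    (mu : set T -> \bar R) (g : T -> T -> R) (D : T) : Prop :=
  mu [set D] = 1 /\ g D = \1_[set D].

(* The sigma-algebra generated by Z_1, ..., Z_k. *)
Definition past (Om : Type) d (T : measurableType d)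
    (Z : nat -> Om -> T) (k : nat) : set (set Om) :=
  <<s [set F | exists j, (1 <= j <= k)%N /\
         exists2 B, measurable B & F = Z j @^-1` B] >>.

(* Only (Z k) for k >= 1 is meaningful; g0 is the density written
   $g(Z_0,\cdot)$. *)
Record markov_chain d (Om : measurableType d) (R : realType)
    (P : probability Om R) dT (T : measurableType dT) (mu : set T -> \bar R)
    (g0 : T -> R) (g : T -> T -> R) (Z : nat -> Om -> T) : Prop := {
  mc_measurable : forall k, (0 < k)%N -> measurable_fun setT (Z k) ;
  mc_initial : forall A, measurable A ->
    P (Z 1%N @^-1` A) = \int[mu]_(z in A) (g0 z)%:E ;
  mc_transition : forall k A F, (0 < k)%N -> measurable A -> past Z k F ->
    P (F `&` Z k.+1 @^-1` A) =
    \int[P]_(w in F) \int[mu]_(z in A) (g (Z k w) z)%:E }.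

(* Random times take values in [option nat], None standing for +oo. *)
Definition hitting_time (H : nat -> Prop) : option nat :=
  match pselect (exists k, (0 < k)%N && `[< H k >]) with
  | left hit => Some (ex_minn hit)
  | right _ => None
  end.

Definition sum_until (R : realType) (tau : option nat) (u : nat -> \bar R) :
    \bar R :=
  if tau is Some n then \sum_(1 <= k < n.+1) u k else \sum_(1 <= k <oo) u k.

Section soft_local_time.
Local Open Scope ring_scope.
Context {R : realType} {T : choiceType}.
Variables (g0 : T -> R) (g : T -> T -> R).
(* A realization of the point process, and a default value for the selected
   point, used only on a null event. *)
Variables (pts : set (T * R)) (p0 : T * R).

(* [used] lists the points (z_k, v_k) selected so far, the last one first. The
   current position is None before the first step: it is the notation Z_0. *)
Definition slt_position (used : seq (T * R)) : option T :=
  omap fst (ohead used).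

Definition density_from (x : option T) : T -> R :=
  if x is Some y then g y else g0.

(* The set is almost surely nonempty; otherwise inf is 0. *)
Definition slt_xi (used : seq (T * R)) (G : T -> R) : R :=
  inf [set t | 0 <= t /\ exists p, [/\ pts p, p \notin used &
         G p.1 + t * density_from (slt_position used) p.1 >= p.2]].

Definition slt_step (st : seq (T * R) * (T -> R)) : seq (T * R) * (T -> R) :=
  let: (used, G) := st in
  let G' z := G z + slt_xi used G * density_from (slt_position used) z in
  (xget p0 [set p | [/\ pts p, p \notin used & G' p.1 = p.2]] :: used, G').

Definition slt_state (n : nat) : seq (T * R) * (T -> R) :=
  iter n slt_step ([::], fun=> 0).

Definition soft_local_time (n : nat) : T -> R := (slt_state n).2.

Definition slt_chain (n : nat) : option T := slt_position (slt_state n).1.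

Definition soft_local_time_at (tau : option nat) (z : T) : \bar R :=
  if tau is Some n then (soft_local_time n z)%:E
  else limn (fun n => (soft_local_time n z)%:E).

End soft_local_time.

(* h is the density with respect to mu of the expected local time of
   (Z_k)_{1 <= k <= tau}, against test functions vanishing at D. *)
Definition expected_local_time_density d (Om : measurableType d) (R : realType)
    (P : probability Om R) dT (T : measurableType dT) (mu : set T -> \bar R)
    (D : T) (Z : nat -> Om -> T) (tau : Om -> option nat) (h : T -> \bar R) :
    Prop :=
  measurable_fun setT h /\
  forall f : T -> \bar R, measurable_fun setT f -> (forall z, 0 <= f z) ->
    f D = 0 ->
    \int[P]_w sum_until (tau w) (fun k => f (Z k w)) = \int[mu]_z (f z * h z).

(* Main.v *)
Require Import Defs.
From HB Require Import structures.
From mathcomp Require Import all_boot all_order all_algebra.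
From mathcomp Require Import all_classical all_reals all_analysis.
From mathcomp Require Import measurable_realfun finmap.
From mathcomp Require Import ring lra.

Set Implicit Arguments.
Unset Strict Implicit.
Unset Printing Implicit Defensive.

Import Order.TTheory GRing.Theory Num.Theory.
Import numFieldNormedType.Exports.

Local Open Scope classical_set_scope.
Local Open Scope ring_scope.
Local Open Scope ereal_scope.

(** Write Y_0, Y_1, ... for the positions selected by the soft local time
    construction, xi_1, xi_2, ... for its waiting times, and g_k(y, .) for the
    density of the k-th step from y, which is g0 for k = 0 and g(y, .)
    otherwise. Then G_n(z) is the sum over k < n of xi_{k+1} g_k(Y_k, z). The
    strong Markov property of the Poisson process says that, after n steps, the
    points not selected yet, with heights measured from the graph of G_n, form
    again a Poisson process with the initial intensity, independent of Y_n.
    Hence xi_{n+1} is exponential of parameter one given Y_n, because the region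
    swept in time t has mass t, and Y_{n+1} has density g_n(Y_n, .) given Y_n.
    Taking expectations, E G_n(z) is the sum over k < n of
    u_k(z) = E g_k(Y_k, z), and u_k is at the same time the density of Y_{k+1},
    which has the law of Z_{k+1}. Integrating f against this sum gives the
    statement at a fixed time. For the hitting time of D, the state D is
    absorbing, f vanishes there and g(D, .) vanishes elsewhere, so that both
    sides are the limits of the sides at fixed times.

    The Markov property is obtained from void probabilities alone. The invariant
    [void_law] says that Q(Y in C, no point of N in A) is Q(Y in C) exp(-m(A)).
    Counting the cells of a fine partition that N meets recovers the number of
    points ([ncells_cvg]), so void events determine everything else: the mean
    counts ([expected_count]), the independence of Y and N, in the form of an
    integration formula for regions A that depend on Y ([freezing]), and the
    Mecke formula ([mecke_formula]), where a point of N is replaced by an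
    independent point with law m. The point p selected by a step is the only
    one such that the region below the multiple of the graph of g_k that passes
    through p contains no other point. The Mecke formula therefore gives the
    joint law of the new position and of the void events of the new
    configuration ([prob_event]), which is the invariant again
    ([void_law_next]). The rest is deterministic: on an event of probability one
    the iterated steps are the soft local time construction
    ([soft_local_time_sum], [slt_chain_position]).

    The soft local times need not be measurable outside this event. This is
    harmless because integrals of non-negative functions are lower integrals
    ([ge0_integral_off_null]). *)

(** * Separating partitions and counting *)

Section cells.
Context {dE : measure_display} {E : measurableType dE}.
Variables (U : nat -> set E) (mU : forall i, measurable (U i)).
Hypothesis sepU : forall p q, (forall i, U i p <-> U i q) -> p = q.

(** The first k bits of the address of p in a separating family of sets. *)
Definition code (k : nat) (p : E) : {ffun 'I_k -> bool} :=
  [ffun i : 'I_k => `[< U i p >]].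

Definition cell (k : nat) (c : {ffun 'I_k -> bool}) : set E :=
  [set p | code k p = c].

Lemma measurable_cell k (c : {ffun 'I_k -> bool}) : measurable (cell c).
Proof using mU.
rewrite (_ : cell c =
  \bigcap_(i in [set: 'I_k]) (if c i then U i else ~` U i)).
  apply: fin_bigcap_measurable => // i _.
  by case: (c i) => //; exact: measurableC.
apply/seteqP; split => [p <- i _|p h]; first by rewrite ffunE; case: asboolP.
by apply/ffunP => i; move: (h i I); rewrite ffunE; case: asboolP; case: (c i).
Qed.

Lemma measurable_point (p : E) : measurable [set p].
Proof using mU sepU.
rewrite (_ : [set p] = \bigcap_i (if `[< U i p >] then U i else ~` U i)).
  by apply: bigcapT_measurable => i; case: ifP => // _; exact: measurableC.
apply/seteqP; split => [_ -> i _|q h]; first by case: asboolP.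
by apply: sepU => i; move: (h i I); case: asboolP.
Qed.

Lemma code_sub j k p q : (j <= k)%N -> code k p = code k q ->
  code j p = code j q.
Proof.
move=> jk /ffunP h; apply/ffunP => i.
by have := h (widen_ord jk i); rewrite !ffunE.
Qed.

(** Finitely many points have pairwise distinct addresses, and each difference
    shows at a finite level. *)
Lemma code_separates (s : seq E) : exists k, forall j, (k <= j)%N ->
  {in s &, injective (code j)}.
Proof using sepU.
have : forall pq : E * E, exists i, pq.1 <> pq.2 -> ~ (U i pq.1 <-> U i pq.2).
  move=> [p q]/=; have [->|pq] := pselect (p = q); first by exists 0%N.
  apply: contrapT => /forallNP h; apply: pq; apply: sepU => i.
  by have := h i; rewrite not_implyE notE => -[].
move=> /choice[f hf].
exists (\max_(x <- [seq (p, q) | p <- s, q <- s]) f x).+1 => j kj p q ps qs pq.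
apply: contrapT => npq; apply: (hf (p, q) npq) => /=.
have fj : (f (p, q) < j)%N.
  apply: leq_trans kj; rewrite ltnS.
  by apply: leq_bigmax_seq => //; apply/allpairsP; exists (p, q).
move/ffunP: pq => /(_ (Ordinal fj)); rewrite !ffunE/=.
by case: asboolP; case: asboolP.
Qed.

(** Increases to the number of points of B as the cells shrink, and is a finite
    sum of indicators of events of the form: B meets a given set. *)
Definition ncells (k : nat) (B : set E) : nat :=
  #|[pred c : {ffun 'I_k -> bool} | `[< cell c `&` B !=set0 >]]|.

Lemma ncells_nd B : {homo ncells ^~ B : j k / (j <= k)%N}.
Proof.
move=> j k jk; rewrite /ncells.
pose r (c : {ffun 'I_k -> bool}) := [ffun i : 'I_j => c (widen_ord jk i)].
apply: leq_trans (leq_image_card r _); apply: subset_leq_card.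
apply/fintype.subsetP => c; rewrite inE => /asboolP[p [/= <- Bp]].
apply/fintype.imageP; exists (code k p); first by rewrite inE; apply/asboolP; exists p.
by apply/ffunP => i; rewrite !ffunE.
Qed.

Lemma ncells_le (s : seq E) k : (ncells k [set` s] <= size s)%N.
Proof.
rewrite /ncells -(size_map (code k)).
apply: leq_trans (card_size _); apply: subset_leq_card.
apply/fintype.subsetP => c; rewrite inE => /asboolP[p [/= <- ps]].
exact: map_f.
Qed.

Lemma ncells_ge (s : seq E) B : uniq s -> [set` s] `<=` B ->
  exists k, forall j, (k <= j)%N -> (size s <= ncells j B)%N.
Proof using sepU.
move=> us sB; have [k hk] := code_separates s; exists k => j kj.
have /card_uniqP um : uniq (map (code j) s) by rewrite map_inj_in_uniq//; exact: hk.
rewrite -(size_map (code j)) -um /ncells; apply: subset_leq_card.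
apply/fintype.subsetP => c /mapP[p ps ->]; rewrite inE; apply/asboolP.
by exists p; split => //; exact: sB.
Qed.

(** Every finite subset of B is eventually split into distinct cells, so the
    limit is right both when B is finite and when it is not. *)
Lemma ncells_cvg (R : realType) (B : set E) :
  ((ncells k B)%:R%:E : \bar R) @[k --> \oo] --> counting B.
Proof using sepU.
rewrite /counting; have [finB|infB] := pselect (finite_set B).
  rewrite asboolT//; have BE : B = [set` enum_fset (fset_set B)] by rewrite fset_setK.
  apply: cvg_near_cst.
  have [k hk] : exists k, forall j, (k <= j)%N ->
      (size (enum_fset (fset_set B)) <= ncells j B)%N.
    by apply: ncells_ge; [exact: fset_uniq|rewrite [X in _ `<=` X]BE].
  exists k => // j kj; congr (_%:R%:E); apply/eqP.
  by rewrite eqn_leq {1}BE ncells_le// hk.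
rewrite asboolF//; apply/cvgeyPge => M.
have [s [us [sB sM]]] : exists s : seq E, uniq s /\ [set` s] `<=` B /\
    (M <= (size s)%:R)%R.
  have [C CB CM] := @infinite_set_fset _ B (Num.truncn M).+1 infB.
  exists (enum_fset C); split; first exact: fset_uniq.
  split => //; apply: le_trans (ltW (Num.Theory.truncnS_gt M)) _.
  by rewrite ler_nat.
have [k hk] := ncells_ge us sB; exists k => // j kj.
by rewrite lee_fin; apply: le_trans sM _; rewrite ler_nat; exact: hk.
Qed.

Lemma ncellsE (R : realType) k B : ((ncells k B)%:R%:E : \bar R) =
  \sum_(c : {ffun 'I_k -> bool}) (`[< cell c `&` B !=set0 >]%:R)%:E.
Proof.
rewrite sumEFin /ncells -sum1_card natr_sum big_mkcond/=; congr EFin.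
by apply: eq_bigr => c _; rewrite inE; case: ifP.
Qed.

End cells.

(** * Void probabilities of small cells *)

Lemma sub_le_measure d (T : measurableType d) (R : realType)
    (mu : {measure set T -> \bar R}) (A B : set T) :
  measurable A -> measurable B -> A `<=` B -> mu A <= mu B.
Proof. by move=> mA mB AB; apply: le_measure => //; exact/mem_set. Qed.

Section fibers.
Context {d : measure_display} {T : measurableType d} {R : realType}.
Context (I : finType) (h : T -> I).
Hypothesis mh : forall i, measurable [set x | h x = i].
Variable mu : {measure set T -> \bar R}.

(** Finite-valued functions cut an integral into finitely many pieces; used with
    the address of a point, to treat it as constant. *)
Lemma ge0_integral_fibers (D : set T) (f : T -> \bar R) : measurable D ->
  measurable_fun D f -> (forall x, D x -> 0 <= f x) ->
  \int[mu]_(x in D) f x = \sum_(i : I) \int[mu]_(x in D `&` [set x | h x = i]) f x.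
Proof using mh.
move=> mD mf f0.
have DE : D = \big[setU/set0]_(i <- index_enum I) (D `&` [set x | h x = i]).
  apply/seteqP; split => [x Dx|x].
    by rewrite -bigcup_seq/=; exists (h x) => //=; rewrite mem_index_enum.
  by rewrite -bigcup_seq/= => -[i _ []].
rewrite {1}DE ge0_integral_bigsetU//.
- by move=> i; exact: measurableI.
- exact: index_enum_uniq.
- by move=> i j _ _ [x [[_ <-] [_ <-]]].
- by rewrite -DE.
- by rewrite -DE.
Qed.

Lemma measure_fibers (D : set T) : measurable D ->
  mu D = \sum_(i : I) mu (D `&` [set x | h x = i]).
Proof using mh.
move=> mD; rewrite -[LHS]mul1e -(integral_cst _ mD) ge0_integral_fibers//.
apply: eq_bigr => i _; rewrite integral_cst ?mul1e//; exact: measurableI.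
Qed.

End fibers.

Section cell_mass.
Context {dE : measure_display} {E : measurableType dE} {R : realType}.
Variables (U : nat -> set E) (mU : forall i, measurable (U i)).
Hypothesis sepU : forall p q, (forall i, U i p <-> U i q) -> p = q.
Variable m : {measure set E -> \bar R}.
Hypothesis m_diffuse : forall p, m [set p] = 0.

Lemma sum_cell_mass k (B : set E) : measurable B ->
  m B = \sum_(c : {ffun 'I_k -> bool}) m (B `&` cell U c).
Proof using mU. by apply: measure_fibers => c; exact: measurable_cell. Qed.

Lemma bigcap_cell (p : E) : \bigcap_k cell U (code U k p) = [set p].
Proof using sepU.
apply/seteqP; split => [q h|_ -> //]; apply: sepU => i.
have /ffunP/(_ (Ordinal (ltnSn i))) := h i.+1 I; rewrite !ffunE/=.
by case: asboolP; case: asboolP.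
Qed.

(** The cells around p shrink to p, which has mass zero. *)
Lemma cell_mass_cvg (B : set E) p : measurable B -> m B < +oo ->
  m (B `&` cell U (code U k p)) @[k --> \oo] --> 0.
Proof using mU sepU m_diffuse.
move=> mB Boo; pose F k := B `&` cell U (code U k p).
have mF k : measurable (F k) by apply: measurableI => //; exact: measurable_cell.
have mcF : measurable (\bigcap_k F k) by exact: bigcapT_measurable.
have -> : 0 = m (\bigcap_k F k).
  apply/esym/eqP; rewrite eq_le measure_ge0 andbT -(m_diffuse p).
  apply: sub_le_measure => //; first exact: (measurable_point mU sepU).
  by rewrite -(bigcap_cell p) => x h k _; have [] := h k I.
apply: nonincreasing_cvg_mu => //.
- by apply: le_lt_trans Boo; apply: (sub_le_measure _ (mF 0%N) mB) => x [].
- move=> j k jk; apply/subsetPset => q [Bq]; rewrite /cell/= => qp; split => //.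
  exact: code_sub jk qp.
Qed.

(** The sum is the integral over B of the mass of the cell around p, which tends
    to zero pointwise and is dominated by m B. *)
Lemma sum_cell_mass2_cvg (B : set E) : measurable B -> m B < +oo ->
  (\sum_(c : {ffun 'I_k -> bool}) (m (B `&` cell U c) * m (B `&` cell U c)))
  @[k --> \oo] --> 0.
Proof using mU sepU m_diffuse.
move=> mB Boo.
have mc k (c : {ffun 'I_k -> bool}) : measurable (cell U c) by exact: measurable_cell.
pose f k p := m (B `&` cell U (code U k p)).
have fE k p : f k p = \sum_(c : {ffun 'I_k -> bool})
    m (B `&` cell U c) * (\1_(cell U c) p)%:E.
  rewrite (bigD1 (code U k p))//= big1 ?adde0.
    by rewrite indicE mem_set// mule1.
  move=> c cp; rewrite indicE memNset ?mule0// => cp'.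
  by move: cp; rewrite cp' eqxx.
have mf k : measurable_fun B (f k).
  have -> : f k = (fun p => \sum_(c : {ffun 'I_k -> bool})
    m (B `&` cell U c) * (\1_(cell U c) p)%:E) by apply/funext => p; exact: fE.
  apply: emeasurable_sum => c; apply: emeasurable_funM => //.
  apply/measurable_EFinP; exact: measurable_indic.
have -> : (fun k => \sum_(c : {ffun 'I_k -> bool})
    (m (B `&` cell U c) * m (B `&` cell U c))) = (fun k => \int[m]_(p in B) f k p).
  apply/funext => k; under [RHS]eq_integral do rewrite fE.
  rewrite ge0_integral_sum//; last first.
    by move=> c; apply: emeasurable_funM => //; apply/measurable_EFinP; exact: measurable_indic.
  apply: eq_bigr => c _; rewrite ge0_integralZl//; last first.
  - apply/measurable_EFinP; exact: measurable_indic.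
  by rewrite integral_indic//; congr (_ * m _); rewrite setIC.
have -> : 0 = \int[m]_(p in B) (cst 0 p) by rewrite integral0.
apply: (@dominated_cvg _ _ _ m B mB f (cst 0) (cst (m B))) => //.
- by move=> p _; exact: cell_mass_cvg.
- by move=> p _; rewrite ge0_fin_numE.
- apply/integrableP; split => //.
  under eq_integral do rewrite gee0_abs//.
  by rewrite integral_cst// lte_mul_pinfty// ge0_fin_numE.
- move=> k p _; rewrite gee0_abs//; apply: sub_le_measure => //.
  exact: measurableI.
Qed.

(** Elementary bounds on the probability that a Poisson variable of mean x is
    not zero; the error is quadratic, hence negligible over fine partitions. *)
Lemma void_prob_bounds (x : \bar R) : 0 <= x -> x \is a fin_num ->
  x - x * x <= 1 - expeR (- x) <= x.
Proof.
case: x => [x| |]//; rewrite lee_fin => x0 _.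
rewrite (_ : expeR _ = (expR (- x))%:E)// -EFinM -!EFinB !lee_fin.
have := @expR_ge1Dx R (- x); have := @expR_ge1Dx R x.
have : (expR x * expR (- x) = 1)%R by rewrite -expRD subrr expR0.
have := @expR_gt0 R (-x); nra.
Qed.

Lemma sum_void_prob_cvg (B : set E) : measurable B -> m B < +oo ->
  (\sum_(c : {ffun 'I_k -> bool}) (1 - expeR (- m (B `&` cell U c))))
  @[k --> \oo] --> m B.
Proof using mU sepU m_diffuse.
move=> mB Boo.
have mc k (c : {ffun 'I_k -> bool}) : measurable (cell U c) by exact: measurable_cell.
have fc k (c : {ffun 'I_k -> bool}) : m (B `&` cell U c) \is a fin_num.
  rewrite ge0_fin_numE//; apply: le_lt_trans Boo.
  by apply: sub_le_measure => //; exact: measurableI.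
have fB : m B \is a fin_num by rewrite ge0_fin_numE.
apply: (@squeeze_cvge _ _ _ _ (fun k => m B - \sum_(c : {ffun 'I_k -> bool})
    (m (B `&` cell U c) * m (B `&` cell U c))) _ (cst (m B))); last first.
- exact: cvg_cst.
- rewrite -[X in _ --> X]sube0; apply: cvgeB.
  + by rewrite fin_num_adde_defl.
  + exact: cvg_cst.
  + exact: sum_cell_mass2_cvg.
- apply: nearW => k; rewrite /cst (sum_cell_mass k mB).
  rewrite leeBlDr; last first.
    by apply/sum_fin_numP => c _ _; exact: fin_numM.
  rewrite -big_split/=; apply/andP; split; apply: lee_sum => c _.
  - rewrite -leeBlDr ?fin_numM//.
    by have /andP[] := void_prob_bounds (measure_ge0 m (B `&` cell U c)) (fc k c).
  - by have /andP[] := void_prob_bounds (measure_ge0 m (B `&` cell U c)) (fc k c).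
Qed.

End cell_mass.

(** * Random sets of points and the Campbell measure *)

(** U separates points, hence provides the partitions; W exhausts the space by
    sets on which all configurations are finite. *)
Record ground_space {dE : measure_display} {E : measurableType dE}
    (U W : nat -> set E) : Prop := {
  gs_measurableU : forall i, measurable (U i) ;
  gs_separated : forall p q, (forall i, U i p <-> U i q) -> p = q ;
  gs_measurableW : forall n, measurable (W n) ;
  gs_nondecreasing : nondecreasing_seq W ;
  gs_cover : \bigcup_n W n = setT }.

Section random_points.
Context {dE : measure_display} {E : measurableType dE} {R : realType}.
Variables (U W : nat -> set E).
Hypothesis hE : ground_space U W.
Let mU := gs_measurableU hE.
Let sepU := gs_separated hE.
Let mW := gs_measurableW hE.
Let ndW := gs_nondecreasing hE.
Let W_T := gs_cover hE.

(** The event, also called avoidance event, that no point falls in A. *)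
Definition void {Om : Type} (N : Om -> set E) (A : set E) : set Om :=
  [set w | N w `&` A = set0].

(** Only void events are asked to be measurable: they determine the counts. *)
Record random_points d (Om : measurableType d) (N : Om -> set E) : Prop := {
  rp_void : forall A, measurable A -> measurable (void N A) ;
  rp_fin : forall w n, finite_set (N w `&` W n) }.

Lemma measurable_finite (A : set E) : finite_set A -> measurable A.
Proof.
move=> finA; rewrite (_ : A = \bigcup_(p in A) [set p]).
  by apply: fin_bigcup_measurable => // p _; exact: (measurable_point mU sepU).
by apply/seteqP; split => [p Ap|p [q Aq ->//]]; exists p.
Qed.

Lemma setI_bigcupW (A : set E) : \bigcup_n (A `&` W n) = A.
Proof. by rewrite -setI_bigcupr W_T setIT. Qed.

Context d (Om : measurableType d) (N : Om -> set E).

Lemma measurable_random_points : random_points N -> forall w, measurable (N w).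
Proof.
move=> hN w; rewrite -(setI_bigcupW (N w)).
by apply: bigcupT_measurable => n; apply: measurable_finite; exact: rp_fin.
Qed.

(** Counts are limits of numbers of cells that are hit, and being hit is the
    complement of a void event. *)
Lemma measurable_counting (A : set E) :
  (forall B, measurable B -> measurable (void N B)) ->
  measurable A -> measurable_fun setT (fun w => counting (N w `&` A) : \bar R).
Proof.
move=> hN mA.
apply: (@emeasurable_fun_cvg _ _ _ _
    (fun k w => (ncells U k (N w `&` A))%:R%:E)) => //; last first.
  by move=> w _; exact: ncells_cvg.
move=> k; under eq_fun do rewrite ncellsE.
apply: emeasurable_sum => c; apply/measurable_EFinP.
rewrite (_ : (fun w => _) = \1_(~` void N (A `&` cell U c))).
  apply: measurable_indic; apply: measurableC; apply: hN.
  by apply: measurableI => //; exact: measurable_cell.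
apply/funext => w; rewrite indicE; congr (_%:R); congr nat_of_bool.
apply/asboolP/idP => [[p [cp [Np Ap]]]|].
  by apply/mem_set => /seteqP[/(_ p) h _]; exact: h.
move=> /set_mem/eqP/set0P[p [Np [Ap cp]]].
by exists p.
Qed.

Hypothesis hN : random_points N.

Definition counting_points (w : Om) : {measure set E -> \bar R} :=
  mrestr (@counting E R) (measurable_random_points hN w).

Lemma counting_pointsE w A : counting_points w A = counting (N w `&` A).
Proof. by rewrite /counting_points/= /mrestr setIC. Qed.

Lemma counting_points_lty w n A : counting (N w `&` (A `&` W n)) < (+oo : \bar R).
Proof.
rewrite /counting asboolT ?ltry//.
by apply: sub_finite_set (rp_fin hN w n) => p [? []].
Qed.

(** For products this follows from the measurability of counts; the passage to
    general F is the standard one for kernels, on each set of the exhaustion. *)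
Lemma measurable_counting_xsection (F : set (Om * E)) : measurable F ->
  measurable_fun setT (fun w => counting (N w `&` xsection F w) : \bar R).
Proof.
move=> mF.
have mk : @isKernel _ _ Om E R counting_points.
  split => A mA; under eq_fun do rewrite counting_pointsE.
  by apply: measurable_counting => //; exact: rp_void.
pose k : R.-ker Om ~> E := HB.pack counting_points mk.
apply: (@emeasurable_fun_cvg _ _ _ _
   (fun n w => counting (N w `&` (xsection F w `&` W n)))) => //.
  move=> n.
  have [|_] := @measurable_prod_subset_xsection_kernel _ _ _ _ _ k _ (mW n) _ F mF.
    move=> w; have fW : counting_points w (W n) \is a fin_num.
      rewrite ge0_fin_numE// counting_pointsE -(setTI (W n)).
      exact: counting_points_lty.
    exists (fine (counting_points w (W n)) + 1)%R => X mX.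
    rewrite EFinD fineK//; apply: (@le_lt_trans _ _ (counting_points w (W n))).
      by apply: sub_le_measure => //; exact: measurableI.
    by rewrite lteDl.
  by apply: eq_measurable_fun => w _; rewrite /mrestr counting_pointsE.
move=> w _.
have -> : counting (N w `&` xsection F w) =
    counting_points w (\bigcup_n (xsection F w `&` W n)) :> \bar R.
  by rewrite counting_pointsE setI_bigcupW.
under eq_fun do rewrite -counting_pointsE.
apply: nondecreasing_cvg_mu.
- by move=> n; apply: measurableI => //; exact: measurable_xsection.
- apply: bigcupT_measurable => n; apply: measurableI => //.
  exact: measurable_xsection.
- by move=> i j ij; apply/subsetPset; apply: setIS; apply/subsetPset; exact: ndW.
Qed.

(** The Campbell measure of the random set N, on pairs of an outcome and one of
    its points. *)
Definition campbell (Q : {measure set Om -> \bar R})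
    (F : set (Om * E)) : \bar R :=
  \int[Q]_w counting (N w `&` xsection F w).

Section campbell.
Variable Q : {measure set Om -> \bar R}.

Let campbell0 : campbell Q set0 = 0.
Proof.
rewrite /campbell -[RHS](integral0 Q setT); apply: eq_integral => w _.
by rewrite -counting_pointsE xsection0 measure0.
Qed.

Let campbell_ge0 F : 0 <= campbell Q F.
Proof. by apply: integral_ge0 => w _; rewrite -counting_pointsE. Qed.

Let campbell_sigma_additive : semi_sigma_additive (campbell Q).
Proof.
move=> F mF tF mUF; rewrite /campbell.
have -> : \int[Q]_w counting (N w `&` xsection (\bigcup_n F n) w) =
    \sum_(n <oo) \int[Q]_w counting (N w `&` xsection (F n) w).
  rewrite -integral_nneseries//; last first.
    by move=> n; exact: measurable_counting_xsection.
  apply: eq_integral => w _.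
  under eq_eseriesr do rewrite -counting_pointsE.
  rewrite -counting_pointsE xsection_bigcup measure_bigcup//.
  - by apply: eq_eseriesl => n; rewrite in_setT.
  - by move=> n _; exact: measurable_xsection.
  - exact: trivIset_xsection.
apply: is_cvg_nneseries => n _ _; exact: campbell_ge0.
Qed.

(** The proofs are arguments only so that the measure structure can be inferred. *)
Definition campbell_measure (_ : ground_space U W) (_ : random_points N) :=
  campbell Q.

HB.instance Definition _ := isMeasure.Build _ _ _ (campbell_measure hE hN) campbell0 campbell_ge0 campbell_sigma_additive.

End campbell.
End random_points.

(** * Laws described by void probabilities *)

Section void_law.
Context {dE : measure_display} {E : measurableType dE} {R : realType}.
Variables (U W : nat -> set E).
Hypothesis hE : ground_space U W.
Let mU := gs_measurableU hE.
Let sepU := gs_separated hE.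
Let mW := gs_measurableW hE.
Let ndW := gs_nondecreasing hE.
Let W_T := gs_cover hE.

(** By a theorem of Renyi this says that N is a Poisson process of intensity m
    independent of Y. The mass of Q is arbitrary, for use under Campbell
    measures. *)
Record void_law (m : set E -> \bar R)
    d (Om : measurableType d) (Q : set Om -> \bar R)
    dX (X : measurableType dX) (Y : Om -> X) (N : Om -> set E) : Prop := {
  vl_void : forall A, measurable A -> measurable (void N A) ;
  vl_fun : measurable_fun setT Y ;
  vl_law : forall C A, measurable C -> measurable A -> m A < +oo ->
    Q (Y @^-1` C `&` void N A) = Q (Y @^-1` C) * expeR (- m A) }.

Lemma void_setU Om (N : Om -> set E) A B :
  void N (A `|` B) = void N A `&` void N B.
Proof.
apply/seteqP; rewrite /void; split => w /=; rewrite setIUr.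
  by move=> h; split; apply/seteqP; split => // p Np; rewrite -h; [left|right].
by case=> -> ->; rewrite setU0.
Qed.

Lemma void0 Om (N : Om -> set E) : void N set0 = setT.
Proof. by apply/seteqP; split => // w _; rewrite /void/= setI0. Qed.

Variable m : {measure set E -> \bar R}.
Hypothesis m_diffuse : forall p, m [set p] = 0.
Hypothesis Wfin : forall n, m (W n) < +oo.
Context d (Om : measurableType d) (Q : {finite_measure set Om -> \bar R}).
Context dX (X : measurableType dX) (Y : Om -> X) (N : Om -> set E).
Hypothesis hN : void_law m Q Y N.

Let mY C : measurable C -> measurable (Y @^-1` C).
Proof. by move=> mC; rewrite -[X in measurable X]setTI; exact: (vl_fun hN). Qed.

Lemma fin_num_expeRN (x : \bar R) : 0 <= x -> x < +oo -> expeR (- x) \is a fin_num.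
Proof. by case: x. Qed.

Let lawQ C A : measurable C -> measurable A -> m A < +oo ->
  Q (Y @^-1` C `&` void N A) = Q (Y @^-1` C) * expeR (- m A).
Proof. exact: (vl_law hN). Qed.

(** Avoiding A and B is avoiding their union, whose mass is the sum of the masses
    as they are disjoint. *)
Lemma prob_hit C A B : measurable C -> measurable A -> measurable B ->
  m A < +oo -> m B < +oo -> A `&` B = set0 ->
  Q ((Y @^-1` C `&` void N A) `&` ~` void N B) =
    Q (Y @^-1` C) * expeR (- m A) * (1 - expeR (- m B)).
Proof.
move=> mC mA mB Aoo Boo AB; have mD : measurable (Y @^-1` C `&` void N A).
  by apply: measurableI; [exact: mY|exact: (vl_void hN)].
rewrite -setDE measureD//; last 2 first.
- exact: (vl_void hN).
- by rewrite -ge0_fin_numE// fin_num_measure.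
have mAB : m (A `|` B) = m A + m B by rewrite measureU.
have h1 : Q (Y @^-1` C `&` void N A) = Q (Y @^-1` C) * expeR (- m A).
  exact: lawQ.
have h2 : Q ((Y @^-1` C `&` void N A) `&` void N B) =
    Q (Y @^-1` C) * expeR (- m A) * expeR (- m B).
  rewrite -setIA -void_setU.
  transitivity (Q (Y @^-1` C) * expeR (- m (A `|` B))).
    by apply: lawQ; [|exact: measurableU|rewrite mAB lte_add_pinfty].
  by rewrite mAB fin_num_oppeD ?ge0_fin_numE// expeRD muleA.
rewrite -[LHS]/(Q _ - Q _) h1 h2 muleBr ?mule1//.
by rewrite fin_numM ?fin_num_measure ?fin_num_expeRN//; exact: mY.
Qed.

(** The mean number of points in B is the limit of the sum of the probabilities
    to hit the cells of B, and each of these is close to the mass of the cell. *)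
Lemma expected_count C A B : measurable C -> measurable A -> measurable B ->
  m A < +oo -> m B < +oo -> A `&` B = set0 ->
  \int[Q]_(w in Y @^-1` C `&` void N A) counting (N w `&` B) =
    Q (Y @^-1` C) * expeR (- m A) * m B.
Proof.
move=> mC mA mB Aoo Boo AB; set D := Y @^-1` C `&` void N A.
have mD : measurable D by apply: measurableI; [exact: mY|exact: (vl_void hN)].
have mc k (c : {ffun 'I_k -> bool}) : measurable (B `&` cell U c).
  by apply: measurableI => //; exact: measurable_cell.
pose f k w : \bar R := \sum_(c : {ffun 'I_k -> bool})
  (\1_(~` void N (B `&` cell U c)) w)%:E.
have fE k w : f k w = (ncells U k (N w `&` B))%:R%:E.
  rewrite ncellsE; apply: eq_bigr => c _.
  rewrite indicE; congr (_%:R%:E); congr nat_of_bool.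
  apply/idP/asboolP => [/set_mem/eqP/set0P[p [Np [Bp cp]]]|[p [cp [Np Bp]]]].
    by exists p.
  by apply/mem_set => /seteqP[/(_ p) h _]; exact: h.
have mi k (c : {ffun 'I_k -> bool}) :
    measurable_fun D (fun w => (\1_(~` void N (B `&` cell U c)) w)%:E : \bar R).
  apply/measurable_EFinP; apply: measurable_indic; apply: measurableC.
  exact: (vl_void hN).
have cvg1 : \int[Q]_(w in D) f k w @[k --> \oo] -->
    \int[Q]_(w in D) counting (N w `&` B).
  have -> : \int[Q]_(w in D) counting (N w `&` B) =
      \int[Q]_(w in D) limn (f ^~ w).
    apply: eq_integral => w _; apply/esym/cvg_lim => //.
    by under eq_fun do rewrite fE; exact: ncells_cvg.
  apply: cvg_monotone_convergence => //.
  - by move=> k; exact: emeasurable_sum.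
  - by move=> k w _; rewrite fE lee_fin.
  - by move=> w _ j k jk; rewrite !fE lee_fin ler_nat; exact: ncells_nd.
suff cvg2 : \int[Q]_(w in D) f k w @[k --> \oo] -->
    Q (Y @^-1` C) * expeR (- m A) * m B.
  exact: (cvg_unique _ cvg1 cvg2).
pose q := Q (Y @^-1` C) * expeR (- m A).
have fq : q \is a fin_num.
  by rewrite /q fin_numM ?fin_num_measure ?fin_num_expeRN//; exact: mY.
have -> : (fun k => \int[Q]_(w in D) f k w) = (fun k => q *
    \sum_(c : {ffun 'I_k -> bool}) (1 - expeR (- m (B `&` cell U c)))).
  apply/funext => k; rewrite ge0_integral_sum//.
  rewrite ge0_sume_distrr//; last first.
    by move=> c _; rewrite sube_ge0 ?orbT// -expeR0 lee_expeR oppe_le0.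
  apply: eq_bigr => c _; rewrite integral_indic//; last first.
    by apply: measurableC; exact: (vl_void hN).
  rewrite setIC; apply: prob_hit => //.
    by apply: le_lt_trans Boo; apply: sub_le_measure => // p [].
  by apply/seteqP; split => // p [Ap [Bp _]]; rewrite -AB.
apply: cvgeZl => //; exact: sum_void_prob_cvg.
Qed.

End void_law.

(** * Independence of the configuration and freezing *)

Section finite_measures.
Context d (T : measurableType d) (R : realType).

(** The proof is an argument only so that finiteness can be inferred. *)
Definition bounded_measure (mu : {measure set T -> \bar R})
  (_ : mu setT < +oo) : set T -> \bar R := mu.

Variables (mu : {measure set T -> \bar R}) (h : mu setT < +oo).

HB.instance Definition _ := Measure.copy (bounded_measure h) mu.

Let bounded_measure_finite : fin_num_fun (bounded_measure h).
Proof. exact: lty_fin_num_fun. Qed.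

HB.instance Definition _ := Measure_isFinite.Build _ _ _ (bounded_measure h)
  bounded_measure_finite.

End finite_measures.

Section image_measure.
Context d1 d2 (T1 : measurableType d1) (T2 : measurableType d2) (R : realType).

(** The proof is an argument only so that the structure of a finite measure can
    be inferred. *)
Definition image_measure (mu : set T1 -> \bar R)
  (f : T1 -> T2) (_ : measurable_fun setT f) : set T2 -> \bar R :=
  pushforward mu f.

Variables (mu : {finite_measure set T1 -> \bar R}) (f : T1 -> T2).
Hypothesis mf : measurable_fun setT f.

HB.instance Definition _ := Measure.copy (image_measure mu mf)
  (measure_function_pushforward__canonical__measure_function_Measure mu mf).

Let image_measure_finite : fin_num_fun (image_measure mu mf).
Proof.
move=> A mA; apply: fin_num_measure.
by rewrite -[X in measurable X]setTI; exact: mf.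
Qed.

HB.instance Definition _ := Measure_isFinite.Build _ _ _ (image_measure mu mf)
  image_measure_finite.

End image_measure.

Lemma counting_eq0 (T : choiceType) (R : realType) (A : set T) :
  ((counting A : \bar R) == 0) = `[< A = set0 >].
Proof.
apply/eqP/asboolP => [|->]; last by rewrite /counting asboolT// fset_set0.
rewrite /counting; case: asboolP => // finA [] /eqP.
rewrite pnatr_eq0 cardfs_eq0 => /eqP A0.
by rewrite -(fset_setK finA) A0; apply/seteqP; split.
Qed.

Section void_xsection.
Context {dE : measure_display} {E : measurableType dE} (R : realType).
Variables (U W : nat -> set E).
Hypothesis hE : ground_space U W.
Context d (Om : measurableType d) (N : Om -> set E).
Hypothesis fN : random_points W N.

Lemma measurable_void_xsection (F : set (Om * E)) : measurable F ->
  measurable [set w | N w `&` xsection F w = set0].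
Proof.
move=> mF; rewrite (_ : mkset _ =
    (fun w => counting (N w `&` xsection F w) : \bar R) @^-1` [set 0]).
  have := measurable_counting_xsection (R := R) hE fN mF.
  by move=> /(_ measurableT _ (emeasurable_set1 0)); rewrite setTI.
apply/seteqP; split => w /= => [h|/eqP].
  by apply/eqP; rewrite counting_eq0; apply/asboolP.
by rewrite counting_eq0 => /asboolP.
Qed.

End void_xsection.

Section freezing.
Context {dE : measure_display} {E : measurableType dE} {R : realType}.
Variables (U W : nat -> set E).
Hypothesis hE : ground_space U W.
Let mW := gs_measurableW hE.
Let W_T := gs_cover hE.
Variable m : {measure set E -> \bar R}.
Hypothesis Wfin : forall n, m (W n) < +oo.
Context d (Om : measurableType d) (M : {finite_measure set Om -> \bar R}).
Context dX (X : measurableType dX) (Y : Om -> X) (N : Om -> set E).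
Hypothesis hN : void_law m M Y N.
Hypothesis fN : random_points W N.
Let mY := vl_fun hN.

Let voids : set (set Om) :=
  [set V | exists B, [/\ measurable B, m B < +oo & V = void N B]].
Let G : measurableType _ := g_sigma_algebraType voids.

Let voids_measurable : voids `<=` measurable.
Proof. by move=> _ [B [mB _ ->]]; exact: (vl_void hN). Qed.

Let sigma_voids_measurable : <<s voids >> `<=` @measurable _ Om.
Proof.
apply: smallest_sub; last exact: voids_measurable.
exact: sigma_algebra_measurable.
Qed.

Let measurable_idG : measurable_fun setT (id : Om -> G).
Proof. by move=> _ V mV; rewrite setTI; exact: sigma_voids_measurable. Qed.

Let measurable_joint : measurable_fun setT (fun w => (Y w, w) : X * G).
Proof. by apply: measurable_fun_pair => //; exact: mY. Qed.

Let voids_setI : setI_closed voids.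
Proof.
move=> _ _ [A [mA Aoo ->]] [B [mB Boo ->]]; exists (A `|` B); split.
- exact: measurableU.
- apply: le_lt_trans (measureU2 m mA mB) _.
  by rewrite lte_add_pinfty.
- by rewrite void_setU.
Qed.

Let voidsT : voids setT.
Proof. by exists set0; split; rewrite ?measure0 ?void0. Qed.

Let void_G B : measurable B -> measurable (void N B : set G).
Proof.
move=> mB; rewrite (_ : void N B = \bigcap_n void N (B `&` W n)).
  apply: (@bigcapT_measurable _ G) => n; apply: sub_sigma_algebra.
  exists (B `&` W n); split => //; first exact: measurableI.
  by apply: le_lt_trans (Wfin n); apply: sub_le_measure => //; exact: measurableI.
apply/seteqP; split => [w|w h]; rewrite /void/=.
  by move=> h n _; apply/seteqP; split => // p [Np [Bp _]]; rewrite -h.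
apply/seteqP; split => // p [Np Bp].
have [n _ Wp] : (\bigcup_n W n) p by rewrite W_T.
by have : (N w `&` (B `&` W n)) p by []; rewrite (h n I).
Qed.

Let points_G : random_points W (N \o snd : X * G -> set E).
Proof.
split; last by move=> w n; exact: (rp_fin fN).
move=> B mB; rewrite (_ : void _ B = setT `*` void N B).
  by apply: measurableX => //; exact: void_G.
by apply/seteqP; split => [[x w]//|[x w] []].
Qed.

Let lawG : {finite_measure set G -> \bar R} := image_measure M measurable_idG.
Let lawY : {finite_measure set X -> \bar R} := image_measure M mY.
Let total : {nonneg R} := NngNum (fine_ge0 (measure_ge0 M setT)).

(** Y and the configuration are independent. Two sigma-finite measures on
    X * G agreeing on rectangles are equal, so it is enough to compare them on
    C * V, and for V it is enough to take a void event. *)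
Let joint_law (F : set (X * G)) : measurable F ->
  (lawY \x lawG) F = total%:num%:E * M ((fun w => (Y w, w)) @^-1` F).
Proof.
move=> mF.
have -> : total%:num%:E * M ((fun w => (Y w, w)) @^-1` F) =
    mscale total (image_measure M measurable_joint) F by [].
apply: product_measure_unique => // C V mC mV.
rewrite /= /mscale/= /image_measure/pushforward.
have mYC : measurable (Y @^-1` C).
  by rewrite -[X in measurable X]setTI; exact: mY.
have cY : (0 <= fine (M (Y @^-1` C)))%R by exact: fine_ge0.
have e : forall V', <<s voids >> V' ->
    mscale total (mrestr M mYC) V' = mscale (NngNum cY) M V'.
  apply: (@g_sigma_algebra_measure_unique _ R Om voids voids_measurable (fun=> setT)) => //.
  - by apply/seteqP; split => // w _; exists 0%N.
  - move=> _ [B [mB Boo ->]]; rewrite /= /mscale/= /mrestr setIC !fineK ?fin_num_measure//.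
    have h1 : M (Y @^-1` C `&` void N B) = M (Y @^-1` C) * expeR (- m B).
      exact: (vl_law hN).
    have h2 : M (void N B) = M setT * expeR (- m B).
      by have := vl_law hN (@measurableT _ X) mB Boo; rewrite preimage_setT setTI.
    by rewrite [X in _ * X = _]h1 h2 muleCA.
  - move=> _; rewrite /= /mscale/= /mrestr setTI ltey_eq fin_numM ?fin_num_measure//.
have := e _ mV.
rewrite /= /mscale/= /mrestr !fineK ?fin_num_measure// => <-.
by rewrite setIC.
Qed.

Variables (A : set (X * E)) (mA : measurable A).
Hypothesis Afin : forall x, m (xsection A x) < +oo.
Variable phi : X -> \bar R.
Hypothesis mphi : measurable_fun setT phi.
Hypothesis phi0 : forall x, 0 <= phi x.

Let S : set (X * G) := [set z | N z.2 `&` xsection A z.1 = set0].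

Let mS : measurable S.
Proof.
pose F : set ((X * G) * E) := [set z | A (z.1.1, z.2)].
have mF : measurable F.
  have mg : measurable_fun setT (fun z : (X * G) * E => (z.1.1, z.2) : X * E).
    by apply: measurable_fun_pair => //; exact: measurableT_comp.
  by have := mg measurableT _ mA; rewrite setTI.
have := measurable_void_xsection R hE points_G mF.
congr measurable; apply/seteqP; rewrite /S; split => -[x w] /=;
  by rewrite (_ : xsection F _ = xsection A x)// !xsectionE.
Qed.

(** Being empty is measurable for sections of measurable sets, because counts of
    sections are. *)
Lemma measurable_void_section :
  measurable [set w | N w `&` xsection A (Y w) = set0].
Proof.
by have := measurable_joint measurableT mS; rewrite setTI.
Qed.

(** As Y is independent of the configuration, it can be frozen: the probability
    that the region A(Y) is empty given Y is exp(-m(A(Y))). *)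
Lemma freezing :
  \int[M]_(w in [set w | N w `&` xsection A (Y w) = set0]) phi (Y w) =
  \int[M]_w (phi (Y w) * expeR (- m (xsection A (Y w)))).
Proof.
pose T := fine (M setT).
have TE : M setT = T%:E by rewrite fineK// fin_num_measure.
have mAx x : measurable (xsection A x) by exact: measurable_xsection.
have mV := measurable_void_section.
(* A mass other than one only rescales the product law; the null measure is
   set apart. *)
have [T0|T0] := eqVneq T 0%R.
  have M0 B : measurable B -> M B = 0.
    move=> mB; apply/eqP; rewrite eq_le measure_ge0 andbT.
    apply: (@le_trans _ _ (M setT)); first exact: sub_le_measure.
    by rewrite TE T0.
  rewrite (eq_measure_integral mzero); last by move=> B mB _; exact: M0.
  rewrite [RHS](eq_measure_integral mzero); last by move=> B mB _; exact: M0.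
  by rewrite !integral_measure_zero.
have SE x : lawG (xsection S x) = T%:E * expeR (- m (xsection A x)).
  have := vl_law hN measurableT (mAx x) (Afin x).
  rewrite preimage_setT setTI -TE => <-; rewrite /= /image_measure/pushforward.
  by rewrite xsectionE.
have mexp : measurable_fun setT (fun x => expeR (- m (xsection A x))).
  have -> : (fun x => expeR (- m (xsection A x))) =
      (fun x => (T^-1)%:E * lawG (xsection S x)).
    by apply/funext => x; rewrite SE muleA -EFinM mulVf// mul1e.
  by apply: measurable_funeM; exact: measurable_fun_xsection.
pose psi (z : X * G) := phi z.1 * (\1_S z)%:E.
have mpsi : measurable_fun setT psi.
  apply: emeasurable_funM; first exact: measurableT_comp.
  by apply/measurable_EFinP; exact: measurable_indic.
have psi0 z : 0 <= psi z by rewrite mule_ge0// lee_fin.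
have e1 : \int[lawY \x lawG]_z psi z =
    \int[M]_w (T%:E * (phi (Y w) * expeR (- m (xsection A (Y w))))).
  rewrite fubini_tonelli1// /fubini_F.
  transitivity (\int[lawY]_x (T%:E * (phi x * expeR (- m (xsection A x))))).
    apply: eq_integral => x _; rewrite /psi/= ge0_integralZl//.
    - rewrite muleCA -SE; congr (_ * _).
      rewrite -[in RHS](setIT (xsection S x)) -integral_indic//; last first.
        exact: measurable_xsection.
      by apply: eq_integral => w _; rewrite !indicE mem_xsection.
    - apply/measurable_EFinP; apply: measurableT_comp; first exact: measurable_indic.
      exact: measurable_pair1.
  rewrite ge0_integral_pushforward//.
  - apply: measurable_funeM; exact: emeasurable_funM.
  - by move=> x _; rewrite !mule_ge0 ?expeR_ge0// lee_fin fine_ge0.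
have e2 : \int[lawY \x lawG]_z psi z = T%:E *
    \int[M]_(w in [set w | N w `&` xsection A (Y w) = set0]) phi (Y w).
  transitivity (\int[mscale total (image_measure M measurable_joint)]_z psi z).
    by apply: eq_measure_integral => F mF _; exact: joint_law.
  rewrite ge0_integral_mscale//=; congr (_ * _).
  rewrite ge0_integral_pushforward// preimage_setT [RHS]integral_mkcond.
  apply: eq_integral => w _; rewrite /psi/= patchE indicE.
  case: ifPn => h; first by rewrite (_ : _ \in S) ?mule1.
  by rewrite (_ : _ \in S = false) ?mule0//; exact/negbTE.
have T1 : T%:E != 0 by [].
have : T%:E * \int[M]_(w in [set w | N w `&` xsection A (Y w) = set0]) phi (Y w)
   = T%:E * \int[M]_w (phi (Y w) * expeR (- m (xsection A (Y w)))).
  rewrite -e2 e1 ge0_integralZl//.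
  - apply: emeasurable_funM; first exact: measurableT_comp.
    exact: (measurableT_comp mexp).
  - by move=> w _; rewrite mule_ge0 ?expeR_ge0.
  - by rewrite lee_fin fine_ge0.
by move=> /(congr1 (mule (T^-1)%:E)); rewrite !muleA -EFinM mulVf// !mul1e.
Qed.

End freezing.

(** * Mecke formula *)

Lemma ge0_integral_mrestr d (T : measurableType d) (R : realType)
    (mu : {measure set T -> \bar R}) (D : set T) (mD : measurable D)
    (f : T -> \bar R) : measurable_fun setT f -> (forall x, 0 <= f x) ->
  \int[mrestr mu mD]_x f x = \int[mu]_(x in D) f x.
Proof.
move=> mf f0; rewrite (@ge0_negligible_integral _ _ _ _ setT (~` D))//; last 2 first.
- exact: measurableC.
- by rewrite /= /mrestr setIC setICr measure0.
rewrite setTD setCK; apply: eq_measure_integral => A mA AD.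
by rewrite /= /mrestr setIidl.
Qed.

Lemma ge0_integral_indic d (T : measurableType d) (R : realType)
    (mu : {measure set T -> \bar R}) (C D : set T) (f : T -> \bar R) :
  \int[mu]_(x in D) ((\1_C x)%:E * f x) = \int[mu]_(x in D `&` C) f x.
Proof.
rewrite integral_mkcond [RHS]integral_mkcond; apply: eq_integral => x _.
rewrite !patchE in_setI indicE; case: (x \in D) => //=.
by case: (x \in C); rewrite ?mul1e ?mul0e.
Qed.

Lemma measurable_expeRN d (T : measurableType d) (R : realType)
    (f : T -> \bar R) : measurable_fun setT f -> (forall x, 0 <= f x) ->
  (forall x, f x < +oo) -> measurable_fun setT (fun x => expeR (- f x)).
Proof.
move=> mf f0 foo.
rewrite (_ : (fun x => _) = (fun x => (expR (- fine (f x)))%:E)).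
  apply/measurable_EFinP; apply: measurableT_comp => //.
  by apply: measurable_funN; exact: measurableT_comp.
by apply/funext => x; have := f0 x; have := foo x; case: (f x).
Qed.

Section mecke.
Context {dE : measure_display} {E : measurableType dE} {R : realType}.
Variables (U W : nat -> set E).
Hypothesis hE : ground_space U W.
Let mU := gs_measurableU hE.
Let sepU := gs_separated hE.
Let mW := gs_measurableW hE.
Let ndW := gs_nondecreasing hE.
Let W_T := gs_cover hE.
Variable m : {sigma_finite_measure set E -> \bar R}.
Hypothesis m_diffuse : forall p, m [set p] = 0.
Hypothesis Wfin : forall n, m (W n) < +oo.
Context d (Om : measurableType d) (Q : {finite_measure set Om -> \bar R}).
Context dX (X : measurableType dX) (Y : Om -> X) (N : Om -> set E).
Hypothesis hN : void_law m Q Y N.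
Hypothesis fN : random_points W N.

Let mY := vl_fun hN.
Let mYC C : measurable C -> measurable (Y @^-1` C).
Proof. by move=> mC; rewrite -[X in measurable X]setTI; exact: mY. Qed.
Local Notation cm := (campbell_measure Q hE fN).
Let V (z : Om * E) : X * E := (Y z.1, z.2).

Let mV : measurable_fun setT V.
Proof.
by apply: measurable_fun_pair => //; exact: measurableT_comp.
Qed.

Let mVC C : measurable C -> measurable (V @^-1` C).
Proof. by move=> mC; rewrite -[X in measurable X]setTI; exact: mV. Qed.

Lemma campbell_setX D B : measurable D -> measurable B ->
  cm (D `*` B) = \int[Q]_(w in D) counting (N w `&` B).
Proof.
move=> mD mB; rewrite [RHS]integral_mkcond; apply: eq_integral => w _.
rewrite patchE; case: ifPn => Dw; first by rewrite in_xsectionX.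
by rewrite notin_xsectionX// -(counting_pointsE hE fN) measure0.
Qed.

Lemma campbell_void C A B : measurable C -> measurable A -> measurable B ->
  m A < +oo -> m B < +oo -> A `&` B = set0 ->
  cm ((Y @^-1` C `&` void N A) `*` B) =
    Q (Y @^-1` C) * expeR (- m A) * m B.
Proof.
move=> mC mA mB Aoo Boo AB; rewrite campbell_setX//.
  exact: (expected_count hE m_diffuse hN).
by apply: measurableI; [exact: mYC|exact: (vl_void hN)].
Qed.

(** Extends the mean number of points from the sets of the exhaustion. *)
Lemma campbell_rectangle C B : measurable C -> measurable B ->
  cm (Y @^-1` C `*` B) = Q (Y @^-1` C) * m B.
Proof.
move=> mC mB.
have fin n : cm (Y @^-1` C `*` (B `&` W n)) = Q (Y @^-1` C) * m (B `&` W n).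
  have mBW : measurable (B `&` W n) by exact: measurableI.
  have := @campbell_void C set0 (B `&` W n) mC measurable0 mBW.
  rewrite measure0 oppe0 expeR0 mule1 set0I void0 setIT; apply => //.
  by apply: le_lt_trans (Wfin n); exact: sub_le_measure.
have BE := setI_bigcupW hE B.
have c1 : cm (Y @^-1` C `*` (B `&` W n)) @[n --> \oo] --> cm (Y @^-1` C `*` B).
  rewrite -[in X in _ --> X]BE setX_bigcupr.
  apply: nondecreasing_cvg_mu.
  - by move=> n; apply: measurableX; [exact: mYC|exact: measurableI].
  - by apply: bigcupT_measurable => n; apply: measurableX; [exact: mYC|exact: measurableI].
  - move=> i j ij; apply/subsetPset => z [Cz [Bz Wz]].
    by split => //; split => //; move: Wz; apply/subsetPset; exact: ndW.
have c2 : Q (Y @^-1` C) * m (B `&` W n) @[n --> \oo] --> Q (Y @^-1` C) * m B.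
  apply: cvgeZl; first by apply: fin_num_measure; exact: mYC.
  rewrite -[in X in _ --> X]BE; apply: nondecreasing_cvg_mu.
  - by move=> n; exact: measurableI.
  - by apply: bigcupT_measurable => n; exact: measurableI.
  - by move=> i j ij; apply/subsetPset; apply: setIS; apply/subsetPset; exact: ndW.
have e : (fun n => cm (Y @^-1` C `*` (B `&` W n))) =
   (fun n => Q (Y @^-1` C) * m (B `&` W n)) by apply/funext => n; exact: fin.
by move: c1; rewrite e => c1; exact: (cvg_unique _ c1 c2).
Qed.

Local Notation lawY := (image_measure Q mY).

Lemma campbell_integral (psi : X * E -> \bar R) :
  measurable_fun setT psi -> (forall x, 0 <= psi x) ->
  \int[cm]_z psi (V z) = \int[lawY \x m]_x psi x.
Proof.
move=> mpsi psi0.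
rewrite (eq_measure_integral (pushforward cm V)); last first.
  move=> F mF _.
  exact: (@product_measure_unique _ _ _ _ _ lawY m
    (measure_function_pushforward__canonical__measure_function_Measure cm mV)
    campbell_rectangle F mF).
by rewrite ge0_integral_pushforward.
Qed.

Lemma voidD (B A : set E) :
  void (fun z : Om * E => N z.1 `\` B) A = void N (A `\` B) `*` [set: E].
Proof.
apply/seteqP; split => [[w p]|[w p] []]; rewrite /void/=.
  by move=> h; split => //; rewrite -h setDE setDE setIA setIAC.
by move=> h _; rewrite -h setDE setDE setIA setIAC.
Qed.

Section cell.
Variables (B : set E) (mB : measurable B).
Hypothesis Boo : m B < +oo.
Let mDB : measurable ([set: Om] `*` B). Proof. exact: measurableX. Qed.

Let cmB_lty : mrestr cm mDB setT < +oo.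
Proof.
rewrite /= /mrestr setTI -(preimage_setT Y) campbell_rectangle//.
by rewrite lte_mul_pinfty// fin_num_measure//; exact: mYC.
Qed.

Let M : {finite_measure set (Om * E)%type -> \bar R} := bounded_measure cmB_lty.
Let mC : {measure set E -> \bar R} := mrestr m (measurableC mB).

Let law_rectangle C1 C2 A : measurable C1 -> measurable C2 -> measurable A ->
  mC A < +oo ->
  M (V @^-1` (C1 `*` C2) `&` void (fun z : Om * E => N z.1 `\` B) A) =
  Q (Y @^-1` C1) * expeR (- mC A) * m (C2 `&` B).
Proof.
move=> mC1 mC2 mA Aoo; rewrite voidD /M/= /bounded_measure /mrestr.
rewrite (_ : _ `&` _ = (Y @^-1` C1 `&` void N (A `\` B)) `*` (C2 `&` B)).
  rewrite campbell_void//.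
  - exact: measurableD.
  - exact: measurableI.
  - by apply: le_lt_trans Boo; apply: sub_le_measure => //; exact: measurableI.
  - by apply/seteqP; split => // p [[_ nB] [_ /nB]].
by apply/seteqP; split => -[w p]/=; rewrite /V/=; tauto.
Qed.

Let law_cell : void_law mC M V (fun z : Om * E => N z.1 `\` B).
Proof.
split; [|exact: mV|].
  move=> A mA; rewrite voidD; apply: measurableX => //.
  by apply: (vl_void hN); exact: measurableD.
move=> C A mCC mA Aoo.
have mvA : measurable (void (fun z : Om * E => N z.1 `\` B) A).
  rewrite voidD; apply: measurableX => //.
  by apply: (vl_void hN); exact: measurableD.
have fe : expeR (- mC A) \is a fin_num by rewrite fin_num_expeRN.
pose a : {nonneg R} := NngNum (fine_ge0 (expeR_ge0 (- mC A))).
have aE : a%:num%:E = expeR (- mC A) by rewrite /a/= fineK.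
pose m1 : {measure set (X * E)%type -> \bar R} :=
  measure_function_pushforward__canonical__measure_function_Measure (mrestr M mvA) mV.
pose m2 : {measure set (X * E)%type -> \bar R} := mscale a
  (measure_function_pushforward__canonical__measure_function_Measure M mV).
suff : m1 C = m2 C.
  move=> e; transitivity (m1 C); first by [].
  rewrite e; transitivity (a%:num%:E * M (V @^-1` C)); first by [].
  by rewrite aE muleC.
apply: (@measure_unique _ R _ [set F `*` G | F in measurable & G in measurable]
    (fun=> setT)) => //.
- by rewrite measurable_prod_measurableType.
- move=> _ _ [F1 mF1 [G1 mG1 <-]] [F2 mF2 [G2 mG2 <-]].
  exists (F1 `&` F2); first exact: measurableI.
  by exists (G1 `&` G2); [exact: measurableI|rewrite setXI].
- by move=> _; exists setT => //; exists setT => //; rewrite setXTT.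
- by apply/seteqP; split => // x _; exists 0%N.
- move=> _ [C1 mC1 [C2 mC2 <-]].
  have h1 : M (V @^-1` (C1 `*` C2)) = Q (Y @^-1` C1) * m (C2 `&` B).
    have := law_rectangle mC1 mC2 measurable0.
    rewrite measure0 voidD set0D void0 setXTT setIT oppe0 expeR0 mule1.
    by apply; rewrite ltry.
  transitivity (Q (Y @^-1` C1) * expeR (- mC A) * m (C2 `&` B)).
    exact: (law_rectangle mC1 mC2 mA Aoo).
  transitivity (a%:num%:E * M (V @^-1` (C1 `*` C2))); last by [].
  by rewrite h1 aE muleA [X in X * _]muleC.
- move=> _; apply: (@le_lt_trans _ _ (M setT)); last exact: cmB_lty.
  have mm : measurable (V @^-1` setT `&` void (fun z : Om * E => N z.1 `\` B) A).
    by rewrite preimage_setT setTI.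
  exact: (sub_le_measure M mm measurableT (@subsetT _ _)).
Qed.

Let points_cell : random_points W (fun z : Om * E => N z.1 `\` B).
Proof.
split; first by move=> A mA; exact: (vl_void law_cell).
by move=> z n; apply: sub_finite_set (rp_fin fN z.1 n) => p [[]].
Qed.

Let WfinC n : mC (W n) < +oo.
Proof.
apply: le_lt_trans (Wfin n); apply: sub_le_measure => //; apply: measurableI => //.
exact: measurableC.
Qed.

Variables (A : set ((X * E) * E)) (mA : measurable A).
Hypothesis Afin : forall x, m (xsection A x) < +oo.

Let AfinC x : mC (xsection A x) < +oo.
Proof.
apply: le_lt_trans (Afin x); apply: sub_le_measure.
- by apply: measurableI; [exact: measurable_xsection|exact: measurableC].
- exact: measurable_xsection.
- exact: subIsetl.
Qed.

Lemma measurable_void_cell :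
  measurable [set z | (N z.1 `\` B) `&` xsection A (V z) = set0].
Proof. exact: (measurable_void_section hE WfinC law_cell points_cell mA). Qed.

(** Restrict the Campbell measure to the pairs whose point lies in B. Under this
    measure the pair formed of Y and the point is independent of the
    configuration outside B, whose intensity is m outside B, and freezing
    applies to regions that depend on both. *)
Lemma mecke_cell (C : set (X * E)) : measurable C ->
  cm (V @^-1` C `&` ([set: Om] `*` B) `&`
      [set z | (N z.1 `\` B) `&` xsection A (V z) = set0]) =
  \int[cm]_(z in V @^-1` C `&` ([set: Om] `*` B))
    expeR (- m (xsection A (V z) `\` B)).
Proof.
move=> mCC.
have m1C : measurable_fun setT (fun x => (\1_C x)%:E : \bar R).
  by apply/measurable_EFinP; exact: measurable_indic.
have C0 x : 0 <= (\1_C x)%:E :> \bar R by rewrite lee_fin.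
have mS := measurable_void_cell.
have mexp : measurable_fun setT (fun x => expeR (- mC (xsection A x))).
  apply: measurable_expeRN => //.
  rewrite (_ : (fun x => _) = (fun x => m (xsection (A `&` (setT `*` ~` B)) x))).
    apply: measurable_fun_xsection; apply: measurableI => //.
    by apply: measurableX => //; exact: measurableC.
  apply/funext => x; rewrite /mC /= /mrestr xsectionI; congr (m (_ `&` _)).
  by rewrite in_xsectionX// in_setT.
have := freezing hE WfinC law_cell points_cell mA AfinC m1C C0.
have -> : \int[M]_(z in [set z | (N z.1 `\` B) `&` xsection A (V z) = set0])
    (\1_C (V z))%:E = M (V @^-1` C `&`
      [set z | (N z.1 `\` B) `&` xsection A (V z) = set0]).
  by rewrite -integral_indic//; exact: mVC.
move=> e; transitivity (M (V @^-1` C `&`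
      [set z | (N z.1 `\` B) `&` xsection A (V z) = set0])).
  by rewrite /M/= /bounded_measure /mrestr setIAC.
rewrite e; transitivity (\int[cm]_(z in [set: Om] `*` B)
    ((\1_(V @^-1` C) z)%:E * expeR (- mC (xsection A (V z))))).
  apply: (@ge0_integral_mrestr _ _ _ cm _ mDB (fun z =>
    (\1_C (V z))%:E * expeR (- mC (xsection A (V z))))).
  - apply: emeasurable_funM; first exact: (measurableT_comp m1C mV).
    exact: (measurableT_comp mexp mV).
  - by move=> z; apply: mule_ge0; [exact: C0|exact: expeR_ge0].
rewrite ge0_integral_indic setIC.
by apply: eq_integral => z _; rewrite /mC/= /mrestr setDE.
Qed.

End cell.

Variables (A : set ((X * E) * E)) (mA : measurable A).
Hypothesis Afin : forall x, m (xsection A x) < +oo.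

(** For z above W n these sets decrease to {z.2} as k grows. *)
Let small n k (z : Om * E) : set E := W n `&` cell U (code U k z.2).

Let Aout n k : set ((Om * E) * E) :=
  [set zq | A (V zq.1, zq.2) /\ ~ small n k zq.1 zq.2].

Let mAout n k : measurable (Aout n k).
Proof.
have mAV : measurable [set zq : (Om * E) * E | A (V zq.1, zq.2)].
  have mg : measurable_fun setT (fun z : (Om * E) * E => (V z.1, z.2) : X * E * E).
    apply: measurable_fun_pair => //.
    exact: (measurableT_comp mV).
  by have := mg measurableT _ mA; rewrite setTI.
rewrite (_ : Aout n k = [set zq : (Om * E) * E | A (V zq.1, zq.2)] `\`
    \bigcup_(c in [set: {ffun 'I_k -> bool}])
      (([set: Om] `*` cell U c) `*` (W n `&` cell U c))).
  apply: measurableD => //; apply: fin_bigcup_measurable => // c _.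
  apply: measurableX; first by apply: measurableX => //; exact: measurable_cell.
  by apply: measurableI => //; exact: measurable_cell.
rewrite /Aout/small; apply/seteqP; split => -[[w p] q] /= [Apq h]; split => //.
  by move=> [c _ [[_ /= pc] [Wq qc]]]; apply: h; split => //=; rewrite pc.
by move=> [Wq qc]; apply: h; exists (code U k p).
Qed.

Let xsectionAout n k z :
  xsection (Aout n k) z = xsection A (V z) `\` small n k z.
Proof. by rewrite !xsectionE. Qed.

Let points_fst : random_points W (fun z : Om * E => N z.1).
Proof.
split; last by move=> z n; exact: (rp_fin fN).
move=> B mB; rewrite (_ : void _ B = void N B `*` setT).
  by apply: measurableX => //; exact: (rp_void fN).
by apply/seteqP; split => [[x w]//|[x w] []].
Qed.

Let voidout n k : set (Om * E) :=
  [set z | N z.1 `&` (xsection A (V z) `\` small n k z) = set0].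

Let mvoidout n k : measurable (voidout n k).
Proof.
have := measurable_void_xsection R hE points_fst (mAout n k).
congr measurable; apply/seteqP; rewrite /voidout; split => z /=;
  by rewrite xsectionAout.
Qed.

Let fout n k z := expeR (- m (xsection A (V z) `\` small n k z)).

Let mxA z : measurable (xsection A z). Proof. exact: measurable_xsection. Qed.

Let msmall n k z : measurable (small n k z).
Proof. by apply: measurableI => //; exact: measurable_cell. Qed.

Let mfout n k : measurable_fun setT (fout n k).
Proof.
apply: measurable_expeRN => //.
- rewrite (_ : (fun z => _) = (fun z => m (xsection (Aout n k) z))).
    exact: measurable_fun_xsection.
  by apply/funext => z; rewrite xsectionAout.
- move=> z; apply: le_lt_trans (Afin (V z)); apply: sub_le_measure => //.
  exact: measurableD.
Qed.

Let mcode k (c : {ffun 'I_k -> bool}) :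
  measurable [set z : Om * E | code U k z.2 = c].
Proof.
rewrite (_ : mkset _ = setT `*` cell U c).
  by apply: measurableX => //; exact: measurable_cell.
by apply/seteqP; split => [[x w]//|[x w] []].
Qed.

(** On each cell the neighbourhood of the point is the cell itself. *)
Let mecke_level n k (C : set (X * E)) : measurable C ->
  cm (V @^-1` C `&` ([set: Om] `*` W n) `&` voidout n k) =
  \int[cm]_(z in V @^-1` C `&` ([set: Om] `*` W n)) fout n k z.
Proof.
move=> mC.
have mD : measurable (V @^-1` C `&` ([set: Om] `*` W n)).
  by apply: measurableI; [exact: mVC|exact: measurableX].
rewrite (measure_fibers (@mcode k)); last by exact: measurableI.
rewrite (ge0_integral_fibers (@mcode k))//; last 2 first.
- exact: measurable_funTS.
- by move=> z _; exact: expeR_ge0.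
apply: eq_bigr => c _.
have mB : measurable (W n `&` cell U c).
  by apply: measurableI => //; exact: measurable_cell.
have Boo : m (W n `&` cell U c) < +oo.
  by apply: le_lt_trans (Wfin n); apply: sub_le_measure.
have DE : V @^-1` C `&` ([set: Om] `*` W n) `&` [set z | code U k z.2 = c] =
    V @^-1` C `&` ([set: Om] `*` (W n `&` cell U c)).
  by apply/seteqP; split => -[w p]/=; rewrite /cell/=; tauto.
rewrite DE; transitivity (\int[cm]_(z in V @^-1` C `&`
    ([set: Om] `*` (W n `&` cell U c)))
    expeR (- m (xsection A (V z) `\` (W n `&` cell U c)))); last first.
  apply: eq_integral => z /set_mem[_ [_ [_ /= zc]]].
  by rewrite /fout /small -zc.
rewrite -(mecke_cell mB Boo mA Afin mC); congr (cm _).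
have hE' (w : Om) p : code U k p = c ->
    (N w `&` (xsection A (V (w, p)) `\` (W n `&` cell U (code U k p)))) =
    (N w `\` (W n `&` cell U c)) `&` xsection A (V (w, p)).
  by move=> ->; apply/seteqP; split => q /=; tauto.
rewrite /voidout /small; apply/seteqP; split => -[w p]/=.
  by move=> [[[Cp [_ Wp]] h] pc]; rewrite -hE'.
by move=> [[Cp [_ [Wp pc]]] h]; rewrite hE'.
Qed.

Let voidpt : set (Om * E) :=
  [set z | N z.1 `&` (xsection A (V z) `\` [set z.2]) = set0].

Let bigcap_small n z : W n z.2 -> \bigcap_k small n k z = [set z.2].
Proof.
move=> Wz; rewrite -(bigcap_cell sepU z.2); apply/seteqP; split => q h k _.
  by have [] := h k I.
have qz : [set z.2] q by rewrite -(bigcap_cell sepU z.2).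
by split; [rewrite qz|exact: h].
Qed.

Let voidoutE n : ([set: Om] `*` W n) `&` \bigcap_k voidout n k =
  ([set: Om] `*` W n) `&` voidpt.
Proof.
apply/seteqP; split => z [[_ Wz] h]; split => //.
  rewrite /voidpt/=; apply/seteqP; split => // q [Nq [Aq qz]].
  have /existsNP[k /not_implyP[_ hk]] : ~ (\bigcap_k small n k z) q.
    by rewrite bigcap_small.
  suff : (set0 : set E) q by [].
  by rewrite -(h k I).
move=> k _; rewrite /voidout/=; apply/seteqP; split => // q [Nq [Aq qz]].
suff : (set0 : set E) q by [].
rewrite -h; split => //; split => // qe; apply: qz; rewrite qe.
have : (\bigcap_k small n k z) z.2 by rewrite bigcap_small.
by move/(_ k I).
Qed.

Let fout_cvg n z : W n z.2 ->
  fout n k z @[k --> \oo] --> expeR (- m (xsection A (V z))).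
Proof.
move=> Wz.
have mAs k : measurable (xsection A (V z) `&` W n `&` cell U (code U k z.2)).
  by apply: measurableI; [exact: measurableI|exact: measurable_cell].
have Aoo := Afin (V z).
have fs k : m (xsection A (V z) `&` W n `&` cell U (code U k z.2)) \is a fin_num.
  rewrite ge0_fin_numE//; apply: le_lt_trans Aoo; apply: sub_le_measure => //.
  by rewrite -setIA; exact: subIsetl.
have c0 : m (xsection A (V z) `&` W n `&` cell U (code U k z.2)) @[k --> \oo] --> 0.
  apply: (cell_mass_cvg mU sepU m_diffuse); first exact: measurableI.
  by apply: le_lt_trans Aoo; apply: sub_le_measure => //; exact: measurableI.
pose a := fine (m (xsection A (V z))).
have aE : m (xsection A (V z)) = a%:E by rewrite fineK// ge0_fin_numE.
pose x k := fine (m (xsection A (V z) `&` W n `&` cell U (code U k z.2))).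
have x0 : x k @[k --> \oo] --> 0%R by exact: (fine_cvg c0).
have -> : (fun k => fout n k z) = (fun k => (expR (- (a - x k)))%:E).
  apply/funext => k.
  have h : m (xsection A (V z) `\` small n k z) =
      m (xsection A (V z)) - m (xsection A (V z) `&` small n k z).
    exact: measureD.
  rewrite /fout h aE (_ : m (_ `&` _) = (x k)%:E)//.
  by rewrite /x fineK// /small setIA.
rewrite aE -[expeR _]/((expR (- a))%:E).
apply: cvg_EFin; first exact: nearW.
apply: (@cvg_comp _ _ _ (fun k => - (a - x k))%R expR _ (nbhs (- a)%R));
  last exact: continuous_expR.
suff : (- (a - x k))%R @[k --> \oo] --> (- (a - 0))%R by rewrite subr0.
by apply: cvgN; apply: cvgB => //; exact: cvg_cst.
Qed.

(** [mecke_cell] holds on each cell of a partition, and the cells shrink to the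
    point itself, which has mass zero. *)
Lemma mecke (C : set (X * E)) : measurable C ->
  cm (V @^-1` C `&` voidpt) =
  \int[cm]_(z in V @^-1` C) expeR (- m (xsection A (V z))).
Proof.
move=> mC; pose D n := V @^-1` C `&` ([set: Om] `*` W n).
have mD n : measurable (D n).
  by apply: measurableI; [exact: mVC|exact: measurableX].
have Doo n : cm (D n) < +oo.
  apply: (@le_lt_trans _ _ (cm (Y @^-1` setT `*` W n))).
    apply: sub_le_measure => //; last by move=> z [_ []].
    by apply: measurableX => //; exact: mYC.
  rewrite campbell_rectangle// lte_mul_pinfty//.
  by apply: fin_num_measure; exact: mYC.
have mvoid n k : measurable (D n `&` voidout n k) by exact: measurableI.
have DE n : D n `&` voidpt = \bigcap_k (D n `&` voidout n k).
  apply/seteqP; split => [z [[Cz Wz] vz]|z h].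
    have [_ h] : (([set: Om] `*` W n) `&` \bigcap_k voidout n k) z.
      by rewrite voidoutE.
    by move=> k _; split; [|exact: h].
  have [[Cz Wz] _] := h 0%N I; split => //.
  have [] : (([set: Om] `*` W n) `&` voidpt) z; last by [].
  by rewrite -voidoutE; split => // k _; have [] := h k I.
have level n : cm (D n `&` voidpt) =
    \int[cm]_(z in D n) expeR (- m (xsection A (V z))).
  have c1 : cm (D n `&` voidout n k) @[k --> \oo] --> cm (D n `&` voidpt).
    rewrite DE; apply: nonincreasing_cvg_mu => //.
    - apply: le_lt_trans (Doo n); apply: sub_le_measure => //.
    - exact: bigcapT_measurable.
    - move=> j k jk; apply/subsetPset => z [Dz h]; split => //.
      rewrite /voidout/=; apply/seteqP; split => // q [Nq [Aq qs]].
      rewrite -h; split => //; split => // -[Wq qc]; apply: qs; split => //.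
      exact: code_sub jk qc.
  have c2 : \int[cm]_(z in D n) fout n k z @[k --> \oo] -->
      \int[cm]_(z in D n) expeR (- m (xsection A (V z))).
    apply: (@dominated_cvg _ _ _ cm _ (mD n) (fout n) _ (cst 1)) => //.
    - by move=> k; exact: measurable_funTS.
    - by move=> z [_ [_ Wz]]; exact: fout_cvg.
    - apply/integrableP; split => //; under eq_integral do rewrite gee0_abs//.
      by rewrite integral_cst// mul1e; exact: Doo.
    - move=> k z _; rewrite gee0_abs ?expeR_ge0//.
      by rewrite -expeR0 lee_expeR oppe_le0.
  have e : (fun k => cm (D n `&` voidout n k)) =
      (fun k => \int[cm]_(z in D n) fout n k z).
    by apply/funext => k; exact: mecke_level.
  by move: c1; rewrite e => c1; exact: (cvg_unique _ c1 c2).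
have DT : \bigcup_n D n = V @^-1` C.
  by rewrite -setI_bigcupr -setX_bigcupr W_T setXTT setIT.
have ndD : {homo D : i j / (i <= j)%N >-> (i <= j)%O}.
  move=> i j ij; apply/subsetPset => z [Cz [_ Wz]]; split => //; split => //.
  by move: Wz; apply/subsetPset; exact: ndW.
have mDv n : measurable (D n `&` voidpt).
  by rewrite DE; exact: bigcapT_measurable.
have c1 : cm (D n `&` voidpt) @[n --> \oo] --> cm (V @^-1` C `&` voidpt).
  rewrite -DT setI_bigcupl; apply: nondecreasing_cvg_mu => //.
    exact: bigcupT_measurable.
  move=> i j ij; apply/subsetPset; apply: setSI; apply/subsetPset; exact: ndD.
have c2 : \int[cm]_(z in D n) expeR (- m (xsection A (V z))) @[n --> \oo] -->
    \int[cm]_(z in V @^-1` C) expeR (- m (xsection A (V z))).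
  rewrite -DT; apply: ge0_nondecreasing_set_cvg_integral => //.
  - move=> n; apply: measurable_funTS.
    apply: (measurableT_comp (f := fun x => expeR (- m (xsection A x)))) => //.
    by apply: measurable_expeRN => //; exact: measurable_fun_xsection.
  - by move=> *; exact: expeR_ge0.
have e : (fun n => cm (D n `&` voidpt)) =
    (fun n => \int[cm]_(z in D n) expeR (- m (xsection A (V z)))).
  by apply/funext => n; exact: level.
by move: c1; rewrite e => c1; exact: (cvg_unique _ c1 c2).
Qed.

Lemma measurable_voidpt : measurable voidpt.
Proof.
rewrite (_ : voidpt = \bigcup_n (([set: Om] `*` W n) `&` voidpt)).
  apply: bigcupT_measurable => n; rewrite -voidoutE; apply: measurableI.
    exact: measurableX.
  exact: bigcapT_measurable.
by rewrite -setI_bigcupl -setX_bigcupr W_T setXTT setTI.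
Qed.

Definition isolated (C : set (X * E)) : set (Om * E) :=
  [set z | C (Y z.1, z.2) /\
     N z.1 `&` (xsection A (Y z.1, z.2) `\` [set z.2]) = set0].

Lemma measurable_isolated C : measurable C -> measurable (isolated C).
Proof.
by move=> mC; apply: measurableI; [exact: mVC|exact: measurable_voidpt].
Qed.

(** Under the Campbell measure the pair of Y and p has law that of Y times m, so
    that [mecke] becomes an integral where p is no longer a point of N. *)
Lemma mecke_formula C : measurable C ->
  \int[Q]_w counting (N w `&` xsection (isolated C) w) =
  \int[lawY \x m]_x ((\1_C x)%:E * expeR (- m (xsection A x))).
Proof.
move=> mC; rewrite -[LHS]/(cm (V @^-1` C `&` voidpt)) mecke// -campbell_integral.
- by rewrite -(setTI (V @^-1` C)) -ge0_integral_indic.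
- apply: emeasurable_funM.
    by apply/measurable_EFinP; exact: measurable_indic.
  by apply: measurable_expeRN => //; exact: measurable_fun_xsection.
- by move=> x; rewrite mule_ge0 ?expeR_ge0 ?lee_fin.
Qed.

End mecke.

(** * The strip over the state space *)

Section strip.
Context {dT : measure_display} {T : measurableType dT} {R : realType}.
Local Notation E := (T * measurableTypeR R)%type.
Local Notation leb := (@lebesgue_measure R).

Lemma measurable_upper : measurable [set p : E | (0 <= p.2)%R].
Proof.
rewrite (_ : mkset _ = setT `*` `[0%R, +oo[%classic).
  by apply: measurableX => //; exact: measurable_itv.
by apply/seteqP; split => -[z v]/=; rewrite in_itv/= andbT; tauto.
Qed.

Variable mu : {sigma_finite_measure set T -> \bar R}.

(** The intensity mu times dv on the half-space of non-negative heights. *)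
Definition strip_measure : set E -> \bar R :=
  mrestr (mu \x leb) measurable_upper.

HB.instance Definition _ := Measure.on strip_measure.

Lemma strip_massE (A : set E) : strip_measure A =
  \int[mu]_z leb (xsection A z `&` `[0%R, +oo[%classic).
Proof.
rewrite /strip_measure /product_measure1; apply: eq_integral => z _ /=.
rewrite xsectionI; congr (leb (_ `&` _)).
by rewrite xsectionE; apply/seteqP; split => v /=; rewrite in_itv/= andbT.
Qed.

Lemma measurable_strip_section (A : set E) : measurable A ->
  measurable_fun setT (fun z => leb (xsection A z `&` `[0%R, +oo[%classic)).
Proof.
move=> mA.
have := measurable_fun_xsection leb (measurableI _ _ mA measurable_upper).
apply: eq_measurable_fun => z _ /=; rewrite xsectionI; congr (leb (_ `&` _)).
by rewrite xsectionE; apply/seteqP; split => v /=; rewrite in_itv/= andbT.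
Qed.

Lemma strip_slab_fin (D : set T) n : measurable D -> mu D < +oo ->
  strip_measure (D `*` (`]-oo, n%:R]%classic : set R)) < +oo.
Proof.
move=> mD Doo; rewrite strip_massE.
apply: (@le_lt_trans _ _ (n%:R%:E * mu D)); last first.
  by rewrite lte_mul_pinfty// ?lee_fin.
have m1 : measurable_fun setT (fun z => (\1_D z)%:E : \bar R).
  by apply/measurable_EFinP; exact: measurable_indic.
have -> : n%:R%:E * mu D = \int[mu]_z (n%:R%:E * (\1_D z)%:E).
  by rewrite ge0_integralZl// integral_indic// setIT.
apply: ge0_le_integral => //.
- by apply: measurable_strip_section; exact: measurableX.
- exact: measurable_funeM.
- move=> z _; rewrite indicE; have [zD|zD] := boolP (z \in D).
    rewrite in_xsectionX// mule1.
    rewrite (_ : _ `&` _ = `[0%R, n%:R]%classic); last first.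
      apply/seteqP; split => v /=; rewrite !in_itv/= andbT; first by move=> [-> ->].
      by move=> /andP[].
    rewrite lebesgue_measure_itv/= lte_fin; case: ifPn => // _.
    by rewrite -EFinB subr0.
  by rewrite notin_xsectionX// set0I measure0 mule0.
Qed.

Let strip_sigma_finite : sigma_finite setT strip_measure.
Proof.
have /sigma_finiteP[F [FT ndF mF]] := sigma_finiteT mu.
exists (fun n => F n `*` (`]-oo, n%:R]%classic : set R)).
  apply/seteqP; split => // -[z v] _.
  have [n _ Wz] : (\bigcup_n F n) z by rewrite -FT.
  have [k vk] : exists k : nat, (v <= k%:R)%R.
    by exists (Num.truncn v).+1; apply/ltW; exact: truncnS_gt.
  exists (maxn n k) => //; split => /=.
    by move: Wz; apply/subsetPset; exact: ndF (leq_maxl _ _).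
  by rewrite in_itv/=; apply: le_trans vk _; rewrite ler_nat leq_maxr.
move=> n; have [mFn Foo] := mF n; split; last exact: strip_slab_fin.
by apply: measurableX => //; exact: measurable_itv.
Qed.

HB.instance Definition _ := Measure_isSigmaFinite.Build _ _ _ strip_measure
  strip_sigma_finite.

(** Vertical lines carry Lebesgue measure, which is diffuse, whatever mu is. *)
Lemma strip_diffuse p : strip_measure [set p] = 0.
Proof.
rewrite strip_massE; apply: integral0_eq => z _.
apply/eqP; rewrite eq_le measure_ge0 andbT -(@lebesgue_measure_set1 R p.2).
apply: sub_le_measure.
- apply: measurableI; last exact: measurable_itv.
  rewrite xsectionE; have [zp|zp] := pselect (z = p.1).
    rewrite (_ : _ @^-1` _ = [set p.2]); first exact: measurable_set1.
    apply/seteqP; split => v /=; first by move=> <-.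
    by move=> ->; rewrite zp; case: (p).
  rewrite (_ : _ @^-1` _ = set0)//; apply/seteqP; split => v //= e.
  by apply: zp; rewrite -e.
- exact: measurable_set1.
- by rewrite xsectionE => v [/= <-].
Qed.

Lemma strip_integral (f : E -> \bar R) : measurable_fun setT f ->
  (forall p, 0 <= f p) -> \int[strip_measure]_p f p =
  \int[mu]_z \int[leb]_(v in `[0%R, +oo[) f (z, v).
Proof.
move=> mf f0; rewrite ge0_integral_mrestr// integral_mkcond fubini_tonelli1//.
- apply: eq_integral => z _; rewrite /fubini_F [RHS]integral_mkcond.
  apply: eq_integral => v _; rewrite !patchE.
  suff -> : ((z, v) \in [set p : E | (0 <= p.2)%R]) =
    (v \in `[0%R, +oo[%classic) by [].
  by apply/idP/idP => /set_mem/=; rewrite ?in_itv/= ?andbT => h; apply/mem_set;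
    rewrite /= ?in_itv/= ?andbT.
- apply/(measurable_restrictT _ _).1; first exact: measurable_upper.
  exact: measurable_funTS.
- by move=> p; rewrite patchE; case: ifP.
Qed.

End strip.

Section strip_exhaustion.
Context {dT : measure_display} {T : measurableType dT} {R : realType}.
Local Notation E := (T * measurableTypeR R)%type.
Variables (TU TW : nat -> set T).
Hypothesis hT : ground_space TU TW.
Variable mu : {sigma_finite_measure set T -> \bar R}.
Hypothesis TWfin : forall n, mu (TW n) < +oo.

(** Enumerates the rationals; indices that code no rational give 0. *)
Definition rational_bound (i : nat) : R := ratr (odflt 0%R (choice.unpickle i)).

(** Odd indices separate the heights, even indices the positions. *)
Definition stripU (i : nat) : set E :=
  if odd i then setT `*` `]-oo, rational_bound (half i)[%classic
  else TU (half i) `*` setT.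

Let stripU_odd n :
  stripU n.*2.+1 = setT `*` `]-oo, rational_bound n[%classic.
Proof. by rewrite /stripU /= odd_double/= uphalf_double. Qed.

Definition stripW (n : nat) : set E := TW n `*` (`]-oo, n%:R]%classic : set R).

Lemma ground_space_strip : ground_space stripU stripW.
Proof.
have [mU sepU mW ndW W_T] := hT; split.
- move=> i; rewrite /stripU; case: ifP => _; last exact: measurableX.
  by apply: measurableX => //; exact: measurable_itv.
- move=> [z v] [z' v'] h.
  have -> : z = z'.
    apply: sepU => i; have := h i.*2; rewrite /stripU odd_double doubleK/=.
    by tauto.
  congr pair.
  have hq (q : rat) : (v < ratr q)%R <-> (v' < ratr q)%R.
    have := h (choice.pickle q).*2.+1.
    rewrite stripU_odd (_ : rational_bound _ = ratr q); last first.
      by rewrite /rational_bound choice.pickleK.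
    by rewrite /= !in_itv/=; tauto.
  apply/eqP; rewrite eq_le !leNgt; apply/andP; split; apply/negP => /rat_in_itvoo[q];
    rewrite in_itv/= => /andP[h1 h2].
    by have := (hq q).2 h1; rewrite ltNge (ltW h2).
  by have := (hq q).1 h1; rewrite ltNge (ltW h2).
- by move=> n; apply: measurableX => //; exact: measurable_itv.
- move=> i j ij; apply/subsetPset => -[z v] [/= Wz vi]; split => /=.
    by move: Wz; apply/subsetPset; exact: ndW.
  by move: vi; rewrite !in_itv/= => /le_trans; apply; rewrite ler_nat.
- apply/seteqP; split => // -[z v] _.
  have [n _ Wz] : (\bigcup_n TW n) z by rewrite W_T.
  have [k vk] : exists k : nat, (v <= k%:R)%R.
    by exists (Num.truncn v).+1; apply/ltW; exact: truncnS_gt.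
  exists (maxn n k) => //; split => /=.
    by move: Wz; apply/subsetPset; exact: ndW (leq_maxl _ _).
  by rewrite in_itv/=; apply: le_trans vk _; rewrite ler_nat leq_maxr.
Qed.

Lemma stripW_fin n : strip_measure mu (stripW n) < +oo.
Proof.
rewrite /stripW; apply: strip_slab_fin; [exact: (gs_measurableW hT)|exact: TWfin].
Qed.

End strip_exhaustion.

(** * Regions below and above a graph *)

Section graph_sets.
Context {dT : measure_display} {T : measurableType dT} {R : realType}.
Local Notation RB := (measurableTypeR R).
Local Notation E := (T * RB)%type.
Local Notation leb := (@lebesgue_measure R).

(** The region swept by the graph of h when it rises from height zero. *)
Definition under (h : T -> R) : set E := [set p | (p.2 <= h p.1)%R].

(** A moved upwards by h: a configuration avoids it when the same configuration,
    with heights measured from the graph of h, avoids A. *)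
Definition lift (h : T -> R) (A : set E) : set E :=
  [set p | (h p.1 < p.2)%R /\ A (p.1, p.2 - h p.1)%R].

Lemma measurable_under_param dP (P : measurableType dP) (h : P * T -> R) :
  measurable_fun setT h ->
  measurable [set z : P * E | under (fun t => h (z.1, t)) z.2].
Proof.
move=> mh.
have m1 : measurable_fun setT (fun z : P * E => z.2.2 : R).
  exact: (measurableT_comp (f := snd : E -> R)).
have m2 : measurable_fun setT (fun z : P * E => h (z.1, z.2.1)).
  apply: (measurableT_comp mh); apply: measurable_fun_pair => //.
  exact: measurableT_comp.
have := measurable_fun_ler m1 m2 measurableT (_ : measurable [set true]).
by rewrite setTI; apply.
Qed.

Lemma measurable_lift_param dP (P : measurableType dP) (h : P * T -> R)
    (A : set E) : measurable_fun setT h -> measurable A ->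
  measurable [set z : P * E | lift (fun t => h (z.1, t)) A z.2].
Proof.
move=> mh mA.
have m1 : measurable_fun setT (fun z : P * E => z.2.2 : R).
  exact: (measurableT_comp (f := snd : E -> R)).
have m2 : measurable_fun setT (fun z : P * E => h (z.1, z.2.1)).
  apply: (measurableT_comp mh); apply: measurable_fun_pair => //.
  exact: measurableT_comp.
have m3 : measurable_fun setT (fun z : P * E =>
    (z.2.1, z.2.2 - h (z.1, z.2.1))%R : E).
  apply: measurable_fun_pair; first exact: measurableT_comp.
  exact: measurable_funB.
have h1 : measurable [set z : P * E | (h (z.1, z.2.1) < z.2.2)%R].
  have := measurable_fun_ltr m2 m1 measurableT (_ : measurable [set true]).
  by rewrite setTI; apply.
have h2 := m3 measurableT _ mA; rewrite setTI in h2.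
by have := measurableI _ _ h1 h2; congr measurable.
Qed.

Lemma lebesgue_translate (c : R) (B : set RB) : measurable B ->
  leb [set v | B (v - c)%R] = leb B.
Proof.
move=> mB.
have mf : measurable_fun setT ((fun v => v - c)%R : RB -> RB).
  by apply: measurable_funB.
pose nu : {measure set RB -> \bar R} :=
  measure_function_pushforward__canonical__measure_function_Measure leb mf.
apply/esym/(@lebesgue_measure_unique R nu) => // _ [[a b]] _ <-.
rewrite /nu/= /pushforward.
have -> : (fun v : RB => v - c)%R @^-1` [set` `]a, b]%R] = [set` `]a + c, b + c]%R].
  by apply/seteqP; split => v /=; rewrite !in_itv/= ltrBrDr lerBlDr.
rewrite !lebesgue_measure_itv/= !lte_fin ltrD2r; case: ifP => // _.
by rewrite -!EFinB; congr EFin; ring.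
Qed.

Variable mu : {sigma_finite_measure set T -> \bar R}.
Local Notation m := (strip_measure mu).

Lemma strip_mass_under (h : T -> R) : measurable_fun setT h ->
  (forall z, 0 <= h z)%R -> m (under h) = \int[mu]_z (h z)%:E.
Proof.
move=> mh h0; rewrite strip_massE; apply: eq_integral => z _.
rewrite xsectionE (_ : _ `&` _ = `[0%R, h z]%classic).
  rewrite lebesgue_measure_itv/= lte_fin -EFinB subr0.
  by have := h0 z; rewrite le_eqVlt => /orP[/eqP <-|->]//; rewrite ltxx.
apply/seteqP; split => v /=; rewrite !in_itv/= andbT.
  by move=> [vh ->].
by move=> /andP[-> vh].
Qed.

(** Vertical translations preserve Lebesgue measure; the part of A at height zero
    is lost, and is null. *)
Lemma strip_mass_lift (h : T -> R) (A : set E) : (forall z, 0 <= h z)%R ->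
  measurable A -> m (lift h A) = m A.
Proof.
move=> h0 mA; rewrite !strip_massE; apply: eq_integral => z _.
have mAz : measurable (xsection A z) by exact: measurable_xsection.
pose B := xsection A z `&` `]0%R, +oo[%classic.
have mB : measurable B by apply: measurableI => //; exact: measurable_itv.
transitivity (leb B).
  rewrite -(lebesgue_translate (h z) mB); congr (leb _).
  rewrite xsectionE; apply/seteqP; split => v /=; rewrite /B/= xsectionE !in_itv/= !andbT subr_gt0.
    by move=> [[? ?] _].
  by move=> [? h1]; split => //; apply: le_trans (ltW h1).
apply/eqP; rewrite eq_le; apply/andP; split.
  apply: sub_le_measure => //; first by apply: measurableI => //; exact: measurable_itv.
  by move=> v [Av]; rewrite /= !in_itv/= !andbT => v0; split => //; exact: ltW.
apply: (@le_trans _ _ (leb (B `|` [set 0%R]))).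
  apply: sub_le_measure.
  - by apply: measurableI => //; exact: measurable_itv.
  - by apply: measurableU => //; exact: measurable_set1.
  - move=> v [Av]; rewrite /= !in_itv/= !andbT le_eqVlt => /orP[/eqP <-|v0].
      by right.
    by left; split => //; rewrite /= in_itv/= v0.
apply: (le_trans (measureU2 leb mB (measurable_set1 0%R))).
by rewrite [X in _ + X](_ : _ = 0) ?adde0//; exact: lebesgue_measure_set1.
Qed.

Lemma under_lift_disjoint (h : T -> R) (A : set E) :
  under h `&` lift h A = set0.
Proof.
by apply/seteqP; split => // p [h1 [h2 _]]; move: h1; rewrite /under/= leNgt h2.
Qed.

End graph_sets.

Lemma measurable_funV d (T : measurableType d) (R : realType) (f : T -> R) :
  measurable_fun setT f -> (forall x, 0 <= f x)%R ->
  measurable_fun setT (fun x => (f x)^-1)%R.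
Proof.
move=> mf f0; rewrite (_ : (fun x => _) = (fun x => powR (f x) (-1)))%R.
  exact: (measurableT_comp (f := (@powR R ^~ (-1))%R)).
by apply/funext => x; rewrite powR_inv1.
Qed.

(** Integral of the density of an exponential variable, up to the factor c. *)
Lemma integral_exp_density (R : realType) (c : R) : (0 < c)%R ->
  \int[lebesgue_measure]_(v in `[0%R, +oo[) (expR (- (v / c)))%:E = c%:E.
Proof.
move=> c0; have := @integral_exponential_pdf R c^-1%R.
rewrite invr_gt0 => /(_ c0) e.
transitivity (\int[lebesgue_measure]_(v in `[0%R, +oo[)
    (c%:E * (exponential_pdf c^-1%R v)%:E)).
  apply: eq_integral => v /set_mem; rewrite /= in_itv/= andbT => v0.
  rewrite exponential_pdfE// -EFinM; congr EFin.
  by rewrite mulrA divff ?gt_eqF// mul1r mulNr mulrC.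
rewrite ge0_integralZl//=.
- rewrite [X in _ * X](_ : _ = 1) ?mule1// -e integral_mkcond.
  apply: eq_integral => v _; rewrite patchE; case: ifPn => // nv.
  by rewrite /exponential_pdf patchE (negbTE nv).
- apply/measurable_EFinP; apply: measurable_funTS.
  exact: measurable_exponential_pdf.
- by move=> v _; rewrite lee_fin exponential_pdf_ge0// invr_ge0 ltW.
- by rewrite lee_fin ltW.
Qed.

Lemma expeRN_EFinD (R : realType) (r : R) (x : \bar R) :
  expeR (- (r%:E + x)) = (expR (- r))%:E * expeR (- x).
Proof.
case: x => [x| |] /=; rewrite ?mule0//; last by rewrite gt0_muley// lte_fin expR_gt0.
by rewrite opprD expRD.
Qed.

(** * One step of the construction *)

Section selection.
Context {dT : measure_display} {T : measurableType dT} {R : realType}.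
Local Notation E := (T * measurableTypeR R)%type.
Implicit Types (h : T -> R) (S : set E) (p : E).

(** The time at which the growing graph of t h reaches the point p. *)
Definition rise h p : R := (p.2 / h p.1)%R.

(** The point p is the first one that the growing graph of t h reaches. *)
Definition sel h S p : Prop := [/\ S p, (0 < h p.1)%R &
  forall q, S q -> q <> p -> (rise h p * h q.1 < q.2)%R].

(** The configuration seen from the graph that stops at p, with p removed. *)
Definition residual h S p : set E :=
  [set q | exists q0, [/\ S q0, (rise h p * h q0.1 < q0.2)%R &
     q = (q0.1, q0.2 - rise h p * h q0.1)%R]].

(** Each of two selected points would be reached strictly before the other. *)
Lemma sel_unique h S p q : sel h S p -> sel h S q -> p = q.
Proof.
move=> [Sp hp pS] [Sq hq qS]; apply: contrapT => pq.
have h1 := pS q Sq (fun e => pq (esym e)); have h2 := qS p Sp pq.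
have h3 : (rise h p < rise h q)%R by rewrite /rise ltr_pdivlMr.
have h4 : (rise h q < rise h p)%R by rewrite /rise ltr_pdivlMr.
by have := lt_trans h3 h4; rewrite ltxx.
Qed.

Lemma residual_void h S p A : residual h S p `&` A = set0 <->
  S `&` lift (fun z => rise h p * h z)%R A = set0.
Proof.
split=> hS; apply/seteqP; split => // q.
  move=> [Sq [hq Aq]].
  suff : (set0 : set E) (q.1, q.2 - rise h p * h q.1)%R by [].
  by rewrite -hS; split => //; exists q.
move=> [[q0 [Sq0 hq0 qE]] Aq]; suff : (set0 : set E) q0 by [].
by rewrite -hS; split => //; split => //; rewrite -qE.
Qed.

Lemma rise_sel h S p : sel h S p -> (rise h p * h p.1)%R = p.2.
Proof. by move=> [_ hp _]; rewrite /rise divfK// gt_eqF. Qed.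

End selection.

Section step.
Context {dT : measure_display} {T : measurableType dT} {R : realType}.
Local Notation E := (T * measurableTypeR R)%type.
Variables (TU TW : nat -> set T).
Hypothesis hT : ground_space TU TW.
Variable mu : {sigma_finite_measure set T -> \bar R}.
Hypothesis TWfin : forall n, mu (TW n) < +oo.
Let m : {sigma_finite_measure set E -> \bar R} := strip_measure mu.
Let hE : ground_space (stripU TU) (@stripW _ _ R TW) := ground_space_strip hT.
Let Wfin : forall n, m (stripW TW n) < +oo := stripW_fin hT TWfin.

Context d (Om : measurableType d) (Q : {finite_measure set Om -> \bar R}).
Context dX (X : measurableType dX) (Y : Om -> X) (N : Om -> set E).
Hypothesis hN : void_law m Q Y N.
Hypothesis fN : random_points (stripW TW) N.
Hypothesis posN : forall w p, N w p -> (0 < p.2)%R.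

Variable gam : X -> T -> R.
Hypothesis mgam : measurable_fun setT (fun p : X * T => gam p.1 p.2).
Hypothesis gam0 : forall x z, (0 <= gam x z)%R.
Hypothesis gam1 : forall x, \int[mu]_z (gam x z)%:E = 1.

(** The absolute value keeps the graph non-negative for points below the strip. *)
Let rate (x : X * E) : R := `|rise (gam x.1) x.2|%R.

(** Its section must contain no other point of N for p to be selected with a
    residual configuration that avoids A. *)
Let region (A : set E) : set ((X * E) * E) :=
  [set z | under (fun t => rate z.1 * gam z.1.1 t)%R z.2 \/
           lift (fun t => rate z.1 * gam z.1.1 t)%R A z.2].

Let range (B : set T) : set (X * E) :=
  [set x | B x.2.1 /\ (0 < gam x.1 x.2.1)%R].

Let mgam_pt : measurable_fun setT (fun x : X * E => gam x.1 x.2.1).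
Proof.
apply: (measurableT_comp (f := fun p : X * T => gam p.1 p.2)
  (g := fun x : X * E => (x.1, x.2.1))) => //.
by apply: measurable_fun_pair => //; exact: measurableT_comp.
Qed.

Let mrate : measurable_fun setT rate.
Proof.
apply: measurableT_comp => //; apply: measurable_funM.
  exact: (measurableT_comp (f := snd : E -> R)).
exact: measurable_funV.
Qed.

Let mheight : measurable_fun setT
  (fun z : (X * E) * T => rate z.1 * gam z.1.1 z.2)%R.
Proof.
apply: measurable_funM; first exact: measurableT_comp.
apply: (measurableT_comp (f := fun p : X * T => gam p.1 p.2)
  (g := fun z : (X * E) * T => (z.1.1, z.2))) => //.
by apply: measurable_fun_pair => //; exact: measurableT_comp.
Qed.

Let mregion A : measurable A -> measurable (region A).
Proof.
move=> mA; apply: measurableU.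
  exact: (measurable_under_param mheight).
exact: (measurable_lift_param mheight mA).
Qed.

Let mrange B : measurable B -> measurable (range B).
Proof.
move=> mB; apply: measurableI.
  have mf : measurable_fun setT (fun x : X * E => x.2.1) by exact: measurableT_comp.
  by have := mf measurableT _ mB; rewrite setTI.
have mc : measurable_fun setT (fun _ : X * E => 0%R : R) by [].
have := measurable_fun_ltr mc mgam_pt measurableT (_ : measurable [set true]).
by rewrite setTI; apply.
Qed.

Let mgamx x : measurable_fun setT (gam x).
Proof. exact: (measurable_fun_pair2 (f := fun p : X * T => gam p.1 p.2)). Qed.

Let region_mass A x : measurable A ->
  m (xsection (region A) x) = (rate x)%:E + m A.
Proof.
move=> mA; pose h t := (rate x * gam x.1 t)%R.
have h0 t : (0 <= h t)%R by rewrite mulr_ge0// normr_ge0.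
have mh : measurable_fun setT h by apply: measurable_funM.
have -> : xsection (region A) x = under h `|` lift h A by rewrite xsectionE.
have mU : measurable (under h).
  by have := measurable_xsection x (measurable_under_param mheight); rewrite xsectionE.
have mL : measurable (lift h A).
  by have := measurable_xsection x (measurable_lift_param mheight mA); rewrite xsectionE.
transitivity (m (under h) + m (lift h A)).
  apply: measureU => //; exact: under_lift_disjoint.
have e1 : m (under h) = (rate x)%:E.
  transitivity (\int[mu]_z (h z)%:E); first exact: strip_mass_under.
  rewrite /h; under eq_integral do rewrite EFinM.
  rewrite ge0_integralZl//.
  - by rewrite gam1 mule1.
  - exact/measurable_EFinP.
  - by move=> z _; rewrite lee_fin.
  - by rewrite lee_fin normr_ge0.
have e2 : m (lift h A) = m A by exact: strip_mass_lift.
by rewrite e1 e2.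
Qed.

(** These events determine the joint law of the new position and of the new
    configuration. *)
Definition event (B : set T) (A : set E) : set Om :=
  [set w | exists p, [/\ sel (gam (Y w)) (N w) p, B p.1 &
    residual (gam (Y w)) (N w) p `&` A = set0]].

Let isol B A := isolated Y N (region A) (range B).

Let isolE B A w : N w `&` xsection (isol B A) w =
  [set p | [/\ sel (gam (Y w)) (N w) p, B p.1 &
    residual (gam (Y w)) (N w) p `&` A = set0]].
Proof.
rewrite xsectionE /isol; apply/seteqP; split => p.
  move=> [Np [[/= Bp hp] h]].
  have rp : rate (Y w, p) = rise (gam (Y w)) p.
    by rewrite /rate/= ger0_norm// divr_ge0// ltW// (posN Np).
  rewrite xsectionE in h.
  have hsel : sel (gam (Y w)) (N w) p.
    split => // q Nq qp; rewrite ltNge; apply/negP => hq.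
    suff : (set0 : set E) q by [].
    by rewrite -h; split => //; split => //; left; rewrite /under/= rp.
  split => //; apply/residual_void; apply/seteqP; split => // q [Nq Lq].
  suff : (set0 : set E) q by [].
  rewrite -h; split => //; split; first by right; rewrite rp.
  by move=> /= qp; move: Lq => [/=]; rewrite qp (rise_sel hsel) ltxx.
move=> [hsel Bp /residual_void hA]; have [Np hp hq] := hsel.
have rp : rate (Y w, p) = rise (gam (Y w)) p.
  by rewrite /rate/= ger0_norm// divr_ge0// ltW// (posN Np).
split => //; split => //; rewrite xsectionE.
apply/seteqP; split => // q [Nq [[hU|hL] qp]].
  by have := hq q Nq qp; move: hU; rewrite /under/= rp leNgt => /negP.
suff : (set0 : set E) q by [].
by rewrite -hA; split => //; move: hL; rewrite /= rp.
Qed.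

(** A sum over the points of N with at most one non-zero term: this is what
    turns the Mecke formula into a probability. *)
Let event_count B A w :
  counting (N w `&` xsection (isol B A) w) = (\1_(event B A) w)%:E :> \bar R.
Proof.
rewrite isolE indicE; have [[p [hp Bp Ap]]|hw] := pselect (event B A w).
  rewrite mem_set; last by exists p.
  rewrite (_ : mkset _ = [set p]); first by rewrite /counting asboolT// fset_set1 cardfs1.
  apply/seteqP; split => [q [hq _ _]|_ ->//]; exact: (sel_unique hq hp).
rewrite memNset// (_ : mkset _ = set0); first by rewrite /counting asboolT// fset_set0.
by apply/seteqP; split => // q hq; apply: hw; exists q.
Qed.

Let region_fin A x : measurable A -> m A < +oo ->
  m (xsection (region A) x) < +oo.
Proof. by move=> mA Aoo; rewrite region_mass// lte_add_pinfty// ltry. Qed.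

Let misol B A : measurable B -> measurable A -> measurable (isol B A).
Proof.
move=> mB mA.
exact: (measurable_isolated hE hN fN (mregion mA) (mrange mB)).
Qed.

Lemma measurable_event B A : measurable B -> measurable A ->
  measurable (event B A).
Proof.
move=> mB mA.
have := measurable_void_xsection R hE fN (misol mB mA) => /measurableC.
congr measurable; apply/seteqP; split => w /=.
  move/eqP/set0P => [p]; rewrite isolE => -[h1 h2 h3].
  by exists p.
move=> [p hp] /seteqP[+ _] => /(_ p); apply.
by rewrite isolE.
Qed.

(** The region swept until p = (z, v) is reached has mass v / gam(z), and
    exp(- v / gam(z)) integrates to gam(z) over v: the new position has density
    gam. *)
Let exit_mass y A B : measurable A -> measurable B -> m A < +oo ->
  \int[m]_p ((\1_(range B) (y, p))%:E * expeR (- m (xsection (region A) (y, p)))) =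
  \int[mu]_(z in B) (gam y z)%:E * expeR (- m A).
Proof.
move=> mA mB Aoo.
have mf : measurable_fun setT (fun p : E => (\1_(range B) (y, p))%:E *
    expeR (- m (xsection (region A) (y, p)))).
  apply: emeasurable_funM.
    apply/measurable_EFinP.
    apply: (measurableT_comp (f := \1_(range B) : X * E -> R)
      (g := fun p : E => (y, p))); last exact: measurable_pair1.
    by apply: measurable_indic; exact: mrange.
  apply: (measurableT_comp (f := fun x => expeR (- m (xsection (region A) x)))
      (g := fun p : E => (y, p))); last exact: measurable_pair1.
  apply: measurable_expeRN => //; last by move=> x; exact: region_fin.
  by apply: measurable_fun_xsection; exact: mregion.
have f0 p : 0 <= (\1_(range B) (y, p))%:E * expeR (- m (xsection (region A) (y, p))).
  by rewrite mule_ge0 ?expeR_ge0// lee_fin.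
transitivity (\int[mu]_z \int[@lebesgue_measure R]_(v in `[0%R, +oo[)
  ((\1_(range B) (y, (z, v)))%:E * expeR (- m (xsection (region A) (y, (z, v)))))).
  exact: strip_integral mf f0.
rewrite [X in X * _]integral_mkcond -ge0_integralZr//; last 3 first.
- apply/(measurable_restrictT _ mB).1; apply: measurable_funTS.
  exact/measurable_EFinP.
- by move=> z _; rewrite patchE; case: ifP => // _; rewrite lee_fin.
- exact: expeR_ge0.
apply: eq_integral => z _; rewrite patchE.
have [zB|zB] := boolP (z \in B); last first.
  rewrite mul0e; apply: integral0_eq => v _; rewrite indicE memNset ?mul0e//.
  by move=> [/= Bz _]; move: zB; rewrite mem_set.
have := gam0 y z; rewrite le_eqVlt => /orP[/eqP g0|g0].
  rewrite -g0 mul0e; apply: integral0_eq => v _; rewrite indicE memNset ?mul0e//.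
  by move=> [_ /=]; rewrite -g0 ltxx.
transitivity (\int[@lebesgue_measure R]_(v in `[0%R, +oo[)
   ((expR (- (v / gam y z)))%:E * expeR (- m A))).
  apply: eq_integral => v /set_mem; rewrite /= in_itv/= andbT => v0.
  rewrite indicE mem_set; last by split => //=; exact: set_mem.
  rewrite mul1e region_mass// expeRN_EFinD; congr ((expR (- _))%:E * _).
  by rewrite /rate/= /rise/= ger0_norm// divr_ge0.
rewrite ge0_integralZr//.
- by rewrite integral_exp_density.
- apply: measurable_funTS; apply/measurable_EFinP; apply: measurableT_comp => //.
  by apply: measurable_funN; exact: mulrr_measurable.
- exact: expeR_ge0.
Qed.

Lemma measurable_density_mass B : measurable B ->
  measurable_fun setT (fun y => \int[mu]_(z in B) (gam y z)%:E).
Proof.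
move=> mB.
have mf : measurable_fun setT (fun p : X * T => (\1_B p.2)%:E * (gam p.1 p.2)%:E).
  apply: emeasurable_funM; last exact/measurable_EFinP.
  apply/measurable_EFinP; apply: (measurableT_comp (f := \1_B : T -> R)) => //.
have f0 (p : X * T) : 0 <= (\1_B p.2)%:E * (gam p.1 p.2)%:E.
  by rewrite mule_ge0// lee_fin.
have := @measurable_fun_fubini_tonelli_F _ _ X T R mu _ mf f0.
apply: eq_measurable_fun => y _; rewrite /fubini_F.
by rewrite ge0_integral_indic setTI.
Qed.

(** A point is selected, with a residual configuration that avoids A, when the
    union of the region under the graph and of the lift of A contains no other
    point. This is the setting of the Mecke formula. *)
Lemma prob_event B A : measurable B -> measurable A -> m A < +oo ->
  Q (event B A) =
  \int[Q]_w (\int[mu]_(z in B) (gam (Y w) z)%:E * expeR (- m A)).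
Proof.
move=> mB mA Aoo.
have mev := measurable_event mB mA.
rewrite -(setIT (event B A)) -integral_indic//.
transitivity (\int[Q]_w (counting (N w `&` xsection (isol B A) w) : \bar R)).
  by apply: eq_integral => w _; rewrite event_count.
rewrite (mecke_formula hE (strip_diffuse mu) Wfin hN fN (mregion mA))//; last 2 first.
- by move=> x; exact: region_fin.
- exact: mrange.
rewrite fubini_tonelli1//; last 2 first.
- apply: emeasurable_funM.
    apply/measurable_EFinP; apply: measurable_indic; exact: mrange.
  apply: measurable_expeRN => //; last by move=> x; exact: region_fin.
  by apply: measurable_fun_xsection; exact: mregion.
- by move=> x; rewrite mule_ge0 ?expeR_ge0// lee_fin.
rewrite /fubini_F; under eq_integral do rewrite exit_mass//.
rewrite ge0_integral_pushforward//.
- exact: (vl_fun hN).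
- by apply: emeasurable_funM => //; exact: measurable_density_mass.
- move=> y _; rewrite mule_ge0 ?expeR_ge0//; apply: integral_ge0 => z _.
  by rewrite lee_fin.
Qed.

Local Notation leb := (@lebesgue_measure R).

Let empty_until (w : Om) (s : R) : Prop :=
  N w `&` under (fun t => s * gam (Y w) t)%R = set0.

(** The time until the growing graph meets a point, as the integral over s of
    the indicator that it has not met any at time s. Unlike the infimum it is
    measurable by Tonelli. *)
Definition exit_time (w : Om) : \bar R :=
  \int[leb]_(s in `[0%R, +oo[) (\1_[set s | empty_until w s] s)%:E.

Lemma exit_time_sel w p : sel (gam (Y w)) (N w) p ->
  exit_time w = (rise (gam (Y w)) p)%:E.
Proof.
move=> hsel; have [Np hp hq] := hsel; set r := rise _ _.
have r0 : (0 <= r)%R by rewrite divr_ge0// ltW// (posN Np).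
transitivity (\int[leb]_(s in `[0%R, +oo[) (\1_(`[0%R, r[%classic) s)%:E).
  apply: eq_integral => s /set_mem; rewrite /= in_itv/= andbT => s0.
  congr EFin; rewrite !indicE; congr (_%:R); congr nat_of_bool.
  apply/idP/idP => /set_mem; rewrite /= ?in_itv/= ?s0/= => h; apply/mem_set;
    rewrite /= ?in_itv/= ?s0/=.
    rewrite ltNge; apply/negP => rs.
    suff : (set0 : set E) p by [].
    rewrite -h; split => //; rewrite /under/= -(rise_sel hsel).
    by rewrite ler_wpM2r.
  apply/seteqP; split => // q [Nq]; rewrite /under/= leNgt => /negP; apply.
  have [->|qp] := pselect (q = p).
    by rewrite -(rise_sel hsel) ltr_pM2r.
  by apply: le_lt_trans (hq q Nq qp); rewrite ler_wpM2r// ltW.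
transitivity (leb (`[0%R, r[%classic : set R)).
  rewrite integral_indic// setIidl// => s /=.
  by rewrite !in_itv/= andbT => /andP[].
rewrite lebesgue_measure_itv/= lte_fin -EFinB subr0.
by move: r0; rewrite le_eqVlt => /orP[/eqP <-|->]//; rewrite ltxx.
Qed.

Let points_time : random_points (stripW TW) (fun z : Om * measurableTypeR R => N z.1).
Proof.
split; last by move=> z n; exact: (rp_fin fN).
move=> B mB; rewrite (_ : void _ B = void N B `*` setT).
  by apply: measurableX => //; exact: (rp_void fN).
by apply/seteqP; split => [[x w]//|[x w] []].
Qed.

Let still : set (Om * measurableTypeR R) :=
  [set z | 0 <= z.2 /\ empty_until z.1 z.2]%R.

Let mstill : measurable still.
Proof.
apply: measurableI; first exact: measurable_upper.
have mh : measurable_fun setT (fun z : (Om * measurableTypeR R) * T =>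
    z.1.2 * gam (Y z.1.1) z.2)%R.
  apply: measurable_funM; first exact: (measurableT_comp (f := snd)).
  apply: (measurableT_comp (f := fun p : X * T => gam p.1 p.2)
    (g := fun z : (Om * measurableTypeR R) * T => (Y z.1.1, z.2))) => //.
  apply: measurable_fun_pair => //.
  apply: (measurableT_comp (vl_fun hN)); exact: measurableT_comp.
have := measurable_void_xsection R hE points_time (measurable_under_param mh).
by congr measurable; apply/seteqP; split => z /=; rewrite xsectionE.
Qed.

Let exit_timeE w : exit_time w = \int[leb]_s (\1_still (w, s))%:E.
Proof.
rewrite /exit_time integral_mkcond; apply: eq_integral => s _.
rewrite patchE; case: ifPn => [/set_mem|/negP ns].
  rewrite /= in_itv/= andbT => s0; rewrite !indicE; congr (_%:R%:E).
  by congr nat_of_bool; apply/idP/idP => /set_mem h; apply/mem_set => //; case: h.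
rewrite indicE memNset// => -[/= s0 _]; apply: ns; apply/mem_set.
by rewrite /= in_itv/= s0.
Qed.

Lemma exit_time_ge0 w : 0 <= exit_time w.
Proof. by apply: integral_ge0 => s _; rewrite lee_fin. Qed.

Let m1still : measurable_fun setT (fun z => (\1_still z)%:E : \bar R).
Proof. by apply/measurable_EFinP; exact: measurable_indic. Qed.

Lemma measurable_exit_time : measurable_fun setT exit_time.
Proof.
have := @measurable_fun_fubini_tonelli_F _ _ Om _ R leb _ m1still.
move=> /(_ (fun z => _)) h; apply: eq_measurable_fun (h _) => [w _|z].
  by rewrite exit_timeE.
by rewrite lee_fin.
Qed.

(** The region swept at time s has mass s whatever Y is, so the time is
    exponential of parameter one given Y. *)
Lemma expected_exit_time (phi : X -> \bar R) : measurable_fun setT phi ->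
  (forall x, 0 <= phi x) ->
  \int[Q]_w (exit_time w * phi (Y w)) = \int[Q]_w phi (Y w).
Proof.
move=> mphi phi0.
have mf : measurable_fun setT (fun z : Om * measurableTypeR R =>
    (\1_still z)%:E * phi (Y z.1)).
  apply: emeasurable_funM => //; apply: (measurableT_comp mphi).
  by apply: (measurableT_comp (vl_fun hN)).
have f0 (z : Om * measurableTypeR R) : 0 <= (\1_still z)%:E * phi (Y z.1).
  by rewrite mule_ge0// lee_fin.
transitivity (\int[Q]_w fubini_F leb (fun z : Om * measurableTypeR R =>
    (\1_still z)%:E * phi (Y z.1)) w).
  apply: eq_integral => w _; rewrite exit_timeE /fubini_F/= ge0_integralZr//.
  exact: (measurableT_comp m1still (measurable_pair1 _)).
transitivity (\int[leb]_s fubini_G Q (fun z : Om * measurableTypeR R =>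
    (\1_still z)%:E * phi (Y z.1)) s); first exact: fubini_tonelli.
rewrite /fubini_G/=.
transitivity (\int[leb]_(s in `[0%R, +oo[)
    (\int[Q]_w phi (Y w) * (expR (- (s / 1)))%:E)).
  rewrite [RHS]integral_mkcond; apply: eq_integral => s _; rewrite patchE.
  case: ifPn => [/set_mem|/negP ns]; last first.
    apply: integral0_eq => w _; rewrite indicE memNset ?mul0e// => -[/= s0 _].
    by apply: ns; apply/mem_set; rewrite /= in_itv/= s0.
  rewrite /= in_itv/= andbT => s0.
  pose A : set (X * E) := [set z | under (fun t => s * gam z.1 t)%R z.2].
  have mA : measurable A.
    apply: (@measurable_under_param _ T R _ X (fun z => s * gam z.1 z.2)%R).
    exact: measurable_funM.
  have massA x : m (xsection A x) = s%:E.
    rewrite xsectionE; transitivity (\int[mu]_z (s * gam x z)%:E).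
      apply: strip_mass_under; last by move=> z; rewrite mulr_ge0.
      exact: measurable_funM.
    under eq_integral do rewrite EFinM.
    rewrite ge0_integralZl//.
    - by rewrite gam1 mule1.
    - exact/measurable_EFinP.
    - by move=> z _; rewrite lee_fin.
  transitivity (\int[Q]_(w in [set w | N w `&` xsection A (Y w) = set0]) phi (Y w)).
    rewrite (_ : mkset _ = [set w | empty_until w s]); last first.
      by apply/seteqP; split => w /=; rewrite xsectionE.
    rewrite -[X in _ = integral _ X _](setTI [set w | empty_until w s]).
    rewrite -ge0_integral_indic; apply: eq_integral => w _.
    congr (_%:E * _); rewrite !indicE.
    by congr (_%:R); congr nat_of_bool; apply/idP/idP => /set_mem h;
      apply/mem_set; [case: h|split].
  have Afin x : m (xsection A x) < +oo by rewrite massA ltry.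
  rewrite (freezing hE Wfin hN fN mA Afin)//.
  transitivity (\int[Q]_w (phi (Y w) * expeR (- s%:E))).
    by apply: eq_integral => w _; congr (_ * expeR (- _)); exact: massA.
  rewrite ge0_integralZr//.
  - by rewrite divr1.
  - exact: measurableT_comp (vl_fun hN).
  - by move=> *; exact: expeR_ge0.
rewrite ge0_integralZl//.
- by rewrite integral_exp_density// mule1.
- apply: measurable_funTS; apply/measurable_EFinP; apply: measurableT_comp => //.
  by apply: measurable_funN; exact: mulrr_measurable.
- by apply: integral_ge0 => w _.
Qed.

End step.

(** * The state after one step *)

Lemma measure_eq_off_null d (T : measurableType d) (R : realType)
    (mu : {measure set T -> \bar R}) (A B G : set T) :
  measurable A -> measurable B -> measurable G -> mu (~` G) = 0 ->
  A `&` G = B `&` G -> mu A = mu B.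
Proof.
move=> mA mB mG G0 AB.
have key C : measurable C -> mu C = mu (C `&` G).
  move=> mC; rewrite (measureDI mu mC mG) [X in X + _](_ : _ = 0) ?add0e//.
  apply/eqP; rewrite eq_le measure_ge0 andbT -G0; apply: sub_le_measure.
  - exact: measurableD.
  - exact: measurableC.
  - by move=> x [].
by rewrite key// AB -key.
Qed.

Lemma measure_bigcup_null d (T : measurableType d) (R : realType)
    (mu : {measure set T -> \bar R}) (F : nat -> set T) :
  (forall k, measurable (F k)) -> (forall k, mu (F k) = 0) ->
  mu (\bigcup_k F k) = 0.
Proof.
move=> mF F0; apply/eqP; rewrite eq_le measure_ge0 andbT.
apply: le_trans (measure_sigma_subadditive mu mF _ _) _ => //.
- exact: bigcupT_measurable.
- by rewrite eseries0.
Qed.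

Section trim.
Context {dE : measure_display} {E : measurableType dE} {R : realType}.
Variables (U W : nat -> set E).
Hypothesis hE : ground_space U W.

(** Makes the configurations locally finite for all outcomes, at the cost of a
    change on a null event. *)
Definition trim (S : set E) : set E :=
  if `[< forall n, finite_set (S `&` W n) >] then S else set0.

Lemma trim_id S : (forall n, finite_set (S `&` W n)) -> trim S = S.
Proof. by rewrite /trim; case: asboolP. Qed.

Lemma trim_sub S : trim S `<=` S.
Proof. by rewrite /trim; case: asboolP => // _ p. Qed.

Lemma trim_finite S n : finite_set (trim S `&` W n).
Proof. by rewrite /trim; case: asboolP => // _; rewrite set0I. Qed.

Variable m : {sigma_finite_measure set E -> \bar R}.
Hypothesis m_diffuse : forall p, m [set p] = 0.
Hypothesis Wfin : forall n, m (W n) < +oo.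
Context d (Om : measurableType d) (Q : {finite_measure set Om -> \bar R}).
Context dX (X : measurableType dX) (Y : Om -> X) (N : Om -> set E).
Hypothesis hN : void_law m Q Y N.

Definition locally_finite : set Om :=
  [set w | forall n, finite_set (N w `&` W n)].

Let infinite_at n := [set w | (counting (N w `&` W n) : \bar R) = +oo].

Let mcount n : measurable_fun setT (fun w => counting (N w `&` W n) : \bar R).
Proof.
exact: (measurable_counting hE (vl_void hN) (gs_measurableW hE n)).
Qed.

Let minfinite n : measurable (infinite_at n).
Proof.
by have := mcount n measurableT (emeasurable_set1 +oo); rewrite setTI.
Qed.

Let locally_finiteE : locally_finite = ~` \bigcup_n infinite_at n.
Proof.
apply/seteqP; split => w.
  by move=> h [n _]; rewrite /infinite_at/= /counting asboolT.
move=> h n; apply: contrapT => hn; apply: h; exists n => //.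
by rewrite /infinite_at/= /counting asboolF.
Qed.

Lemma measurable_locally_finite : measurable locally_finite.
Proof.
rewrite locally_finiteE; apply: measurableC.
exact: bigcupT_measurable.
Qed.

(** The mean number of points in each set of the exhaustion is finite. *)
Lemma locally_finite_full : Q (~` locally_finite) = 0.
Proof.
rewrite locally_finiteE setCK.
have Q0 n : Q (infinite_at n) = 0.
  have := expected_count hE m_diffuse hN measurableT measurable0
    (gs_measurableW hE n).
  rewrite measure0 oppe0 expeR0 mule1 set0I void0 preimage_setT setIT.
  move=> /(_ (ltry _) (Wfin n) erefl) e.
  have iN : Q.-integrable setT (fun w => counting (N w `&` W n) : \bar R).
    apply/integrableP; split => //; under eq_integral do rewrite gee0_abs//.
    by rewrite e lte_mul_pinfty// ?fin_num_measure//; exact: Wfin.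
  have [N0 [mN0 N00 sub]] := integrable_ae measurableT iN.
  apply/eqP; rewrite eq_le measure_ge0 andbT -N00; apply: sub_le_measure => //.
  by move=> w hw; apply: sub => /= /(_ I); rewrite hw.
exact: measure_bigcup_null.
Qed.

Let void_trim A : void (trim \o N) A `&` locally_finite =
  void N A `&` locally_finite.
Proof.
by apply/seteqP; split => w [h hf]; split => //; move: h;
  rewrite /void/= trim_id.
Qed.

Let mvoid_trim A : measurable A -> measurable (void (trim \o N) A).
Proof.
move=> mA; rewrite (_ : void _ A = ~` locally_finite `|`
    (void N A `&` locally_finite)).
  apply: measurableU; first by apply: measurableC; exact: measurable_locally_finite.
  apply: measurableI; last exact: measurable_locally_finite.
  exact: (vl_void hN).
rewrite -void_trim; apply/seteqP; split => w.
  by move=> h; have [hf|hf] := pselect (locally_finite w); [right|left].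
case=> [hf|[]//]; rewrite /void/= /trim; case: asboolP => // _.
by rewrite set0I.
Qed.

Lemma random_points_trim : random_points W (trim \o N).
Proof. by split=> [|w n]; [exact: mvoid_trim|exact: trim_finite]. Qed.

Lemma void_law_trim : void_law m Q Y (trim \o N).
Proof.
split; [exact: mvoid_trim|exact: (vl_fun hN)|].
move=> C A mC mA Aoo; rewrite -(vl_law hN mC mA Aoo).
have mYC : measurable (Y @^-1` C).
  by rewrite -[X in measurable X]setTI; exact: (vl_fun hN).
apply: (measure_eq_off_null _ _ measurable_locally_finite locally_finite_full).
- by apply: measurableI => //; exact: mvoid_trim.
- by apply: measurableI => //; exact: (vl_void hN).
- by rewrite -!setIA void_trim.
Qed.

End trim.

Section next_state.
Context {dT : measure_display} {T : measurableType dT} {R : realType}.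
Local Notation E := (T * measurableTypeR R)%type.
Variables (TW : nat -> set T) (p0 : E).

Implicit Types (h : T -> R) (S : set E) (p q : E).

(** The default value occurs only when no point can be selected. *)
Definition selected (h : T -> R) (S : set E) : E := xget p0 (sel h S).

Definition selectable (h : T -> R) (S : set E) : Prop := exists p, sel h S p.

Definition raw_next (h : T -> R) (S : set E) : set E :=
  if `[< selectable h S >] then residual h S (selected h S) else set0.

Definition next_position (h : T -> R) (S : set E) : T :=
  if `[< selectable h S >] then (selected h S).1 else p0.1.

Definition next_points (h : T -> R) (S : set E) : set E :=
  trim (stripW TW) (raw_next h S).

Lemma selectedP h S p : sel h S p -> selected h S = p.
Proof.
move=> hp; rewrite /selected; case: xgetP => [q _ hq|/(_ p)//].
exact: sel_unique hq hp.
Qed.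

Lemma raw_nextP h S p : sel h S p -> raw_next h S = residual h S p.
Proof.
by move=> hp; rewrite /raw_next asboolT ?(selectedP hp)//; exists p.
Qed.

Lemma next_positionP h S p : sel h S p -> next_position h S = p.1.
Proof.
by move=> hp; rewrite /next_position asboolT ?(selectedP hp)//; exists p.
Qed.

Lemma residual_pos h S p q : residual h S p q -> (0 < q.2)%R.
Proof. by move=> [q0 [_ h0 ->]]; rewrite /= subr_gt0. Qed.

Lemma next_points_pos h S q : next_points h S q -> (0 < q.2)%R.
Proof.
move=> /trim_sub; rewrite /raw_next; case: asboolP => // _.
exact: residual_pos.
Qed.

Variables (TU : nat -> set T).
Hypothesis hT : ground_space TU TW.
Variable mu : {sigma_finite_measure set T -> \bar R}.
Hypothesis TWfin : forall n, mu (TW n) < +oo.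
Local Notation m := (strip_measure mu).
Context d (Om : measurableType d) (Q : {finite_measure set Om -> \bar R}).
Context dX (X : measurableType dX) (Y : Om -> X) (N : Om -> set E).
Hypothesis hN : void_law m Q Y N.
Hypothesis fN : random_points (stripW TW) N.
Hypothesis posN : forall w p, N w p -> (0 < p.2)%R.
Variable gam : X -> T -> R.
Hypothesis mgam : measurable_fun setT (fun p : X * T => gam p.1 p.2).
Hypothesis gam0 : forall x z, (0 <= gam x z)%R.
Hypothesis gam1 : forall x, \int[mu]_z (gam x z)%:E = 1.

Let good : set Om := [set w | selectable (gam (Y w)) (N w)].

Let goodE : good = event Y N gam setT set0.
Proof.
apply/seteqP; split => w [p hp]; last by case: hp => hp _ _; exists p.
by exists p; split => //; rewrite setI0.
Qed.

Let mev B A : measurable B -> measurable A -> measurable (event Y N gam B A).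
Proof. exact: (measurable_event hT hN fN posN mgam gam0). Qed.

Let pev B A : measurable B -> measurable A -> m A < +oo ->
  Q (event Y N gam B A) =
  \int[Q]_w (\int[mu]_(z in B) (gam (Y w) z)%:E * expeR (- m A)).
Proof. exact: (prob_event hT TWfin hN fN posN mgam gam0 gam1). Qed.

Let mgood : measurable good.
Proof. by rewrite goodE; exact: mev. Qed.

Let good_full : Q (~` good) = 0.
Proof.
have Qg : Q good = Q setT.
  rewrite goodE pev// ?measure0//.
  transitivity (\int[Q]_w (cst 1 w)); last by rewrite integral_cst// mul1e.
  by apply: eq_integral => w _; rewrite gam1 oppe0 expeR0 mule1.
rewrite -setTD measureD// ?setTI//; last by rewrite -ge0_fin_numE// fin_num_measure.
by rewrite -[LHS]/(Q setT - Q good) Qg subee// fin_num_measure.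
Qed.

Definition next_Y (w : Om) : T := next_position (gam (Y w)) (N w).
Definition next_N (w : Om) : set E := next_points (gam (Y w)) (N w).
Let N1 (w : Om) : set E := raw_next (gam (Y w)) (N w).

Let next_event C A : (next_Y @^-1` C `&` void N1 A) `&` good =
  event Y N gam C A `&` good.
Proof.
apply/seteqP; split => w [h [p hp]]; split; try by exists p.
  case: h; rewrite /void/= /next_Y /N1 (next_positionP hp) (raw_nextP hp) => h1 h2.
  by exists p.
have [q [hq Cq hA]] := h.
by split; rewrite /void/= /next_Y /N1 ?(next_positionP hq) ?(raw_nextP hq).
Qed.

Let mvoidN1 A : measurable A -> measurable (void N1 A).
Proof.
move=> mA; rewrite (_ : void N1 A = ~` good `|` event Y N gam setT A).
  by apply: measurableU; [exact: measurableC|exact: mev].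
apply/seteqP; split => w.
  move=> h; have [hw|] := pselect (good w); last by left.
  right; suff [] : (event Y N gam setT A `&` good) w by [].
  by rewrite -next_event; split => //; split.
move=> [hw|[p [hp _ hA]]]; rewrite /void/= /N1.
  by rewrite /raw_next asboolF// set0I.
by rewrite (raw_nextP hp).
Qed.

Lemma measurable_next_Y : measurable_fun setT next_Y.
Proof.
move=> _ B mB; rewrite setTI.
rewrite (_ : _ @^-1` _ = (event Y N gam B set0) `|`
   (if `[< B p0.1 >] then ~` good else set0)).
  apply: measurableU; first exact: mev.
  by case: asboolP => // _; exact: measurableC.
apply/seteqP; split => w.
  move=> h; have [hw|hw] := pselect (good w).
    left; suff [] : (event Y N gam B set0 `&` good) w by [].
    by rewrite -next_event; split => //; split => //; rewrite /void/= setI0.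
  by right; move: h; rewrite /next_Y /= /next_position asboolF// => h; rewrite asboolT.
case=> [[p [hp Bp _]]|]; first by rewrite /next_Y /= (next_positionP hp).
by case: asboolP => // hB hw; rewrite /next_Y /= /next_position asboolF.
Qed.

Let mnextC C : measurable C -> measurable (next_Y @^-1` C).
Proof.
by move=> mC; rewrite -[X in measurable X]setTI; exact: measurable_next_Y.
Qed.

(** Case of [prob_event] without condition on the residual configuration. *)
Lemma law_next_Y B : measurable B ->
  Q (next_Y @^-1` B) = \int[Q]_w (\int[mu]_(z in B) (gam (Y w) z)%:E).
Proof.
move=> mB; transitivity (Q (event Y N gam B set0)).
  apply: (measure_eq_off_null _ _ mgood good_full).
  - exact: mnextC.
  - exact: mev.
  - rewrite -next_event; congr (_ `&` _).
    by apply/seteqP; split => [w h|w []]//; split => //; rewrite /void/= setI0.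
rewrite pev// ?measure0//; apply: eq_integral => w _.
by rewrite oppe0 expeR0 mule1.
Qed.

Let lawN1 : void_law m Q next_Y N1.
Proof.
split; [exact: mvoidN1|exact: measurable_next_Y|].
move=> C A mC mA Aoo; rewrite law_next_Y//.
transitivity (Q (event Y N gam C A)).
  apply: (measure_eq_off_null _ _ mgood good_full (next_event C A)).
  - by apply: measurableI; [exact: mnextC|exact: mvoidN1].
  - exact: mev.
rewrite pev// ge0_integralZr//.
- apply: (measurableT_comp (f := fun y => \int[mu]_(z in C) (gam y z)%:E) (g := Y)).
    exact: (measurable_density_mass mu mgam gam0 mC).
  exact: (vl_fun hN).
- by move=> w _; apply: integral_ge0 => z _; rewrite lee_fin.
- exact: expeR_ge0.
Qed.

Let hE : ground_space (stripU TU) (@stripW _ _ R TW) := ground_space_strip hT.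
Let Wfin : forall n, m (stripW TW n) < +oo := stripW_fin hT TWfin.

(** The invariant is preserved: the new configuration is again Poisson with
    intensity m, and independent of the new position. *)
Lemma void_law_next : void_law m Q next_Y next_N.
Proof. exact: (void_law_trim hE (strip_diffuse mu) Wfin lawN1). Qed.

Lemma random_points_next : random_points (stripW TW) next_N.
Proof. exact: (random_points_trim hE lawN1). Qed.

Definition regular : set Om := [set w | selectable (gam (Y w)) (N w) /\
  forall n, finite_set (raw_next (gam (Y w)) (N w) `&` stripW TW n)].

Lemma measurable_regular : measurable regular.
Proof.
apply: measurableI; first exact: mgood.
exact: (measurable_locally_finite hE lawN1).
Qed.

Lemma regular_full : Q (~` regular) = 0.
Proof.
have -> : ~` regular = ~` good `|` ~` (locally_finite (stripW TW) N1).
  by rewrite -setCI.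
rewrite null_set_setU//.
- exact: measurableC.
- by apply: measurableC; exact: (measurable_locally_finite hE lawN1).
- exact: (locally_finite_full hE (strip_diffuse mu) Wfin lawN1).
Qed.

End next_state.

(** * The construction as an iteration of steps *)

Section pathwise.
Context {dT : measure_display} {T : measurableType dT} {R : realType}.
Local Notation E := (T * measurableTypeR R)%type.
Variables (TW : nat -> set T) (p0 : E) (g0 : T -> R) (g : T -> T -> R).

(** The density that governs step k; at step 0 the position is a dummy. *)
Definition jump_density (k : nat) (y : T) : T -> R := if k is 0%N then g0 else g y.

(** Position and remaining configuration after k steps. The heights of the
    remaining points are measured from the current graph, so that all steps
    have the same form. *)
Fixpoint exploration (S : set E) (k : nat) : T * set E :=
  if k is j.+1 then
    let: (y, S') := exploration S j in
    (next_position p0 (jump_density j y) S', next_points TW p0 (jump_density j y) S')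
  else (p0.1, S).

Definition position S k := (exploration S k).1.
Definition remaining S k := (exploration S k).2.

Lemma positionS S k : position S k.+1 =
  next_position p0 (jump_density k (position S k)) (remaining S k).
Proof. by rewrite /position /remaining/=; case: (exploration S k). Qed.

Lemma remainingS S k : remaining S k.+1 =
  next_points TW p0 (jump_density k (position S k)) (remaining S k).
Proof. by rewrite /position /remaining/=; case: (exploration S k). Qed.

(** The default values of the step are not used. *)
Definition regular_step (S : set E) (k : nat) : Prop :=
  let h := jump_density k (position S k) in
  selectable h (remaining S k) /\
  forall n, finite_set (raw_next p0 h (remaining S k) `&` stripW TW n).

Definition waiting (S : set E) (k : nat) : R :=
  let h := jump_density k (position S k) in
  rise h (selected p0 h (remaining S k)).

Hypothesis g0_ge0 : forall z, (0 <= g0 z)%R.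
Hypothesis g_ge0 : forall y z, (0 <= g y z)%R.

Let jump_ge0 k y z : (0 <= jump_density k y z)%R.
Proof. by case: k. Qed.

Variable pts : set (T * R).
Hypothesis pts_pos : forall p, pts p -> (0 < p.2)%R.
Hypothesis reg : forall k, regular_step pts k.

Local Notation pos := (position pts).
Local Notation rem := (remaining pts).
Local Notation slt n := (slt_state g0 g pts p0 n).

(** The graph of the soft local time has passed the selected points and no
    other one; seen from this graph, the others are the points that remain in
    the exploration. *)
Let invariant n : Prop := [/\
  slt_position (slt n).1 = (if n is 0%N then None else Some (pos n)),
  (forall q, pts q -> q \notin (slt n).1 -> ((slt n).2 q.1 < q.2)%R) &
  rem n = [set q' | exists q, [/\ pts q, q \notin (slt n).1 &
     q' = (q.1, q.2 - (slt n).2 q.1)%R]]].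

Let densityE n : invariant n ->
  density_from g0 g (slt_position (slt n).1) = jump_density n (pos n).
Proof. by case: n => [|n] [-> _ _]. Qed.

Let xi n : R := slt_xi g0 g pts (slt n).1 (slt n).2.

(** The point selected by the step corresponds to the point picked by the
    construction, whose threshold set is the half-line that starts at the rise
    of this point. *)
Let step n : invariant n -> [/\ invariant n.+1, xi n = waiting pts n &
  forall z, (slt n.+1).2 z =
     ((slt n).2 z + waiting pts n * jump_density n (pos n) z)%R].
Proof.
move=> inv; have dE := densityE inv; have [_ above remE] := inv.
set h := jump_density n (pos n) in dE *.
have h0 z : (0 <= h z)%R by exact: jump_ge0.
have [[p hp] fin] := reg n; rewrite -/h in hp fin.
have wE : waiting pts n = rise h p by rewrite /waiting -/h (selectedP p0 hp).
set r := rise h p in wE.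
have rp : (r * h p.1)%R = p.2 by exact: rise_sel hp.
have [Rp hp0 hpq] := hp.
have posR q' : rem n q' -> (0 < q'.2)%R.
  by rewrite remE => -[q [pq nq ->]]; rewrite /= subr_gt0; exact: above.
have r0 : (0 <= r)%R by rewrite divr_ge0// ltW// posR.
move: (Rp); rewrite remE => -[ph [pph nph pE]].
have inR q : pts q -> q \notin (slt n).1 -> rem n (q.1, q.2 - (slt n).2 q.1)%R.
  by move=> pq nq; rewrite remE; exists q.
(* Distinct points stay distinct when heights are measured from the graph. *)
have uniq q : pts q -> q \notin (slt n).1 ->
    (q.1, q.2 - (slt n).2 q.1)%R = p -> q = ph.
  move=> pq nq; rewrite pE => -[e1 e2]; move: e1 e2.
  by case: q {pq nq} => q1 q2; case: (ph) => ph1 ph2 /= <- /addIr ->.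
have xiE : xi n = r.
  rewrite /xi /slt_xi dE.
  rewrite (_ : [set t | _] = `[r, +oo[%classic); first exact: inf_itv.
  apply/seteqP; split => t /=; rewrite in_itv/= andbT.
    move=> [t0 [q [pq nq hq]]].
    have [qp|qp] := pselect ((q.1, q.2 - (slt n).2 q.1)%R = p).
      have [e1 e2] : q.1 = p.1 /\ (q.2 - (slt n).2 q.1)%R = p.2 by rewrite -qp.
      by rewrite -(ler_pM2r hp0) rp -e2 -e1 lerBlDl.
    have /= := hpq _ (inR q pq nq) qp; rewrite -/r => h1.
    rewrite leNgt; apply/negP => tr.
    have := lt_le_trans h1 (_ : q.2 - (slt n).2 q.1 <= t * h q.1)%R.
    rewrite lerBlDl => /(_ hq); rewrite ltNge => /negP; apply.
    by rewrite ler_wpM2r// ltW.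
  move=> rt; split; first exact: le_trans rt.
  exists ph; split => //.
  have : (p.2 <= t * h p.1)%R by rewrite -rp ler_wpM2r.
  by rewrite pE/= lerBlDl.
pose sel_set := [set q : T * R | [/\ pts q, q \notin (slt n).1 &
  ((slt n).2 q.1 + r * h q.1)%R = q.2]].
have sltS : slt n.+1 = (xget p0 sel_set :: (slt n).1,
    fun z => (slt n).2 z + r * h z)%R.
  rewrite /slt_state iterS -/(slt_state g0 g pts p0 n) /slt_step.
  have := xiE; rewrite /xi; move: dE; rewrite /sel_set.
  by case: (slt n) => used G /= -> ->.
have selE : xget p0 sel_set = ph.
  have hph : sel_set ph.
    by split => //; move: rp; rewrite pE /= => ->; rewrite addrC subrK.
  case: xgetP => [q _ [pq nq hq]|/(_ ph)//].
  apply: uniq => //; apply: contrapT => qp.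
  have := hpq _ (inR q pq nq) qp; rewrite /= -/r -hq.
  by rewrite addrAC subrr add0r ltxx.
split.
- split.
  + rewrite sltS selE positionS -/h (next_positionP p0 hp) pE//.
  + move=> q pq; rewrite sltS selE /= in_cons negb_or => /andP[/eqP qph nq].
    have qp : (q.1, q.2 - (slt n).2 q.1)%R <> p by move=> /(uniq q pq nq).
    by have := hpq _ (inR q pq nq) qp; rewrite /= -/r ltrBrDl.
  + rewrite remainingS -/h /next_points trim_id; last exact: fin.
    rewrite (raw_nextP p0 hp) sltS selE /=; apply/seteqP; split => q'.
      move=> [q0 [Rq0 hq0 ->]]; move: Rq0 hq0; rewrite remE => -[q [pq nq ->]] /= hq.
      exists q; split => //; last by rewrite opprD addrA.
      rewrite in_cons negb_or nq andbT; apply/eqP => qph; move: hq.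
      by rewrite qph -/r; move: rp; rewrite pE /= => ->; rewrite ltxx.
    move=> [q [pq]]; rewrite in_cons negb_or => /andP[/eqP qph nq] ->.
    have qp : (q.1, q.2 - (slt n).2 q.1)%R <> p by move=> /(uniq q pq nq).
    exists (q.1, q.2 - (slt n).2 q.1)%R; split => /=.
    * exact: inR.
    * exact: hpq (inR q pq nq) qp.
    * by rewrite opprD addrA.
- by rewrite xiE wE.
- by move=> z; rewrite sltS wE.
Qed.

Let invariant_all n : invariant n.
Proof.
elim: n => [|n IH]; last by have [] := step IH.
split => //; first by move=> q pq _; exact: pts_pos.
apply/seteqP; split => [q pq|_ [q [pq _ ->]]]; rewrite /= ?subr0.
  by exists q; split => //; rewrite subr0; case: q {pq}.
by move: pq; case: q.
Qed.

Lemma slt_chain_position n : slt_chain g0 g pts p0 n.+1 = Some (pos n.+1).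
Proof. by have [h _ _] := invariant_all n.+1; rewrite /slt_chain h. Qed.

Lemma soft_local_time_sum n z : soft_local_time g0 g pts p0 n z =
  (\sum_(k < n) waiting pts k * jump_density k (pos k) z)%R.
Proof.
elim: n => [|n IH]; first by rewrite big_ord0.
rewrite big_ord_recr/= -IH; have [_ _] := step (invariant_all n).
by move/(_ z).
Qed.

(** Selected points lie where the density is positive; used to see that D is
    absorbing. *)
Lemma position_density n : (0 < jump_density n (pos n) (pos n.+1))%R.
Proof.
have [[p hp] _] := reg n; rewrite positionS (next_positionP p0 hp).
by have [] := hp.
Qed.

End pathwise.

(** * Locally compact separable spaces *)

Section borel_space.
Context {R : realType} (S : completeMetricType R).
Hypothesis hsep : separable S.

Lemma ball_borel (x : S) (r : R) : measurable (ball x r : set (borel S)).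
Proof.
apply: sub_sigma_algebra; rewrite openE => y; rewrite ballEmdist/= => xy.
apply/nbhs_ballP; exists (r - mdist x y)%R => /=; first by rewrite subr_gt0.
move=> z; rewrite !ballEmdist/= ltrBrDl.
by apply: le_lt_trans; exact: metric_triangle.
Qed.

Lemma separable_seq : exists e : nat -> S, forall (x : S) (r : R), (0 < r)%R ->
  exists n, ball x r (e n).
Proof.
have [A cA dA] := hsep.
have [f injf] := elimT (countable_injP A) cA.
exists (fun n => xget point [set x | A x /\ f x = n]) => x r r0.
have [y [xy Ay]] : ball x r `&` A !=set0.
  have [|y [hy Ay]] := dA (interior (ball x r)) _ (open_interior _).
    by exists x; exact: nbhsx_ballx.
  by exists y; split => //; exact: interior_subset.
exists (f y); case: xgetP => [z _ [Az fz]|/(_ y) h]; last by exfalso; exact: h.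
by rewrite (injf z y)//; exact: mem_set.
Qed.

Definition small_ball (e : nat -> S) (i : nat) : set (borel S) :=
  if choice.unpickle i is Some (n, k) then ball (e n) k.+1%:R^-1 else set0.

Variable mu : {measure set (borel S) -> \bar R}.
Hypothesis hmu : radon_measure mu.
Hypothesis hlc : locally_compact [set: S].

(** Local compactness makes small balls of finite mass around each point
    available, so the other ones can be discarded. *)
Definition finite_ball (e : nat -> S) (i : nat) : set (borel S) :=
  if `[< mu (small_ball e i) < +oo >] then small_ball e i else set0.

Definition finite_balls (e : nat -> S) (n : nat) : set (borel S) :=
  \big[setU/set0]_(i < n) finite_ball e i.

Let measurable_small_ball e i : measurable (small_ball e i).
Proof.
by rewrite /small_ball; case: choice.unpickle => [[n k]|//]; exact: ball_borel.
Qed.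

Let measurable_finite_ball e i : measurable (finite_ball e i).
Proof. by rewrite /finite_ball; case: asboolP. Qed.

Let small_ball_around e : (forall (x : S) (r : R), (0 < r)%R ->
    exists n, ball x r (e n)) -> forall (x : S) (r : R), (0 < r)%R ->
  exists i, small_ball e i x /\ small_ball e i `<=` ball x r.
Proof.
move=> he x r r0.
(* A ball of radius less than r / 2 that contains x lies in ball x r. *)
pose k := Num.truncn (2 / r)%R.
have kr : (k.+1%:R^-1 < r / 2)%R.
  by rewrite -[X in (_ < X)%R]invf_div ltf_pV2 ?posrE ?divr_gt0// truncnS_gt.
have k0 : (0 < k.+1%:R^-1 :> R)%R by rewrite invr_gt0.
have [n hn] := he x _ k0.
exists (choice.pickle (n, k)); rewrite /small_ball choice.pickleK; split.
  exact: ball_sym.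
move=> y hy; apply: (@le_ball _ _ _ (k.+1%:R^-1 + k.+1%:R^-1)%R).
  by rewrite [X in (_ <= X)%R]splitr lerD// ltW.
exact: ball_triangle hn hy.
Qed.

(** Small balls around a dense sequence separate points. Those of finite mass
    still cover the space, because each point has a compact neighbourhood and mu
    is finite on compact sets. *)
Lemma borel_ground_space : exists TU TW : nat -> set (borel S),
  ground_space TU TW /\ forall n, mu (TW n) < +oo.
Proof.
have [e he] := separable_seq.
exists (small_ball e), (finite_balls e); split; [split|].
- exact: measurable_small_ball.
- move=> p q pq; apply: contrapT => npq.
  have d0 : (0 < mdist p q)%R by rewrite mdist_gt0; apply/eqP.
  have [i [ip ib]] := small_ball_around he p d0.
  by have := ib _ ((pq i).1 ip); rewrite ballEmdist/= ltxx.
- move=> n; apply: bigsetU_measurable => i _; exact: measurable_finite_ball.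
- by move=> i j ij; apply/subsetPset; exact: subset_bigsetU.
- apply/seteqP; split => // x _.
  have [K nK [cK clK]] := hlc I : compact_near (within setT (nbhs x)).
  have {}nK : nbhs x K by move: nK; rewrite /within/=; apply: filterS => y; apply.
  have /nbhs_ballP[r /= r0 rK] := nK.
  have [i [ix ir]] := small_ball_around he x r0.
  exists i.+1 => //; rewrite /finite_balls big_ord_recr/=; right.
  rewrite /finite_ball asboolT//; apply: le_lt_trans (hmu.1 K cK).
  apply: sub_le_measure => //; last exact: subset_trans rK.
  rewrite -(setCK K); apply: measurableC; apply: sub_sigma_algebra.
  by rewrite openC.
- move=> n; rewrite /finite_balls.
  apply: le_lt_trans (Boole_inequality mu _) _.
    by move=> i _; exact: measurable_finite_ball.
  apply: lte_sum_pinfty => i _; rewrite /finite_ball; case: asboolP => //.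
  by rewrite measure0.
Qed.

End borel_space.

(** * Densities, and integrals off null sets *)

Section sigma_finite_packing.
Context d (T : measurableType d) (R : realType).

(** The proof is an argument only so that sigma-finiteness can be inferred. *)
Definition exhausted_measure (mu : {measure set T -> \bar R})
  (_ : sigma_finite setT mu) : set T -> \bar R := mu.

Variables (mu : {measure set T -> \bar R}) (h : sigma_finite setT mu).

HB.instance Definition _ := Measure.copy (exhausted_measure h) mu.
HB.instance Definition _ := Measure_isSigmaFinite.Build _ _ _
  (exhausted_measure h) h.

End sigma_finite_packing.

Section off_null.
Context d (T : measurableType d) (R : realType).
Variable mu : {measure set T -> \bar R}.
Import HBNNSimple.

(** Integrals of arbitrary non-negative functions are lower integrals, so they
    do not see what happens inside a measurable null set, even when the
    functions are not measurable there. *)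
Lemma ge0_integral_off_null (G : set T) (f f' : T -> \bar R) :
  measurable G -> mu (~` G) = 0 -> (forall x, 0 <= f x) ->
  (forall x, 0 <= f' x) -> measurable_fun setT f' ->
  (forall x, G x -> f x = f' x) -> \int[mu]_x f x = \int[mu]_x f' x.
Proof.
move=> mG G0 f0 f'0 mf' ff'.
have restrict_G h : measurable_fun setT h -> (forall x, 0 <= h x) ->
    \int[mu]_x h x = \int[mu]_(x in G) h x.
  move=> mh h0; rewrite (@ge0_negligible_integral _ _ _ mu setT (~` G))//.
    by rewrite setTD setCK.
  exact: measurableC.
apply/eqP; rewrite eq_le; apply/andP; split.
  rewrite (ge0_integralTE _ f0); apply: ge_ereal_sup => _ [h /= hf <-].
  rewrite -integralT_nnsfun restrict_G//; last first.
  - by move=> x; rewrite lee_fin.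
  - exact/measurable_EFinP.
  rewrite [leRHS]restrict_G//; apply: ge0_le_integral => //.
  - by move=> x _; rewrite lee_fin.
  - by apply: measurable_funTS; exact/measurable_EFinP.
  - exact: measurable_funTS.
  - by move=> x Gx; rewrite -ff'//; exact: hf.
rewrite restrict_G// integral_mkcond ge0_integralTE; last first.
  by move=> x; rewrite patchE; case: ifP.
rewrite ge0_integralTE//; apply: le_ereal_sup => _ [h /= hf <-].
exists h => // x; apply: le_trans (hf x) _; rewrite patchE.
by case: ifPn => // /set_mem Gx; rewrite ff'.
Qed.

End off_null.

Section density.
Context d (T : measurableType d) (R : realType).
Local Notation leb := (@lebesgue_measure R).
Variables (nu mu : {sigma_finite_measure set T -> \bar R}) (u : T -> \bar R).
Hypothesis mu_ : measurable_fun setT u.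
Hypothesis u0 : forall x, 0 <= u x.
Hypothesis nuE : forall A, measurable A -> nu A = \int[mu]_(x in A) u x.

Let layer (y : \bar R) : 0 <= y ->
  \int[leb]_t (\1_[set t : R | (0 <= t)%R /\ (t%:E < y)%E] t)%:E = y.
Proof.
move=> y0.
have mI (i : interval R) : measurable ([set` i] : set (measurableTypeR R)).
  exact: measurable_itv.
case: y y0 => [y| |]// y0; last first.
  rewrite (_ : mkset _ = `[0%R, +oo[%classic).
    transitivity (leb (`[0%R, +oo[%classic : set R)).
      by rewrite integral_indic// setIT.
    by rewrite lebesgue_measure_itv/= ltry.
  apply/seteqP; split => t /=; rewrite in_itv/= andbT; first by move=> [].
  by move=> t0; split => //; exact: ltry.
rewrite (_ : mkset _ = `[0%R, y[%classic).
  transitivity (leb (`[0%R, y[%classic : set R)).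
    by rewrite integral_indic// setIT.
  rewrite lebesgue_measure_itv/= lte_fin -EFinB subr0.
  by move: y0; rewrite lee_fin le_eqVlt => /orP[/eqP <-|->]//; rewrite ltxx.
apply/seteqP; split => t /=; rewrite in_itv/= lte_fin.
  by move=> [-> ->].
by move=> /andP[].
Qed.

(** Both sides are computed by slicing f into the sets where it exceeds t. *)
Lemma ge0_integral_density (f : T -> \bar R) : measurable_fun setT f ->
  (forall x, 0 <= f x) -> \int[nu]_x f x = \int[mu]_x (f x * u x).
Proof.
move=> mf f0.
pose G : set (T * measurableTypeR R) :=
  [set z : T * R | (0 <= z.2)%R /\ (z.2%:E < f z.1)%E].
have mG : measurable G.
  apply: measurableI; first exact: measurable_upper.
  rewrite -[X in measurable X]setTI; apply: measurable_lte => //.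
    by apply/measurable_EFinP; exact: (measurableT_comp (f := snd)).
  exact: (measurableT_comp mf).
have m1 : measurable_fun setT (fun z => (\1_G z)%:E : \bar R).
  by apply/measurable_EFinP; exact: measurable_indic.
have g0 z : 0 <= (\1_G z)%:E :> \bar R by rewrite lee_fin.
transitivity (\int[nu]_x fubini_F leb (fun z => (\1_G z)%:E) x).
  by apply: eq_integral => x _; rewrite /fubini_F -[LHS]layer.
transitivity (\int[leb]_t fubini_G nu (fun z => (\1_G z)%:E) t).
  exact: fubini_tonelli.
have mGt t : measurable [set x | G (x, t)].
  by have := measurable_ysection t mG; rewrite ysectionE.
transitivity (\int[leb]_t fubini_G mu (fun z => (\1_G z)%:E * u z.1) t).
  apply: eq_integral => t _; rewrite /fubini_G/=.
  transitivity (nu [set x | G (x, t)]).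
    by rewrite -[in RHS](setIT [set x | G (x, t)]) -integral_indic.
  rewrite nuE// -[X in integral _ X _ = _](setTI [set x | G (x, t)]).
  by rewrite -ge0_integral_indic.
transitivity (\int[mu]_x fubini_F leb (fun z => (\1_G z)%:E * u z.1) x).
  apply/esym; apply: fubini_tonelli.
    apply: emeasurable_funM => //.
    exact: (measurableT_comp mu_).
  by move=> z; rewrite mule_ge0.
apply: eq_integral => x _; rewrite /fubini_F/= ge0_integralZr//.
  by congr (_ * _); rewrite -[RHS]layer.
exact: (measurableT_comp m1 (measurable_pair1 _)).
Qed.

End density.

(** * The Poisson process as initial state *)

Section initial_points.
Context {dT : measure_display} {T : measurableType dT} {R : realType}.
Local Notation E := (T * measurableTypeR R)%type.
Variables (TU TW : nat -> set T).
Hypothesis hT : ground_space TU TW.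
Variable mu : {sigma_finite_measure set T -> \bar R}.
Hypothesis TWfin : forall n, mu (TW n) < +oo.
Local Notation m := (strip_measure mu).
Context d (Om : measurableType d) (Q : probability Om R).
Variables (Lam : Om -> set nat) (pt : nat -> Om -> T * R).
Hypothesis heta : poisson_point_process Q (slt_intensity mu) Lam pt.
Variable D : T.

Lemma point_measure_eq0 w (A : set (T * R)) :
  point_measure R Lam pt w A = 0 <-> point_set Lam pt w `&` A = set0.
Proof.
rewrite /point_measure; split => [h|h].
  apply/seteqP; split => // _ [[i Li <-] Ai].
  have : (1 : \bar R) <= \esum_(i in Lam w) \d_(pt i w) A.
    apply: esum_ge; exists [set i].
      by split; [exact: finite_set1|move=> j ->].
    by rewrite fsbig_set1 diracE mem_set.
  by rewrite h lee_fin ler10.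
apply: esum1 => i Li; rewrite diracE memNset// => Ai.
suff : (set0 : set (T * R)) (pt i w) by [].
by rewrite -h; split => //; exists i.
Qed.

Lemma poisson_prob0 (r : R) : (0 <= r)%R ->
  poisson_prob r 0%N [set 0%N] = (expR (- r))%:E.
Proof.
move=> r0; rewrite /poisson_prob; case: ifPn => [rp|].
  rewrite esum_set1 ?lee_fin ?poisson_pmf_ge0//.
  by rewrite /poisson_pmf rp expr0 fact0 invr1 !mul1r.
rewrite -leNgt => rn; have -> : r = 0%R by apply/eqP; rewrite eq_le rn.
by rewrite oppr0 expR0 diracE mem_set.
Qed.

(** Almost surely no point is discarded, because height zero is null. *)
Definition upper_points (w : Om) : set E :=
  point_set Lam pt w `&` [set p | (0 < p.2)%R].

Let measurable_pos : measurable [set p : E | (0 < p.2)%R].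
Proof.
rewrite (_ : mkset _ = setT `*` `]0%R, +oo[%classic).
  by apply: measurableX => //; exact: measurable_itv.
by apply/seteqP; split => -[z v]/=; rewrite in_itv/= andbT; tauto.
Qed.

Let void_points (A : set E) :
  void (point_set Lam pt) A = [set w | point_measure R Lam pt w A = 0].
Proof. by apply/seteqP; split => w /point_measure_eq0. Qed.

Let measurable_void_points (A : set E) : measurable A ->
  measurable (void (point_set Lam pt) A).
Proof.
move=> mA; rewrite void_points.
by have := ppp_measurable heta mA measurableT (emeasurable_set1 0); rewrite setTI.
Qed.

Let prob_void_points (A : set E) : measurable A -> m A < +oo ->
  Q (void (point_set Lam pt) A) = expeR (- m A).
Proof.
move=> mA Aoo; rewrite void_points.
have -> := ppp_law heta mA Aoo 0.
rewrite poisson_prob0; last by apply: fine_ge0; exact: (measure_ge0 m).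
have : m A \is a fin_num by rewrite ge0_fin_numE.
rewrite -[slt_intensity mu A]/(m A).
by case: (m A).
Qed.

Let void_upper (A : set E) : void upper_points A =
  void (point_set Lam pt) (A `&` [set p | (0 < p.2)%R]).
Proof.
by apply/seteqP; split => w; rewrite /void/= /upper_points => <-;
  rewrite -setIA; congr (_ `&` _); rewrite setIC.
Qed.

Let mass_upper (A : set E) : measurable A ->
  m (A `&` [set p | (0 < p.2)%R]) = m A.
Proof.
move=> mA; rewrite -[RHS](@strip_mass_lift _ _ _ mu (fun=> 0%R))//.
by congr (m _); apply/seteqP; split => -[z v] /=; rewrite /lift/= subr0; tauto.
Qed.

(** The void probability of a Poisson process is the value at 0 of the Poisson
    law. The constant position is a dummy for the first step. *)
Lemma void_law_initial : void_law m Q (fun _ => D) upper_points.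
Proof.
split.
- move=> A mA; rewrite void_upper; apply: measurable_void_points.
  exact: measurableI.
- exact: measurable_cst.
- move=> C A mC mA Aoo; rewrite void_upper.
  have [hC|hC] := pselect (C D).
    rewrite (_ : (fun _ => D) @^-1` C = setT); last by apply/seteqP; split.
    rewrite setTI probability_setT mul1e prob_void_points ?mass_upper//.
    exact: measurableI.
  rewrite (_ : (fun _ => D) @^-1` C = set0); last by apply/seteqP; split.
  by rewrite set0I measure0 mul0e.
Qed.

Let hE : ground_space (stripU TU) (@stripW _ _ R TW) := ground_space_strip hT.
Let Wfin : forall n, m (stripW TW n) < +oo := stripW_fin hT TWfin.

Definition initial_points (w : Om) : set E := trim (stripW TW) (upper_points w).

(** On this event neither the restriction to positive heights nor trimming
    changes the configuration. *)
Definition initial_regular : set Om :=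
  void (point_set Lam pt) (~` [set p | (0 < p.2)%R]) `&`
  locally_finite (stripW TW) upper_points.

Lemma measurable_initial_regular : measurable initial_regular.
Proof.
apply: measurableI; last exact: (measurable_locally_finite hE void_law_initial).
by apply: measurable_void_points; exact: measurableC.
Qed.

Lemma initial_regular_full : Q (~` initial_regular) = 0.
Proof.
have ms : measurable (void (point_set Lam pt) (~` [set p | (0 < p.2)%R])).
  by apply: measurable_void_points; exact: measurableC.
rewrite /initial_regular setCI null_set_setU//.
- exact: measurableC.
- by apply: measurableC; exact: (measurable_locally_finite hE void_law_initial).
- have m0 : m (~` [set p : E | (0 < p.2)%R]) = 0.
    by rewrite -mass_upper ?setICl ?measure0//; exact: measurableC.
  transitivity (1 - Q (void (point_set Lam pt) (~` [set p : E | (0 < p.2)%R]))).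
    exact: probability_setC.
  rewrite prob_void_points.
  + by rewrite m0 oppe0 expeR0 subee.
  + exact: measurableC.
  + by rewrite m0 ltry.
- exact: (locally_finite_full hE (strip_diffuse mu) Wfin void_law_initial).
Qed.

Lemma initial_pointsE w : initial_regular w ->
  initial_points w = point_set Lam pt w /\
  forall p, point_set Lam pt w p -> (0 < p.2)%R.
Proof.
move=> [hv hf]; have pos p : point_set Lam pt w p -> (0 < p.2)%R.
  move=> hp; apply: contrapT => np; suff : (set0 : set E) p by [].
  by rewrite -hv.
split => //; rewrite /initial_points trim_id//.
by rewrite /upper_points setIidl// => p /pos.
Qed.

End initial_points.

(** * The chain carried by the Poisson process *)

Lemma expectation_image d (Om : measurableType d) (R : realType)
    dT (T : measurableType dT) (P : {finite_measure set Om -> \bar R}) (X : Om -> T)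
    (f : T -> \bar R) (mX : measurable_fun setT X) :
  measurable_fun setT f -> (forall x, 0 <= f x) ->
  \int[P]_w f (X w) = \int[image_measure P mX]_x f x.
Proof. by move=> mf f0; apply/esym; exact: ge0_integral_pushforward. Qed.

Section image_laws.
Context d (Om : measurableType d) (R : realType).
Context dT (T : measurableType dT).

Lemma expectation_eq d' (Om' : measurableType d')
    (P : {finite_measure set Om -> \bar R})
    (Q : {finite_measure set Om' -> \bar R}) (X : Om -> T) (Y : Om' -> T)
    (f : T -> \bar R) :
  measurable_fun setT X -> measurable_fun setT Y ->
  (forall B, measurable B -> P (X @^-1` B) = Q (Y @^-1` B)) ->
  measurable_fun setT f -> (forall x, 0 <= f x) ->
  \int[P]_w f (X w) = \int[Q]_w f (Y w).
Proof.
move=> mX mY e mf f0; rewrite (expectation_image P mX)// (expectation_image Q mY)//.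
by apply: eq_measure_integral => B mB _; exact: e.
Qed.

Lemma expectation_density (P : {finite_measure set Om -> \bar R})
    (mu : {sigma_finite_measure set T -> \bar R}) (X : Om -> T)
    (u f : T -> \bar R) :
  measurable_fun setT X -> measurable_fun setT u -> (forall x, 0 <= u x) ->
  (forall B, measurable B -> P (X @^-1` B) = \int[mu]_(x in B) u x) ->
  measurable_fun setT f -> (forall x, 0 <= f x) ->
  \int[P]_w f (X w) = \int[mu]_x (f x * u x).
Proof.
move=> mX mu_ u0 e mf f0; rewrite (expectation_image P mX)//.
exact: (ge0_integral_density (nu := image_measure P mX)).
Qed.

End image_laws.

Section explored_chain.
Context {dT : measure_display} {T : measurableType dT} {R : realType}.
Local Notation E := (T * measurableTypeR R)%type.
Variables (TU TW : nat -> set T).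
Hypothesis hT : ground_space TU TW.
Variable mu : {sigma_finite_measure set T -> \bar R}.
Hypothesis TWfin : forall n, mu (TW n) < +oo.
Local Notation m := (strip_measure mu).
Context d (Om : measurableType d) (Q : probability Om R).
Variables (Lam : Om -> set nat) (pt : nat -> Om -> T * R).
Hypothesis heta : poisson_point_process Q (slt_intensity mu) Lam pt.
Variables (D : T) (g0 : T -> R) (g : T -> T -> R).
Hypothesis hg0 : probability_density mu g0.
Hypothesis hg : transition_density mu g.
Local Notation p0 := ((D, 0%R) : E).
Local Notation jump := (jump_density g0 g).
Local Notation slt w n := (soft_local_time g0 g (point_set Lam pt w) p0 n).

Let hE : ground_space (stripU TU) (@stripW _ _ R TW) := ground_space_strip hT.

Let g0_ge0 z : (0 <= g0 z)%R.
Proof. by have [_ h _] := hg0; exact: h. Qed.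

Let g_ge0 y z : (0 <= g y z)%R.
Proof. by have [_ h _] := td_density hg y; exact: h. Qed.

Lemma jump_density_ge0 k y z : (0 <= jump k y z)%R.
Proof. by case: k => [|k]; [exact: g0_ge0|exact: g_ge0]. Qed.

Lemma measurable_jump_density k :
  measurable_fun setT (fun p : T * T => jump k p.1 p.2).
Proof.
case: k => [|k]; last exact: (td_measurable hg).
by have [h _ _] := hg0; exact: (measurableT_comp h).
Qed.

Lemma jump_density_mass k y : \int[mu]_z (jump k y z)%:E = 1.
Proof.
case: k => [|k]; first by have [_ _ h] := hg0.
by have [_ _ h] := td_density hg y.
Qed.

Definition explored_position k (w : Om) : T :=
  position TW p0 g0 g (initial_points TW Lam pt w) k.

Definition explored_points k (w : Om) : set E :=
  remaining TW p0 g0 g (initial_points TW Lam pt w) k.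

Local Notation Y := explored_position.
Local Notation N := explored_points.

Let YS k : Y k.+1 = next_Y p0 (Y k) (N k) (jump k).
Proof. by apply/funext => w; rewrite /Y positionS. Qed.

Let NS k : N k.+1 = next_N TW p0 (Y k) (N k) (jump k).
Proof. by apply/funext => w; rewrite /N remainingS. Qed.

(** The invariant of the iteration. *)
Let state k : [/\ void_law m Q (Y k) (N k), random_points (stripW TW) (N k) &
  forall w p, N k w p -> (0 < p.2)%R].
Proof.
elim: k => [|k [lawN finN posN]].
  have law0 := void_law_initial heta D; split.
  - exact: (void_law_trim hE (strip_diffuse mu) (stripW_fin hT TWfin) law0).
  - exact: (random_points_trim hE law0).
  - by move=> w p /trim_sub[].
rewrite YS NS; split.
- exact: (void_law_next p0 hT TWfin lawN finN posN (measurable_jump_density k)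
    (jump_density_ge0 k) (jump_density_mass k)).
- exact: (random_points_next p0 hT TWfin lawN finN posN (measurable_jump_density k)
    (jump_density_ge0 k) (jump_density_mass k)).
- by move=> w p; exact: next_points_pos.
Qed.

Lemma measurable_explored_position k : measurable_fun setT (Y k).
Proof. by have [h _ _] := state k; exact: (vl_fun h). Qed.

(** The event of probability one on which the exploration is the soft local time
    construction. *)
Definition regular_exploration : set Om := initial_regular TW Lam pt `&`
  \bigcap_k regular TW p0 (Y k) (N k) (jump k).

Lemma measurable_regular_exploration : measurable regular_exploration.
Proof.
apply: measurableI; first exact: (measurable_initial_regular hT heta D).
apply: bigcapT_measurable => k; have [h1 h2 h3] := state k.
exact: (measurable_regular p0 hT TWfin h1 h2 h3 (measurable_jump_density k)
    (jump_density_ge0 k) (jump_density_mass k)).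
Qed.

Lemma regular_exploration_full : Q (~` regular_exploration) = 0.
Proof.
have mreg k : measurable (regular TW p0 (Y k) (N k) (jump k)).
  have [h1 h2 h3] := state k.
  exact: (measurable_regular p0 hT TWfin h1 h2 h3 (measurable_jump_density k)
      (jump_density_ge0 k) (jump_density_mass k)).
rewrite /regular_exploration setCI setC_bigcap null_set_setU//.
- by apply: measurableC; exact: (measurable_initial_regular hT heta D).
- by apply: bigcupT_measurable => k; exact: measurableC.
- exact: (initial_regular_full hT TWfin heta D).
apply: measure_bigcup_null => [k|k]; first exact: measurableC.
have [h1 h2 h3] := state k.
exact: (regular_full p0 hT TWfin h1 h2 h3 (measurable_jump_density k)
      (jump_density_ge0 k) (jump_density_mass k)).
Qed.

Let regularP w : regular_exploration w ->
  [/\ initial_points TW Lam pt w = point_set Lam pt w,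
      (forall p, point_set Lam pt w p -> (0 < p.2)%R) &
      forall k, regular_step TW p0 g0 g (point_set Lam pt w) k].
Proof.
move=> [/initial_pointsE[wE wpos] hreg]; split => // k.
by have [h1 h2] := hreg k I; rewrite -wE; split.
Qed.

Lemma explored_chain w n : regular_exploration w ->
  slt_chain g0 g (point_set Lam pt w) p0 n.+1 = Some (Y n.+1 w).
Proof.
move=> /regularP[wE wpos wreg].
by rewrite (slt_chain_position g0_ge0 g_ge0 wpos wreg) /Y wE.
Qed.

Lemma explored_jump w n : regular_exploration w ->
  (0 < jump n (Y n w) (Y n.+1 w))%R.
Proof.
move=> /regularP[wE wpos wreg].
by have := position_density wreg n; rewrite /Y wE.
Qed.

(** A measurable version of the waiting time. *)
Let clock k w := exit_time (Y k) (N k) (jump k) w.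

Let clockE k w : regular_exploration w ->
  clock k w = (waiting TW p0 g0 g (point_set Lam pt w) k)%:E.
Proof.
move=> hw; have [wE wpos wreg] := regularP hw.
have [_ _ posN] := state k; have [[p hp] _] := wreg k.
rewrite -wE in hp; rewrite /clock (exit_time_sel posN (jump_density_ge0 k) hp).
by rewrite -wE /waiting (selectedP p0 hp).
Qed.

Let soft_local_timeE w n z : regular_exploration w ->
  (slt w n z)%:E = \sum_(k < n) clock k w * (jump k (Y k w) z)%:E.
Proof.
move=> hw; have [wE wpos wreg] := regularP hw.
rewrite (soft_local_time_sum g0_ge0 g_ge0 wpos wreg) -sumEFin.
by apply: eq_bigr => k _; rewrite clockE// /Y wE.
Qed.

(** Mean density of the step from Y_k, and density of Y_{k+1}. *)
Definition occupation k z : \bar R := \int[Q]_w (jump k (Y k w) z)%:E.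

Let measurable_jump_at k :
  measurable_fun setT (fun p : Om * T => (jump k (Y k p.1) p.2)%:E).
Proof.
apply/measurable_EFinP.
apply: (measurableT_comp (measurable_jump_density k)
  (g := fun p : Om * T => (Y k p.1, p.2))).
apply: measurable_fun_pair => //.
exact: (measurableT_comp (measurable_explored_position k)).
Qed.

Lemma occupation_ge0 k z : 0 <= occupation k z.
Proof.
by apply: integral_ge0 => w _; rewrite lee_fin; exact: jump_density_ge0.
Qed.

Lemma measurable_occupation k : measurable_fun setT (occupation k).
Proof.
apply: (@measurable_fun_fubini_tonelli_G _ _ Om T R Q
  (fun p => (jump k (Y k p.1) p.2)%:E)) => //.
by move=> p; rewrite lee_fin; exact: jump_density_ge0.
Qed.

Lemma law_explored_position k B : measurable B ->
  Q (Y k.+1 @^-1` B) = \int[Q]_w \int[mu]_(z in B) (jump k (Y k w) z)%:E.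
Proof.
move=> mB; have [h1 h2 h3] := state k; rewrite YS.
exact: (law_next_Y p0 hT TWfin h1 h2 h3 (measurable_jump_density k)
      (jump_density_ge0 k) (jump_density_mass k)).
Qed.

(** Tonelli, from the law of the new position. *)
Lemma density_explored_position k B : measurable B ->
  Q (Y k.+1 @^-1` B) = \int[mu]_(z in B) occupation k z.
Proof.
move=> mB; rewrite law_explored_position//.
have mf : measurable_fun setT (fun p : Om * T =>
    (\1_B p.2)%:E * (jump k (Y k p.1) p.2)%:E).
  apply: emeasurable_funM => //; apply/measurable_EFinP.
  exact: (measurableT_comp (f := \1_B : T -> R)).
have f0 (p : Om * T) : 0 <= (\1_B p.2)%:E * (jump k (Y k p.1) p.2)%:E.
  by rewrite mule_ge0// lee_fin jump_density_ge0.
have e : \int[Q]_w \int[mu]_z ((\1_B z)%:E * (jump k (Y k w) z)%:E) =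
    \int[mu]_z \int[Q]_w ((\1_B z)%:E * (jump k (Y k w) z)%:E).
  exact: (fubini_tonelli _ mf f0).
transitivity (\int[Q]_w \int[mu]_z ((\1_B z)%:E * (jump k (Y k w) z)%:E)).
  by apply: eq_integral => w _; rewrite ge0_integral_indic setTI.
rewrite e -[in RHS](setTI B) -ge0_integral_indic; apply: eq_integral => z _.
rewrite ge0_integralZl//.
- exact: (measurableT_comp (measurable_jump_at k) (measurable_pair2 _)).
- by move=> w _; rewrite lee_fin jump_density_ge0.
Qed.

Let slt_ge0 pts n z : (0 <= soft_local_time g0 g pts p0 n z)%R.
Proof.
elim: n => [|n IH]//.
rewrite /soft_local_time /slt_state iterS -/(slt_state g0 g pts p0 n) /slt_step.
move: IH; rewrite /soft_local_time; case: (slt_state _ _ _ _ n) => used G /= G0.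
rewrite addr_ge0// mulr_ge0//; last by rewrite /density_from; case: slt_position.
rewrite /slt_xi; set A := [set t | _].
have [->|/set0P A0] := eqVneq A set0; first by rewrite inf0.
by apply: lb_le_inf => // t [].
Qed.

Lemma soft_local_time_nd pts z :
  nondecreasing_seq (fun n => soft_local_time g0 g pts p0 n z).
Proof.
apply/nondecreasing_seqP => n.
rewrite {2}/soft_local_time /slt_state iterS -/(slt_state g0 g pts p0 n) /slt_step.
rewrite /soft_local_time; case: (slt_state _ _ _ _ n) => used G /=.
rewrite lerDl mulr_ge0//; last by rewrite /density_from; case: slt_position.
rewrite /slt_xi; set A := [set t | _].
have [->|/set0P A0] := eqVneq A set0; first by rewrite inf0.
by apply: lb_le_inf => // t [].
Qed.

Let expected_clock k z :
  \int[Q]_w (clock k w * (jump k (Y k w) z)%:E) = occupation k z.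
Proof.
have [h1 h2 h3] := state k.
apply: (expected_exit_time hT TWfin h1 h2 (measurable_jump_density k)
      (jump_density_ge0 k) (jump_density_mass k)
  (phi := fun y => (jump k y z)%:E)).
- apply/measurable_EFinP.
  exact: (measurableT_comp (measurable_jump_density k) (measurable_pair2 _)).
- by move=> y; rewrite lee_fin jump_density_ge0.
Qed.

Let measurable_clock k : measurable_fun setT (clock k).
Proof.
have [h1 h2 h3] := state k.
exact: (measurable_exit_time hT h1 h2 (measurable_jump_density k)).
Qed.

Let measurable_increment k z :
  measurable_fun setT (fun w => clock k w * (jump k (Y k w) z)%:E).
Proof.
apply: emeasurable_funM; first exact: measurable_clock.
exact: (measurableT_comp (measurable_jump_at k) (measurable_pair2 _)).
Qed.

Let increment_ge0 k z w : 0 <= clock k w * (jump k (Y k w) z)%:E.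
Proof. by rewrite mule_ge0 ?exit_time_ge0// lee_fin jump_density_ge0. Qed.

(** Each waiting time has mean one given the position. *)
Lemma expected_soft_local_time n z :
  \int[Q]_w (slt w n z)%:E = \sum_(k < n) occupation k z.
Proof.
transitivity (\int[Q]_w \sum_(k < n) (clock k w * (jump k (Y k w) z)%:E)).
  apply: (ge0_integral_off_null measurable_regular_exploration
    regular_exploration_full).
  - by move=> w; rewrite lee_fin; exact: slt_ge0.
  - by move=> w; apply: sume_ge0 => k _; exact: increment_ge0.
  - by apply: emeasurable_sum => k; exact: measurable_increment.
  - by move=> w; exact: soft_local_timeE.
rewrite ge0_integral_sum//.
by apply: eq_bigr => k _; exact: expected_clock.
Qed.

Lemma soft_local_time_limit w z : regular_exploration w ->
  limn (fun n => (slt w n z)%:E) =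
  \sum_(k <oo) (clock k w * (jump k (Y k w) z)%:E).
Proof.
move=> hw; congr (lim (_ @ \oo)); apply/funext => n.
by rewrite soft_local_timeE// big_mkord.
Qed.

(** Once the chain has reached D it stays there, and jumps from D do not
    increase the soft local time away from D: the soft local time at the
    hitting time of D is the limit of the soft local times. *)
Lemma expected_soft_local_time_hitting (h : cemetery mu g D) z : z <> D ->
  \int[Q]_w soft_local_time_at g0 g (point_set Lam pt w) p0
    (hitting_time (fun k => slt_chain g0 g (point_set Lam pt w) p0 k = Some D)) z
  = \sum_(k <oo) occupation k z.
Proof.
move=> zD; have [_ gD] := h.
have -> : \sum_(k <oo) occupation k z =
    \int[Q]_w \sum_(k <oo) (clock k w * (jump k (Y k w) z)%:E).
  rewrite integral_nneseries//.
  by apply: eq_eseriesr => k _; rewrite expected_clock.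
apply: (ge0_integral_off_null measurable_regular_exploration
  regular_exploration_full).
- move=> w; rewrite /soft_local_time_at; case: hitting_time => [n|].
    by rewrite lee_fin; exact: slt_ge0.
  apply: lime_ge; last by apply: nearW => n; rewrite lee_fin; exact: slt_ge0.
  apply: ereal_nondecreasing_is_cvgn => i j ij; rewrite lee_fin.
  exact: soft_local_time_nd.
- by move=> w; apply: nneseries_ge0 => k _ _; exact: increment_ge0.
- by apply: ge0_emeasurable_sum => // k w _ _; exact: increment_ge0.
move=> w hw; rewrite -soft_local_time_limit// /hitting_time.
case: pselect => [hit|//].
set n := ex_minn hit.
have [n0 nD] : (0 < n)%N /\ Y n w = D.
  rewrite /n; case: ex_minnP => -[//|j] /andP[_ /asboolP].
  by rewrite explored_chain// => -[].
have stay j : (n <= j)%N -> Y j w = D.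
  elim: j => [|j IH]; first by rewrite leqn0 => /eqP n00; rewrite n00 in n0.
  rewrite leq_eqVlt => /orP[/eqP <-//|]; rewrite ltnS => nj.
  have := explored_jump j hw; rewrite (IH nj).
  case: j nj {IH} => [|j] nj; first by move: n0; rewrite lt0n -leqn0 nj.
  rewrite /= gD indicE; case: (boolP (_ \in _)) => [/set_mem//|_].
  by rewrite ltxx.
have const j : (n <= j)%N -> slt w j z = slt w n z.
  elim: j => [|j IH]; first by rewrite leqn0 => /eqP ->.
  rewrite leq_eqVlt => /orP[/eqP <-//|]; rewrite ltnS => nj.
  rewrite -(IH nj); apply: EFin_inj; rewrite !soft_local_timeE// big_ord_recr/=.
  rewrite (stay _ nj); case: j nj {IH} => [|j] nj.
    by move: n0; rewrite lt0n -leqn0 nj.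
  by rewrite /= gD indicE memNset ?mule0 ?adde0//; exact: zD.
rewrite /soft_local_time_at; apply/esym/cvg_lim => //.
apply: cvg_near_cst; exists n => // j /= nj.
by rewrite const.
Qed.

End explored_chain.

(** * Comparison with the Markov chain *)

Lemma nneseriesZl_ereal (R : realType) (x : \bar R) (u : nat -> \bar R) :
  0 <= x -> (forall k, 0 <= u k) ->
  x * \sum_(k <oo) u k = \sum_(k <oo) (x * u k).
Proof.
move=> x0 u0; rewrite -!ge0_integral_count//.
  by rewrite ge0_integralZl.
by move=> k; exact: mule_ge0.
Qed.

Section markov_chain_law.
Context {dT : measure_display} {T : measurableType dT} {R : realType}.
Variables (TU TW : nat -> set T).
Hypothesis hT : ground_space TU TW.
Variable mu : {sigma_finite_measure set T -> \bar R}.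
Hypothesis TWfin : forall n, mu (TW n) < +oo.
Variables (D : T) (g0 : T -> R) (g : T -> T -> R).
Hypothesis hg0 : probability_density mu g0.
Hypothesis hg : transition_density mu g.
Context d (Om : measurableType d) (P : probability Om R).
Variable Z : nat -> Om -> T.
Hypothesis hZ : markov_chain P mu g0 g Z.
Context d' (Om' : measurableType d') (Q : probability Om' R).
Variables (Lam : Om' -> set nat) (pt : nat -> Om' -> T * R).
Hypothesis heta : poisson_point_process Q (slt_intensity mu) Lam pt.

Local Notation Y := (explored_position TW Lam pt D g0 g).
Local Notation occ := (occupation TW Q Lam pt D g0 g).

Let mY k : measurable_fun setT (Y k).
Proof. exact: (measurable_explored_position hT TWfin heta D hg0 hg). Qed.

Let mZ k : measurable_fun setT (Z k.+1).
Proof. exact: (mc_measurable hZ). Qed.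

(** Both sequences start from the density g0 and move by the kernel with density
    g, so their marginals agree by induction. *)
Lemma chain_law_eq k B : measurable B ->
  P (Z k.+1 @^-1` B) = Q (Y k.+1 @^-1` B).
Proof.
elim: k B => [|k IH] B mB.
  rewrite (mc_initial hZ mB) (law_explored_position hT TWfin heta D hg0 hg)//=.
  rewrite integral_cst// [X in _ = _ * X](_ : _ = 1) ?mule1//.
  exact: probability_setT.
have pastT : past Z k.+1 setT.
  have := sub_sigma_algebra (D := setT) (G := [set F | exists j,
    (1 <= j <= k.+1)%N /\ exists2 B, measurable B & F = Z j @^-1` B]).
  by apply; exists 1%N; split => //; exists setT => //; rewrite preimage_setT.
have := mc_transition hZ (ltn0Sn k) mB pastT; rewrite setTI => ->.
rewrite (law_explored_position hT TWfin heta D hg0 hg)//=.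
apply: (expectation_eq (f := fun y => \int[mu]_(z in B) (g y z)%:E)) => //.
- apply: (measurable_density_mass _ _ _ mB); first exact: (td_measurable hg).
  by move=> x z; have [_ h _] := td_density hg x; exact: h.
- move=> y; apply: integral_ge0 => z _; rewrite lee_fin.
  by have [_ h _] := td_density hg y; exact: h.
Qed.

(** The marginal law of the chain has density u_k. *)
Lemma expectation_chain k (f : T -> \bar R) : measurable_fun setT f ->
  (forall z, 0 <= f z) ->
  \int[P]_w f (Z k.+1 w) = \int[mu]_z (f z * occ k z).
Proof.
move=> mf f0; apply: expectation_density => //.
- exact: (measurable_occupation hT TWfin heta D hg0 hg).
- by move=> z; exact: (occupation_ge0 _ _ _ _ _ hg0 hg).
- move=> B mB; transitivity (Q (Y k.+1 @^-1` B)); first exact: chain_law_eq.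
  exact: (density_explored_position hT TWfin heta D hg0 hg).
Qed.

Lemma expectation_chain_sum n (f : T -> \bar R) : measurable_fun setT f ->
  (forall z, 0 <= f z) ->
  \int[P]_w (\sum_(k < n) f (Z k.+1 w)) = \int[mu]_z (f z * \sum_(k < n) occ k z).
Proof.
move=> mf f0; rewrite ge0_integral_sum//; last first.
  by move=> k; exact: measurableT_comp.
under eq_bigr do rewrite expectation_chain//.
have o0 k z : 0 <= occ k z by exact: (occupation_ge0 _ _ _ _ _ hg0 hg).
have mo k : measurable_fun setT (occ k).
  exact: (measurable_occupation hT TWfin heta D hg0 hg).
rewrite -ge0_integral_sum//.
- by apply: eq_integral => z _; rewrite ge0_sume_distrr.
- by move=> k; exact: emeasurable_funM.
- by move=> k z _; exact: mule_ge0.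
Qed.

Lemma expectation_chain_series (f : T -> \bar R) : measurable_fun setT f ->
  (forall z, 0 <= f z) ->
  \int[P]_w (\sum_(k <oo) f (Z k.+1 w)) = \int[mu]_z (f z * \sum_(k <oo) occ k z).
Proof.
move=> mf f0; rewrite integral_nneseries//; last first.
  by move=> k; exact: measurableT_comp.
under eq_eseriesr do rewrite expectation_chain//.
have o0 k z : 0 <= occ k z by exact: (occupation_ge0 _ _ _ _ _ hg0 hg).
have mo k : measurable_fun setT (occ k).
  exact: (measurable_occupation hT TWfin heta D hg0 hg).
rewrite -integral_nneseries//.
- by apply: eq_integral => z _; rewrite nneseriesZl_ereal.
- by move=> k; exact: emeasurable_funM.
- by move=> k z _; exact: mule_ge0.
Qed.

Hypothesis hD : cemetery mu g D.

(** Has probability one since g(D, .) vanishes off D. *)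
Definition absorbed : set Om :=
  \bigcap_k ~` (Z k.+1 @^-1` [set D] `&` Z k.+2 @^-1` (~` [set D])).

Let mD : measurable [set D].
Proof. exact: (measurable_point (gs_measurableU hT) (gs_separated hT)). Qed.

Let mleave k : measurable (Z k.+1 @^-1` [set D] `&` Z k.+2 @^-1` (~` [set D])).
Proof.
have mpre j B : measurable B -> measurable (Z j.+1 @^-1` B).
  by move=> mB; rewrite -[X in measurable X]setTI; exact: mZ.
by apply: measurableI; apply: mpre => //; exact: measurableC.
Qed.

Lemma measurable_absorbed : measurable absorbed.
Proof. by apply: bigcapT_measurable => k; exact: measurableC. Qed.

Lemma absorbed_full : P (~` absorbed) = 0.
Proof.
rewrite /absorbed setC_bigcap; under eq_bigcupr do rewrite setCK.
apply: measure_bigcup_null => // k.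
have [_ gD] := hD.
have pastD : past Z k.+1 (Z k.+1 @^-1` [set D]).
  have := sub_sigma_algebra (D := setT) (G := [set F | exists j,
    (1 <= j <= k.+1)%N /\ exists2 B, measurable B & F = Z j @^-1` B]).
  by apply; exists k.+1; split; rewrite ?leqnn//; exists [set D].
apply: (etrans (mc_transition hZ (ltn0Sn k) (measurableC mD) pastD)).
apply: integral0_eq => w /= ->; apply: integral0_eq => z /= zD.
by rewrite gD indicE memNset.
Qed.

(** The test function vanishes at D, where the chain sits after it is hit. *)
Lemma sum_until_hitting w (f : T -> \bar R) : absorbed w -> (forall z, 0 <= f z) ->
  f D = 0 ->
  sum_until (hitting_time (fun k => Z k w = D)) (fun k => f (Z k w)) =
  \sum_(k <oo) f (Z k.+1 w).
Proof.
move=> hw f0 fD.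
have shift n : \sum_(1 <= k < n.+1) f (Z k w) = \sum_(0 <= k < n) f (Z k.+1 w).
  by rewrite big_add1.
rewrite /hitting_time; case: pselect => [hit|_] /=; last first.
  rewrite -(@nneseries_addn _ (fun k => f (Z k w)) 1)//.
  by apply: eq_eseriesr => k _; rewrite addn1.
set n := ex_minn hit; have [n0 nD] : (0 < n)%N /\ Z n w = D.
  by rewrite /n; case: ex_minnP => j /andP[j0 /asboolP].
have stay j : (n <= j)%N -> Z j w = D.
  elim: j => [|j IH]; first by rewrite leqn0 => /eqP n00; rewrite n00 in n0.
  rewrite leq_eqVlt => /orP[/eqP <-//|]; rewrite ltnS => nj.
  case: j nj IH => [|j] nj IH; first by move: n0; rewrite lt0n -leqn0 nj.
  by apply: contrapT => njD; apply: (hw j I); split => //=; exact: IH.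
rewrite shift; apply/esym/cvg_lim => //.
apply: cvg_near_cst; exists n => // j /= nj.
rewrite (big_cat_nat (leq0n n) nj)/= [X in _ + X](_ : _ = 0) ?adde0//.
by rewrite big_nat big1// => i /andP[ni _]; rewrite stay ?fD// ltnW.
Qed.

End markov_chain_law.

Section local_time_density.
Context {dT : measure_display} {T : measurableType dT} {R : realType}.
Variables (TU TW : nat -> set T).
Hypothesis hT : ground_space TU TW.
Variable mu : {sigma_finite_measure set T -> \bar R}.
Hypothesis TWfin : forall n, mu (TW n) < +oo.
Variables (D : T) (g0 : T -> R) (g : T -> T -> R).
Hypothesis hg0 : probability_density mu g0.
Hypothesis hg : transition_density mu g.
Hypothesis hD : cemetery mu g D.
Context d (Om : measurableType d) (P : probability Om R).
Variable Z : nat -> Om -> T.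
Hypothesis hZ : markov_chain P mu g0 g Z.
Context d' (Om' : measurableType d') (Q : probability Om' R).
Variables (Lam : Om' -> set nat) (pt : nat -> Om' -> T * R).
Hypothesis heta : poisson_point_process Q (slt_intensity mu) Lam pt.
Local Notation p0 := ((D, 0%R) : T * R).
Local Notation occ := (occupation TW Q Lam pt D g0 g).

Let occ_ge0 k z : 0 <= occ k z.
Proof. exact: (occupation_ge0 _ _ _ _ _ hg0 hg). Qed.

Let measurable_occ k : measurable_fun setT (occ k).
Proof. exact: (measurable_occupation hT TWfin heta D hg0 hg). Qed.

Lemma deterministic_time n : expected_local_time_density P mu D Z (fun=> Some n)
  (fun z => \int[Q]_w soft_local_time_at g0 g (point_set Lam pt w) p0 (Some n) z).
Proof.
have e z : \int[Q]_w soft_local_time_at g0 g (point_set Lam pt w) p0 (Some n) z =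
    \sum_(k < n) occ k z.
  exact: (expected_soft_local_time hT TWfin heta D hg0 hg).
split; first by under eq_fun do rewrite e; exact: emeasurable_sum.
move=> f mf f0 fD; under [RHS]eq_integral do rewrite e.
rewrite -(expectation_chain_sum hT TWfin D hg0 hg hZ heta)//.
by apply: eq_integral => w _; rewrite /= big_add1/= big_mkord.
Qed.

(** Away from D the density is the sum of all u_k; at D the test function
    vanishes. *)
Lemma hitting_time_cemetery : expected_local_time_density P mu D Z
  (fun w => hitting_time (fun k => Z k w = D))
  (fun z => \int[Q]_w soft_local_time_at g0 g (point_set Lam pt w) p0
    (hitting_time (fun k =>
       slt_chain g0 g (point_set Lam pt w) p0 k = Some D)) z).
Proof.
set h := fun z : T => \int[Q]_w _.
have e z : z <> D -> h z = \sum_(k <oo) occ k z.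
  exact: (expected_soft_local_time_hitting hT TWfin heta hg0 hg hD).
have mD : measurable [set D].
  exact: (measurable_point (gs_measurableU hT) (gs_separated hT)).
have mocc : measurable_fun setT (fun z => \sum_(k <oo) occ k z).
  exact: ge0_emeasurable_sum.
split.
  rewrite -(setUv [set D]); apply/measurable_funU => //; first exact: measurableC.
  split; first exact: measurable_fun_set1.
  apply: (eq_measurable_fun (fun z => \sum_(k <oo) occ k z)).
    by move=> z /set_mem zD; rewrite e.
  exact: measurable_funTS.
move=> f mf f0 fD.
transitivity (\int[mu]_z (f z * \sum_(k <oo) occ k z)); last first.
  apply: eq_integral => z _; have [->|/eqP zD] := eqVneq z D; last by rewrite e.
  by rewrite fD !mul0e.
rewrite -(expectation_chain_series hT TWfin D hg0 hg hZ heta)//.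
apply: (ge0_integral_off_null (measurable_absorbed hT D hZ)
  (absorbed_full hT hZ hD)).
- move=> w; rewrite /sum_until; case: hitting_time => [n|].
    exact: sume_ge0.
  by apply: nneseries_ge0.
- by move=> w; exact: nneseries_ge0.
- apply: ge0_emeasurable_sum => // k _; apply: measurableT_comp => //.
  exact: (mc_measurable hZ).
- by move=> w hw; exact: sum_until_hitting.
Qed.

End local_time_density.

Theorem theorem4p6 (R : realType) (S : completeMetricType R)
  (hsep : separable S) (hlc : locally_compact [set: S])
  (mu : {measure set (borel S) -> \bar R}) (hmu : radon_measure mu)
  (g0 : borel S -> R) (hg0 : probability_density mu g0)
  (g : borel S -> borel S -> R) (hg : transition_density mu g)
  (D : borel S) (hD : cemetery mu g D)
  (d : measure_display) (Om : measurableType d) (P : probability Om R)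
  (Z : nat -> Om -> borel S) (hZ : markov_chain P mu g0 g Z)
  (d' : measure_display) (Om' : measurableType d') (Q : probability Om' R)
  (Lam : Om' -> set nat) (pt : nat -> Om' -> borel S * R)
  (heta : poisson_point_process Q (slt_intensity mu) Lam pt) :
  let eta w := point_set Lam pt w in
  let p0 : borel S * R := (D, 0%R) in
  let z_ w k := slt_chain g0 g (eta w) p0 k in
  let G w := soft_local_time_at g0 g (eta w) p0 in
  let tauP w := hitting_time (fun k => Z k w = D) in
  let tauQ w := hitting_time (fun k => z_ w k = Some D) in
  expected_local_time_density P mu D Z tauP
    (fun z => \int[Q]_w G w (tauQ w) z) /\
  (forall n : nat, expected_local_time_density P mu D Z (fun=> Some n)
    (fun z => \int[Q]_w G w (Some n) z)).
Proof.
have [TU [TW [hT TWfin]]] := borel_ground_space hsep hmu hlc.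
have sfin : sigma_finite setT mu.
  exists TW; first by rewrite (gs_cover hT).
  by move=> n; split; [exact: (gs_measurableW hT)|exact: TWfin].
pose m : {sigma_finite_measure set (borel S) -> \bar R} := exhausted_measure sfin.
split=> [|n].
- exact: (hitting_time_cemetery (mu := m) hT TWfin hg0 hg hD hZ heta).
- exact: (deterministic_time (mu := m) hT TWfin D hg0 hg hZ heta).
Qed.
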